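(* Let $d\ge1$ and $0<q_0<1$. Then there exist constants $0<C,C'<\infty$ (which depend only on $d$ and $q_0$) such that the following results hold. (Quenched case) For all $0<p<q<1$, $$\inf_{x\in\mathbb{R}^d\setminus\{0\}}\frac{I_p(x)-I_q(x)}{\|x\|_1}\ge(1-e^{-1})(q-p),$$ and for all $0<p<q\le q_0$, $$\sup_{x\in\mathbb{R}^d\setminus\{0\}}\frac{I_p(x)-I_q(x)}{\|x\|_1}\le C(q-p).$$ (Annealed case) For all $0<p<q<1$, $$\inf_{x\in\mathbb{R}^d\setminus\{0\}}\frac{J_p(x)-J_q(x)}{\|x\|_1}\ge(1-e^{-1})(q-p),$$ and for all $0<p<q\le q_0$, $$\sup_{x\in\mathbb{R}^d\setminus\{0\}}\frac{J_p(x)-J_q(x)}{\|x\|_1}\le C'(\log q-\log p).$$ In particular, if $d\ge3$, then the right side of the last inequality can be replaced by $C'(q-p)$.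
   Context: $(S_k)_{k\ge0}$ is the simple (symmetric nearest-neighbor) random walk on $\mathbb{Z}^d$; $E^x$ is its expectation when started at $x$. $H(y):=\inf\{k\ge 0: S_k=y\}$. For a potential $\omega\in[0,\infty)^{\mathbb{Z}^d}$, $$e(x,y,\omega):=E^x\Bigl[\exp\Bigl\{-\sum_{k=0}^{H(y)-1}\omega(S_k)\Bigr\}\mathbf{1}_{\{H(y)<\infty\}}\Bigr]$$ (with $e(x,x,\omega)=1$), and $a(x,y,\omega):=-\log e(x,y,\omega)$. For $0\le r\le 1$, $\mathbb{P}_r$ (expectation $\mathbb{E}_r$) is the law, independent of the walk, under which the $\omega(x)$, $x\in\mathbb{Z}^d$, are i.i.d. with $\mathbb{P}_r(\omega(x)=0)=1-\mathbb{P}_r(\omega(x)=1)=r$. For $\lambda\ge0$, write $\omega+\lambda:=(\omega(x)+\lambda)_{x\in\mathbb{Z}^d}$. The quenched and annealed Lyapunov exponents $\alpha_r(\lambda,\cdot)$ and $\beta_r(\lambda,\cdot)$ for the potential $\omega+\lambda$ are the norms on $\mathbb{R}^d$ determined by $$\alpha_r(\lambda,x)=\lim_{n\to\infty}\tfrac1n\mathbb{E}_r[a(0,nx,\omega+\lambda)],\qquad \beta_r(\lambda,x)=\lim_{n\to\infty}-\tfrac1n\log\mathbb{E}_r[e(0,nx,\omega+\lambda)]$$ for all $x\in\mathbb{Z}^d$ (it is known that such norms exist, that both limits are also infima over $n\in\mathbb{N}$, and that $\alpha_r(\lambda,x)$, $\beta_r(\lambda,x)$ are continuous in $(\lambda,x)\in[0,\infty)\times\mathbb{R}^d$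 and concave increasing in $\lambda$). For $x\in\mathbb{R}^d$ set $$I_r(x):=\sup_{\lambda\ge0}\{\alpha_r(\lambda,x)-\lambda\},\qquad J_r(x):=\sup_{\lambda\ge0}\{\beta_r(\lambda,x)-\lambda\}.$$ These are the rate functions of the quenched and annealed large deviation principles for $S_n/n$ in the Bernoulli potential; it is known that their effective domains (the sets where they are finite) equal the closed $\ell^1$-unit ball. $\|\cdot\|_1$ is the $\ell^1$-norm on $\mathbb{R}^d$. *)

(* Defs.v *)
From mathcomp Require Import all_boot all_order all_algebra.
From mathcomp Require Import all_classical all_reals all_analysis.

Set Implicit Arguments.
Unset Strict Implicit.
Unset Printing Implicit Defensive.

Import Order.TTheory GRing.Theory Num.Theory.
Import numFieldNormedType.Exports.

Local Open Scope classical_set_scope.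
Local Open Scope ring_scope.

(* Z^d is 'rV[int]_d and R^d is 'rV[R]_d.  The library norm `|x| on row
   vectors is the sup norm, hence the separate l^1 norm. *)
Definition l1norm (K : numDomainType) (d : nat) (x : 'rV[K]_d) : K :=
  \sum_(i < d) `|x 0 i|.

Definition lattice_embed (R : realType) (d : nat) (x : 'rV[int]_d) : 'rV[R]_d :=
  map_mx intr x.

Definition srw_kernel (R : realType) (d : nat) (x y : 'rV[int]_d) : R :=
  if l1norm (y - x) == 1 then (2 * d)%:R^-1 else 0.

(* [Px x] is the law of the walk started at [x]; the walk is characterised by
   its finite-dimensional distributions. *)
Definition simple_random_walk (R : realType) (d : nat)
    (dW : measure_display) (W : measurableType dW)
    (Px : 'rV[int]_d -> probability W R) (S : nat -> W -> 'rV[int]_d) : Prop :=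
  (forall k z, measurable [set w | S k w = z]) /\
  (forall (x : 'rV[int]_d) (n : nat) (g : nat -> 'rV[int]_d),
    Px x [set w | forall k, (k <= n)%N -> S k w = g k] =
    (if g 0%N == x then \prod_(k < n) srw_kernel R (g k) (g k.+1) else 0)%:E).

(* H(y), with [None] standing for H(y) = oo. *)
Definition hitting_time (d : nat) (s : nat -> 'rV[int]_d) (y : 'rV[int]_d) :
    option nat :=
  match pselect (exists k, s k == y) with
  | left h => Some (ex_minn h)
  | right _ => None
  end.

Definition hitting_weight (R : realType) (d : nat) (V : 'rV[int]_d -> R)
    (y : 'rV[int]_d) (s : nat -> 'rV[int]_d) : R :=
  if hitting_time s y is Some n then expR (- \sum_(k < n) V (s k)) else 0.

(* e(x, y, V); the expectation lies in [0, 1] when V >= 0, so [fine] is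
   harmless. *)
Definition travel_weight (R : realType) (d : nat)
    (dW : measure_display) (W : measurableType dW)
    (Px : 'rV[int]_d -> probability W R) (S : nat -> W -> 'rV[int]_d)
    (x y : 'rV[int]_d) (V : 'rV[int]_d -> R) : R :=
  fine ('E_(Px x)[fun w => hitting_weight V y (fun k => S k w)])%E.

(* a(x, y, V); for d >= 1 and V >= 0 the argument of [ln] is positive, so the
   convention [ln 0 = 0] plays no role. *)
Definition travel_cost (R : realType) (d : nat)
    (dW : measure_display) (W : measurableType dW)
    (Px : 'rV[int]_d -> probability W R) (S : nat -> W -> 'rV[int]_d)
    (x y : 'rV[int]_d) (V : 'rV[int]_d -> R) : R :=
  - ln (travel_weight Px S x y V).

Definition mutually_independent (R : realType) (I : choiceType)
    (dO : measure_display) (O : measurableType dO)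
    (P : probability O R) (X : I -> {mfun O >-> R}) : Prop :=
  forall (s : seq I) (A : I -> set R), uniq s ->
    (forall i, measurable (A i)) ->
    P [set o | forall i, i \in s -> A i (X i o)] =
    (\prod_(i <- s) P [set o | A i (X i o)])%E.

Definition bernoulli_potential (R : realType) (d : nat)
    (dO : measure_display) (O : measurableType dO)
    (r : R) (P : probability O R) (omega : 'rV[int]_d -> {mfun O >-> R}) : Prop :=
  [/\ forall z o, 0 <= omega z o,
      forall z, P [set o | omega z o = 0] = r%:E /\
                P [set o | omega z o = 1] = (1 - r)%:E
    & mutually_independent P omega].

Definition is_norm (R : realType) (d : nat) (N : 'rV[R]_d -> R) : Prop :=
  [/\ forall x y, N (x + y) <= N x + N y,
      forall (c : R) x, N (c *: x) = `|c| * N x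
    & forall x, N x = 0 -> x = 0].

(* [N] is the quenched Lyapunov exponent alpha_r(lam, .), where [P] is the law
   P_r of the potential [omega]. *)
Definition quenched_lyapunov (R : realType) (d : nat)
    (dW : measure_display) (W : measurableType dW)
    (Px : 'rV[int]_d -> probability W R) (S : nat -> W -> 'rV[int]_d)
    (dO : measure_display) (O : measurableType dO)
    (P : probability O R) (omega : 'rV[int]_d -> {mfun O >-> R})
    (lam : R) (N : 'rV[R]_d -> R) : Prop :=
  is_norm N /\
  forall x : 'rV[int]_d,
    ((n%:R^-1)%:E *
       'E_P[fun o => travel_cost Px S 0 (x *+ n)%R (fun z => omega z o + lam)%R])%E
      @[n --> \oo] --> (N (lattice_embed R x))%:E.

Definition annealed_lyapunov (R : realType) (d : nat)
    (dW : measure_display) (W : measurableType dW)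
    (Px : 'rV[int]_d -> probability W R) (S : nat -> W -> 'rV[int]_d)
    (dO : measure_display) (O : measurableType dO)
    (P : probability O R) (omega : 'rV[int]_d -> {mfun O >-> R})
    (lam : R) (N : 'rV[R]_d -> R) : Prop :=
  is_norm N /\
  forall x : 'rV[int]_d,
    - (n%:R^-1 * ln (fine
       ('E_P[fun o => travel_weight Px S 0 (x *+ n)%R (fun z => omega z o + lam)%R])%E))
      @[n --> \oo] --> N (lattice_embed R x).

(* I_r and J_r, with values in the extended reals, from the exponents
   [L lam x] = alpha_r(lam, x) and beta_r(lam, x) respectively. *)
Definition rate_function (R : realType) (d : nat) (L : R -> 'rV[R]_d -> R)
    (x : 'rV[R]_d) : \bar R :=
  ereal_sup [set (L lam x - lam)%:E | lam in [set lam : R | 0 <= lam]].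

(* The quotients (F x - G x) / |x|_1 over nonzero x.  Rate functions take the
   value +oo; exactly the points where F x - G x has the indeterminate form
   oo - oo are left out. *)
Definition diff_quotients (R : realType) (d : nat) (F G : 'rV[R]_d -> \bar R) :
    set (\bar R) :=
  [set ((F x - G x) * ((l1norm x)^-1)%:E)%E
    | x in [set x : 'rV[R]_d | x != 0 /\ (F x +? - G x)%E]].

(* Main.v *)
(* The increments of - ln e and of ln E[e] in r are derivatives of polynomials in
   r (Russo's formula), so that everything reduces to bounds, linear in |y|_1, for
   the sum over z of the effect of changing the potential at z from 1 to 0.

   Lower bounds: changing the potential at z multiplies the weight of the walks
   through z by at least e, and a walk from 0 to y visits a site in each of the
   |y|_1 levels {|z|_1 = j}.

   Upper bounds: the mean number of sites visited by the weighted walk is linear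
   in |y|_1, by a Chernoff bound.  It remains to compare the weights e_0 and e_1
   with potential 0 and 1 at z to the weight h_1 of the walks through z for the
   value 1.  In the annealed case the comparison with h_0 suffices, at the cost of
   1/r.  If lam >= 1 or d >= 3, the walk escapes from z with a probability bounded
   below and e_0 - e_1 <= K h_1.  In the quenched case with lam <= 1 and d >= 2,
   one looks at the largest square at z on which the potential vanishes: if its
   side is m, the comparison costs Q^m, but this has probability r^(m^2 - 1) only.
   If d = 1, a gap of length m to the left of z costs only a multiple of m. *)

Require Import Defs.
From mathcomp Require Import all_boot all_order all_algebra.
From mathcomp Require Import all_classical all_reals all_analysis measurable_realfun.
From mathcomp Require Import ring lra zify.

Import Order.TTheory GRing.Theory Num.Theory.
Import numFieldNormedType.Exports.

Local Open Scope classical_set_scope.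
Local Open Scope ring_scope.

Set Implicit Arguments.
Unset Strict Implicit.
Unset Printing Implicit Defensive.

(** The bounds must be uniform in [lam], because the suprema that define I and J can be approached
    at any [lam]. This shapes the Chernoff argument: a walk to y takes at least |y|_1 steps, so its
    weight contains e^(-lam |y|_1), and so does the lower bound given by a straight walk. The two
    factors cancel, and the constant depends on d and q0 only.

    Only the coordinates in a finite list are random; all others are 1. Then expectations are
    polynomials in r, Russo's sum is finite, and largest vacant squares and gaps exist. No estimate
    depends on the list, which finally exhausts Z^d.

    The weight e(., y) is handled as the least nonnegative solution of u = k * avg u off y with u(y)
    = 1, so that most comparisons of weights amount to exhibiting a supersolution. The law of the
    walk serves only to identify this solution with the expectation. *)

Section Walk.
Context {R : realType} {d : nat}.
Local Notation site := 'rV[int]_d.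

(** The flag [true] selects the negative direction, so the index type has 2d elements. *)
Definition dir (e : 'I_d * bool) : site := delta_mx 0 e.1 *~ (-1) ^+ e.2.

Definition avg (f : site -> R) (x : site) : R :=
  (2 * d)%:R^-1 * \sum_e f (x + dir e).

Lemma le_avg f g x : (forall e, f (x + dir e) <= g (x + dir e)) ->
  avg f x <= avg g x.
Proof. by move=> fg; rewrite ler_wpM2l ?invr_ge0 ?ler0n// ler_sum. Qed.

Lemma avgD f g x : avg (fun z => f z + g z) x = avg f x + avg g x.
Proof. by rewrite /avg big_split mulrDr. Qed.

Lemma avgB f g x : avg (fun z => f z - g z) x = avg f x - avg g x.
Proof. by rewrite /avg sumrB mulrBr. Qed.

Lemma avgZ a f x : avg (fun z => a * f z) x = a * avg f x.
Proof. by rewrite /avg -mulr_sumr mulrCA. Qed.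

Lemma avgZr a f x : avg (fun z => f z * a) x = avg f x * a.
Proof. by rewrite /avg -mulr_suml mulrA. Qed.

Lemma avg_ge0 f x : (forall z, 0 <= f z) -> 0 <= avg f x.
Proof. by move=> f0; rewrite mulr_ge0 ?invr_ge0 ?ler0n// sumr_ge0. Qed.

Lemma eq_avg f g x : (forall e, f (x + dir e) = g (x + dir e)) -> avg f x = avg g x.
Proof. by move=> fg; rewrite /avg; congr (_ * _); apply: eq_bigr. Qed.

Lemma cvg_avg (f : nat -> site -> R) (g : site -> R) x :
  (forall z, f N z @[N --> \oo] --> g z) -> avg (f N) x @[N --> \oo] --> avg g x.
Proof.
move=> fg; apply: cvgMr; rewrite /=.
by apply: cvg_big => //; exact: add_continuous.
Qed.

Hypothesis d_gt0 : (0 < d)%N.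

Lemma avg_cst a x : avg (fun=> a) x = a.
Proof.
rewrite /avg sumr_const card_prod card_ord card_bool -[in X in _ * X]mulr_natl.
by rewrite mulrA (mulnC d) mulVf ?mul1r// pnatr_eq0; lia.
Qed.

Lemma dir_le_avg f x e : (forall e, 0 <= f (x + dir e)) ->
  (2 * d)%:R^-1 * f (x + dir e) <= avg f x.
Proof.
move=> f0; rewrite ler_wpM2l ?invr_ge0 ?ler0n//.
by rewrite (bigD1 e)//= lerDl sumr_ge0.
Qed.

End Walk.

(** * Weights of killed walks and their comparison by supersolutions *)

Section Travel.
Context {R : realType} {d : nat} (d_gt0 : (0 < d)%N).
Local Notation site := 'rV[int]_d.
Implicit Types (k g : site -> R) (x y z : site).

(** With [k] in the role of e^(-V), this is e(x, y, V) restricted to H(y) <= N. The value at y is 1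
    whatever [k y] is: the potential at the target never counts. *)
Fixpoint travelN k y N x : R :=
  if x == y then 1 else
  if N is N'.+1 then k x * avg (travelN k y N') x else 0.

Definition travel k y x : R := limn (fun N => travelN k y N x).

Definition killing k := forall z, 0 <= k z <= 1.

Lemma killing_ge0 k z : killing k -> 0 <= k z. Proof. by move=> /(_ z)/andP[]. Qed.
Lemma killing_le1 k z : killing k -> k z <= 1. Proof. by move=> /(_ z)/andP[]. Qed.

Lemma travelNxx k y N : travelN k y N y = 1.
Proof. by case: N => [|N] /=; rewrite eqxx. Qed.

Lemma travelN_ge0 k y N x : killing k -> 0 <= travelN k y N x.
Proof.
move=> kk; elim: N x => [|N IH] x /=; case: eqP => // _.
by apply: mulr_ge0; [exact: killing_ge0|exact: avg_ge0].
Qed.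

Lemma travelN_nd k y x : killing k -> {homo (fun N => travelN k y N x) : m n / (m <= n)%N >-> m <= n}.
Proof.
move=> kk; apply: homo_leq => // [? ? ?|N]; first exact: le_trans.
elim: N x => [|N IH] x /=; case: eqP => // _.
  by apply: mulr_ge0; [exact: killing_ge0|apply: avg_ge0 => z; exact: (@travelN_ge0 _ _ 0)].
by rewrite ler_wpM2l ?killing_ge0// le_avg.
Qed.

Lemma travelN_le1 k y N x : killing k -> travelN k y N x <= 1.
Proof.
move=> kk; elim: N x => [|N IH] x /=; case: eqP => // _.
apply: mulr_ile1; [exact: killing_ge0| |exact: killing_le1|].
  by apply: avg_ge0 => z; exact: travelN_ge0.
by rewrite -[leRHS](avg_cst d_gt0 1 x) le_avg.
Qed.

Lemma travelN_cvg k y x : killing k ->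
  travelN k y N x @[N --> \oo] --> travel k y x.
Proof.
move=> kk; apply: (@nondecreasing_is_cvgn _ (fun N => travelN k y N x)).
  exact: travelN_nd.
by exists 1 => _ [N _ <-]; exact: travelN_le1.
Qed.

Lemma travelN_le_travel k y N x : killing k -> travelN k y N x <= travel k y x.
Proof.
move=> kk; apply: nondecreasing_cvgn_le; last exact: (cvgP _ (@travelN_cvg k y x kk)).
exact: travelN_nd.
Qed.

Lemma travel_le k y x a : killing k -> (forall N, travelN k y N x <= a) ->
  travel k y x <= a.
Proof.
move=> kk h; apply: limr_le; first exact: (cvgP _ (@travelN_cvg k y x kk)).
exact: nearW.
Qed.

Lemma travelxx k y : killing k -> travel k y y = 1.
Proof.
move=> kk; apply/eqP; rewrite eq_le; apply/andP; split.
  by apply: travel_le => // N; rewrite travelNxx.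
by rewrite -(travelNxx k y 0) travelN_le_travel.
Qed.

Lemma travel_ge0 k y x : killing k -> 0 <= travel k y x.
Proof. by move=> kk; apply: le_trans (travelN_le_travel _ 0 _ kk); exact: travelN_ge0. Qed.

Lemma travel_le1 k y x : killing k -> travel k y x <= 1.
Proof. by move=> kk; apply: travel_le => // N; exact: travelN_le1. Qed.

Lemma travelE k y x : killing k -> x != y -> travel k y x = k x * avg (travel k y) x.
Proof.
move=> kk xy.
have h1 : travelN k y N.+1 x @[N --> \oo] --> travel k y x.
  have := @travelN_cvg k y x kk.
  by rewrite -(@cvg_shiftS _ (fun N => travelN k y N x)).
have h2 : travelN k y N.+1 x @[N --> \oo] --> k x * avg (travel k y) x.
  rewrite /= (negbTE xy); apply: cvgMr; apply: cvg_avg => z; exact: travelN_cvg.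
by rewrite -(cvg_lim _ h1)// -(cvg_lim _ h2).
Qed.

Lemma le_travelN k k' y N x : killing k -> killing k' ->
  (forall z, k z <= k' z) -> travelN k y N x <= travelN k' y N x.
Proof.
move=> kk kk' le; elim: N x => [|N IH] x /=; case: eqP => // _.
by apply: ler_pM; [exact: killing_ge0|apply: avg_ge0 => z; exact: travelN_ge0| |exact: le_avg].
Qed.

Lemma le_travel k k' y x : killing k -> killing k' ->
  (forall z, k z <= k' z) -> travel k y x <= travel k' y x.
Proof.
move=> kk kk' le; apply: travel_le => // N.
exact: le_trans (le_travelN _ _ _ _ _ _) (travelN_le_travel _ _ _ _).
Qed.

(** The factor 0 discards the walks that visit B before y; y itself may lie in B without harm. *)
Definition avoid (B : pred site) k z : R := if B z then 0 else k z.

Lemma killing_avoid B k : killing k -> killing (avoid B k).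
Proof. by move=> kk z; rewrite /avoid; case: ifP => // _; rewrite lexx ler01. Qed.

Lemma avoid_le B k z : killing k -> avoid B k z <= k z.
Proof. by move=> kk; rewrite /avoid; case: ifP => // _; exact: killing_ge0. Qed.

Lemma travel_avoid_le B k y x : killing k -> travel (avoid B k) y x <= travel k y x.
Proof.
move=> kk; apply: le_travel => //; first exact: killing_avoid.
by move=> z; exact: avoid_le.
Qed.

Lemma travel_avoid0 (B : pred site) k y x : killing k -> x != y -> B x -> travel (avoid B k) y x = 0.
Proof.
by move=> kk xy Bx; rewrite travelE ?/avoid ?Bx ?mul0r//; exact: killing_avoid.
Qed.

(** Minimality of [travel], by induction on the number of steps. Sites where the desired bound is
    already known act as boundary sites: the supersolution inequality is asked only elsewhere. *)
Lemma travel_le_super k y g x : killing k -> (forall z, 0 <= g z) ->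
  1 <= g y ->
  (forall z, z != y -> travel k y z <= g z \/ k z * avg g z <= g z) ->
  travel k y x <= g x.
Proof.
move=> kk g0 gy gk; apply: travel_le => // N.
elim: N x => [|N IH] x /=; case: eqP => [->//|/eqP xy] //.
have [xg|xg] := gk x xy.
  apply: le_trans xg; apply: le_trans (travelN_le_travel _ N.+1 _ kk).
  by rewrite /= (negbTE xy).
by apply: le_trans xg; rewrite ler_wpM2l ?killing_ge0// le_avg.
Qed.

(** Strong Markov property at the first visit to B: until then both walks carry the same factors,
    and from there on the ratio is at most K. The supersolution is v + K (u1 - v), with v the common
    weight of the walks that avoid B. *)
Lemma travel_ratio (B : pred site) k0 k1 y K x : 0 <= K ->
  killing k0 -> killing k1 -> (forall z, ~~ B z -> k0 z = k1 z) ->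
  (forall z, B z -> z != y -> travel k0 y z <= K * travel k1 y z) ->
  travel k0 y x - travel (avoid B k0) y x <=
  K * (travel k1 y x - travel (avoid B k0) y x).
Proof.
move=> K0 kk0 kk1 k01 BK; have ka := killing_avoid B kk0.
have avE : avoid B k0 = avoid B k1.
  by apply/funext => z; rewrite /avoid; case: ifPn => // /k01.
rewrite lerBlDl; set v := travel (avoid B k0) y.
have v1 z : v z <= travel k1 y z by rewrite /v avE travel_avoid_le.
apply: (@travel_le_super _ _ (fun x => v x + K * (travel k1 y x - v x))) => //.
- by move=> z; rewrite addr_ge0 ?travel_ge0// mulr_ge0// subr_ge0.
- by rewrite /v !travelxx// subrr mulr0 addr0.
move=> z zy; have [Bz|Bz] := boolP (B z).
  by left; rewrite /v travel_avoid0// subr0 add0r BK.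
have vE : v z = k1 z * avg v z by rewrite {1}/v (travelE ka zy) /avoid (negbTE Bz) k01.
right; rewrite avgD avgZ avgB (travelE kk1 zy) vE k01//.
by rewrite le_eqVlt; apply/orP; left; apply/eqP; ring.
Qed.

Section SingleSite.
Variables (k0 k1 : site -> R) (y z : site) (a eta : R).
Hypotheses (kk0 : killing k0) (kk1 : killing k1).
Hypotheses (k01 : forall x, x != z -> k0 x = k1 x) (k0z : a * k0 z <= k1 z).
Hypotheses (a_gt0 : 0 < a) (eta_gt0 : 0 < eta).

(* If, after visiting [z], the walk fails to come back with probability at
   least [eta], then changing the killing at [z] costs a bounded factor. *)
Lemma travel_single_site g : (forall x, 0 <= g x) -> 1 <= g z ->
  (forall x, x != z -> k0 x * avg g x <= g x) -> k0 z * avg g z <= 1 - eta ->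
  forall x, travel k0 y x - travel (avoid (pred1 z) k0) y x <=
    (a * eta)^-1 * (travel k1 y x - travel (avoid (pred1 z) k0) y x).
Proof.
move=> g0 gz gk gez x; apply: travel_ratio => //.
  by rewrite invr_ge0 mulr_ge0// ltW.
move=> _ /eqP-> zy.
set v := travel (avoid (pred1 z) k0) y; have ka := killing_avoid (pred1 z) kk0.
have v1 w : v w <= travel k1 y w.
  rewrite /v; have -> : avoid (pred1 z) k0 = avoid (pred1 z) k1.
    by apply/funext => t; rewrite /avoid/=; case: ifPn => // /k01.
  by rewrite travel_avoid_le.
(* Decomposition at the first visit to z, the weight of which is bounded by g. *)
have le0 w : travel k0 y w <= v w + g w * travel k0 y z.
  apply: (@travel_le_super _ _ (fun w => v w + g w * travel k0 y z)) => //.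
  - by move=> t; rewrite addr_ge0 ?mulr_ge0 ?travel_ge0.
  - by rewrite /v travelxx// lerDl mulr_ge0 ?travel_ge0.
  move=> t ty; have [->|tz] := eqVneq t z.
    by left; rewrite /v travel_avoid0//= ?eqxx// add0r ler_peMl ?travel_ge0.
  right; rewrite avgD avgZr mulrDr mulrA; apply: lerD.
    by rewrite {2}/v (travelE ka ty) {1}/avoid/= (negbTE tz).
  by rewrite ler_wpM2r ?travel_ge0 ?gk.
(* One step from z: the returning walks carry a total factor of at most 1 - eta and can be absorbed
   into the left-hand side. *)
have h1 : travel k0 y z <= k0 z * avg v z + (1 - eta) * travel k0 y z.
  rewrite {1}(travelE kk0 zy); apply: (@le_trans _ _ (k0 z * avg (fun w => v w + g w * travel k0 y z) z)).
    by rewrite ler_wpM2l ?killing_ge0 ?le_avg.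
  by rewrite avgD avgZr mulrDr mulrA lerD2l ler_wpM2r ?travel_ge0.
have h2 : a * (k0 z * avg v z) <= travel k1 y z.
  rewrite (travelE kk1 zy) mulrA; apply: ler_pM => //.
  - by rewrite mulr_ge0 ?(ltW a_gt0) ?killing_ge0.
  - by apply: avg_ge0 => w; exact: travel_ge0.
  - by apply: le_avg => e; exact: v1.
rewrite ler_pdivlMl ?mulr_gt0//; apply: le_trans h2.
by rewrite -mulrA ler_pM2l//; lra.
Qed.

End SingleSite.

End Travel.

(** * Sums over walks with their histories; visited sites *)

Section Histories.
Context {R : realType} {d : nat} (d_gt0 : (0 < d)%N).
Local Notation site := 'rV[int]_d.
Implicit Types (k : site -> R) (x y z : site) (h : seq site) (Phi Psi : seq site -> R).

(* Expectation of [Phi h] over the walks from [x] that reach [y] within [N]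
   steps, [h] being the reversed list of the sites visited before [y], appended
   to a given list. *)
Fixpoint pathsum y N Phi h x : R :=
  if x == y then Phi h else
  if N is N'.+1 then avg (pathsum y N' Phi (x :: h)) x else 0.

Lemma pathsumD y N Phi Psi h x :
  pathsum y N (fun h => Phi h + Psi h) h x = pathsum y N Phi h x + pathsum y N Psi h x.
Proof.
elim: N h x => [|N IH] h x /=; case: eqP => // _; first by rewrite addr0.
by rewrite -avgD; apply: eq_avg => e.
Qed.

Lemma pathsumZ y N a Phi h x :
  pathsum y N (fun h => a * Phi h) h x = a * pathsum y N Phi h x.
Proof.
elim: N h x => [|N IH] h x /=; case: eqP => // _; first by rewrite mulr0.
by rewrite -avgZ; apply: eq_avg => e.
Qed.

Lemma pathsum_sum y N (I : Type) (s : seq I) (Phi : I -> seq site -> R) h x :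
  pathsum y N (fun h => \sum_(i <- s) Phi i h) h x =
  \sum_(i <- s) pathsum y N (Phi i) h x.
Proof.
elim: s => [|i s IH].
  rewrite big_nil; transitivity (pathsum y N (fun h => 0 * 0) h x).
    by congr pathsum; apply/funext => h'; rewrite big_nil mul0r.
  by rewrite (pathsumZ y N 0 (fun=> 0)) mul0r.
rewrite big_cons -IH -pathsumD; congr pathsum.
by apply/funext => h'; rewrite big_cons.
Qed.

(** [I] is an invariant of history and position; it carries facts about the path, such as [levels],
    to the moment when y is reached. *)
Lemma pathsum_le (I : seq site -> site -> Prop) y N Phi Psi h x :
  (forall h x e, I h x -> x != y -> I (x :: h) (x + dir e)) ->
  (forall h, I h y -> Phi h <= Psi h) -> I h x ->
  pathsum y N Phi h x <= pathsum y N Psi h x.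
Proof.
move=> Istep le; elim: N h x => [|N IH] h x Ihx /=; case: eqP Ihx => [->|/eqP xy] Ihx //.
- exact: le.
- exact: le.
- by apply: le_avg => e; apply: IH; exact: Istep.
Qed.

Lemma travelN_pathsum k y N h x :
  \prod_(z <- h) k z * travelN k y N x = pathsum y N (fun h => \prod_(z <- h) k z) h x.
Proof.
elim: N h x => [|N IH] h x /=; case: eqP => // _; rewrite ?mulr1 ?mulr0//.
rewrite mulrA [X in X * _]mulrC -avgZ; apply: eq_avg => e.
by rewrite -IH big_cons.
Qed.

Lemma travelN_pathsum0 k y N x :
  travelN k y N x = pathsum y N (fun h => \prod_(z <- h) k z) [::] x.
Proof. by rewrite -travelN_pathsum big_nil mul1r. Qed.

(** The weight of the walks that visit z strictly before reaching y; it vanishes for z = y. *)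
Definition hit k y z x : R := travel k y x - travel (avoid (pred1 z) k) y x.

Definition hitN k y z N x : R :=
  travelN k y N x - travelN (avoid (pred1 z) k) y N x.

Lemma prod_avoid (B : pred site) k h :
  \prod_(z <- h) avoid B k z = \prod_(z <- h) k z * (~~ has B h)%:R.
Proof.
elim: h => [|z h IH]; first by rewrite !big_nil mulr1.
rewrite !big_cons IH /= /avoid; case: ifP => _ /=; first by rewrite !mul0r mulr0.
by rewrite mulrA.
Qed.

Lemma hitN_pathsum k y z N x :
  hitN k y z N x = pathsum y N (fun h => \prod_(t <- h) k t * (z \in h)%:R) [::] x.
Proof.
rewrite /hitN !travelN_pathsum0 -[X in _ - X]mul1r -mulNr -pathsumZ -pathsumD.
congr pathsum; apply/funext => h; rewrite prod_avoid has_pred1.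
by case: (z \in h); rewrite ?mulr1 ?mulr0; ring.
Qed.

Lemma hitN_cvg k y z x : killing k -> hitN k y z N x @[N --> \oo] --> hit k y z x.
Proof.
by move=> kk; apply: cvgB; apply: travelN_cvg => //; exact: killing_avoid.
Qed.

Lemma hit_ge0 k y z x : killing k -> 0 <= hit k y z x.
Proof. by move=> kk; rewrite subr_ge0 travel_avoid_le. Qed.

Lemma sum_hitN_cvg k y (s : seq site) x : killing k ->
  \sum_(z <- s) hitN k y z N x @[N --> \oo] --> \sum_(z <- s) hit k y z x.
Proof.
move=> kk; apply: cvg_big; first exact: add_continuous.
by move=> z _; exact: hitN_cvg.
Qed.

Lemma sum_hitN k y (s : seq site) N x : \sum_(z <- s) hitN k y z N x =
  pathsum y N (fun h => \prod_(t <- h) k t * (\sum_(z <- s) (z \in h)%:R)) [::] x.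
Proof.
under eq_bigr do rewrite hitN_pathsum.
rewrite -pathsum_sum; congr pathsum; apply/funext => h.
by rewrite mulr_sumr.
Qed.

(** Union bound: on each history, the indicator of visiting B is at most the sum of the indicators
    of visiting its sites. *)
Lemma travel_avoid_union k y (B : seq site) x : killing k ->
  travel k y x - travel (avoid (fun z => z \in B) k) y x <= \sum_(b <- B) hit k y b x.
Proof.
move=> kk; have ka := killing_avoid (fun z => z \in B) kk.
apply: (ler_cvg_to (cvgB (travelN_cvg d_gt0 kk) (travelN_cvg d_gt0 ka)) (sum_hitN_cvg kk)).
apply: nearW => N; rewrite sum_hitN /=.
rewrite [leLHS](_ : _ = travelN k y N x - travelN (avoid (fun z => z \in B) k) y N x)//.
rewrite !travelN_pathsum0.
rewrite -[X in _ - X]mul1r -mulNr -pathsumZ -pathsumD.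
apply: (@pathsum_le (fun _ _ => True)) => // h _; rewrite prod_avoid.
have p0 : 0 <= \prod_(z <- h) k z by apply: prodr_ge0 => z _; exact: killing_ge0.
have [/hasP[b bh bB]|_] /= := boolP (has _ h); last first.
  rewrite mulr1 mulN1r subrr mulr_ge0// sumr_ge0// => z _; exact: ler0n.
rewrite mulr0 mulr0 addr0 ler_peMr// (big_rem b)//= bh lerDl; exact: sumr_ge0.
Qed.

Definition norm1 x : nat := (\sum_(i < d) `|x 0%R i|)%N.

Lemma norm1D x y : (norm1 (x + y) <= norm1 x + norm1 y)%N.
Proof.
rewrite /norm1 -big_split; apply: leq_sum => i _ /=; rewrite mxE.
by rewrite -lez_nat PoszD !abszE ler_normD.
Qed.

Lemma norm1_dir e : norm1 (dir e) = 1%N.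
Proof.
rewrite /norm1 (bigD1 e.1)//= big1 => [|i ie].
  by rewrite addn0 /dir; case: e => i [] /=; rewrite ?expr1 ?expr0 ?mulrNz !mxE ?eqxx.
rewrite /dir; case: e ie => j [] /= ij; rewrite ?expr1 ?expr0 ?mulrNz !mxE (negbTE ij);
  by rewrite ?andbF ?oppr0.
Qed.

Lemma norm10 : norm1 0 = 0%N.
Proof. by rewrite /norm1 big1// => i _; rewrite mxE. Qed.

(** Discrete intermediate values: one step changes |.|_1 by at most 1, so this is preserved along
    walks from 0 and can serve as the invariant in [pathsum_le]. *)
Definition levels h x := forall j, (j < norm1 x)%N -> exists2 z, z \in h & norm1 z = j.

Lemma levels_step h x e : levels h x -> levels (x :: h) (x + dir e).
Proof.
move=> lv j jx; have := leq_trans jx (norm1D _ _); rewrite norm1_dir addn1 ltnS leq_eqVlt.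
case/orP => [/eqP->|/lv[z zh <-]]; first by exists x; rewrite ?mem_head.
by exists z => //; rewrite in_cons zh orbT.
Qed.

Lemma levels_count h x (s : seq site) : levels h x ->
  (forall z, (norm1 z < norm1 x)%N -> z \in s) ->
  (norm1 x)%:R <= \sum_(z <- s) (z \in h)%:R :> R.
Proof.
move=> lv sP; rewrite -natr_sum ler_nat.
have -> : (\sum_(z <- s) (z \in h) = size [seq z <- s | z \in h])%N.
  by rewrite -sum1_size big_filter [RHS]big_mkcond; apply: eq_bigr => z _; case: (z \in h).
rewrite -(size_map norm1) -[leqLHS](size_iota 0); apply: uniq_leq_size; first exact: iota_uniq.
move=> j; rewrite mem_iota add0n => /= jx; have [z zh zj] := lv j jx.
by apply/mapP; exists z; rewrite ?mem_filter ?zh ?sP ?zj.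
Qed.

Lemma levels_size_undup h x : levels h x -> (norm1 x <= size (undup h))%N.
Proof.
move=> lv; rewrite -(size_map norm1) -[leqLHS](size_iota 0).
apply: uniq_leq_size; first exact: iota_uniq.
move=> j; rewrite mem_iota add0n => /= jx; have [z zh zj] := lv j jx.
by apply/mapP; exists z; rewrite ?mem_undup.
Qed.

Lemma levels0 : levels [::] 0. Proof. by move=> j; rewrite norm10. Qed.

Lemma sum_hit_ge k y (s : seq site) : killing k ->
  (forall z, (norm1 z < norm1 y)%N -> z \in s) ->
  (norm1 y)%:R * travel k y 0 <= \sum_(z <- s) hit k y z 0.
Proof.
move=> kk sP.
have cL : (norm1 y)%:R * travelN k y N 0 @[N --> \oo] --> (norm1 y)%:R * travel k y 0.
  by apply: cvgMr; exact: travelN_cvg.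
apply: (ler_cvg_to cL (sum_hitN_cvg kk)); apply: nearW => N; rewrite sum_hitN travelN_pathsum0 -pathsumZ.
apply: (@pathsum_le levels) => [h x e lv _|h lv|]; [exact: levels_step| |exact: levels0].
rewrite mulrC ler_wpM2l ?levels_count//.
by apply: prodr_ge0 => z _; exact: killing_ge0.
Qed.

(** A cube of side 2N + 1 containing the l^1 ball of radius N; these lists exhaust Z^d. *)
Definition lattice_ball (N : nat) : seq site :=
  undup [seq \row_i ((f i : nat)%:Z - N%:Z) | f : {ffun 'I_d -> 'I_(2 * N).+1}].

Lemma lattice_ball_uniq N : uniq (lattice_ball N). Proof. exact: undup_uniq. Qed.

Lemma mem_lattice_ball N z : (norm1 z <= N)%N -> z \in lattice_ball N.
Proof.
move=> zN; rewrite mem_undup; apply/mapP.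
have zi i : (`|z 0%R i| <= N)%N.
  by apply: leq_trans zN; rewrite /norm1 (bigD1 i)//= leq_addr.
exists [ffun i => inord (absz (z 0 i + N%:Z))]; first by rewrite mem_enum.
apply/rowP => i; rewrite !mxE ffunE; move: (z 0 i) (zi i) => t tN; rewrite inordK; lia.
Qed.

(* Harnack inequality along a shortest path. *)
Lemma travel_harnack k y a x z : killing k -> (forall t, a <= k t) -> 0 <= a ->
  ((2 * d)%:R^-1 * a) ^+ norm1 (z - x) * travel k y z <= travel k y x.
Proof.
move=> kk ak a0; move En : (norm1 (z - x)) => n.
have c0 : 0 <= (2 * d)%:R^-1 * a by rewrite mulr_ge0// invr_ge0 ler0n.
have c1 : (2 * d)%:R^-1 * a <= 1.
  rewrite mulr_ile1 ?invr_ge0 ?ler0n//; last by apply: le_trans (ak 0) _; exact: killing_le1.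
  by rewrite invf_le1 ?ler1n ?ltr0n; lia.
elim: n x En => [|n IH] x En.
  suff -> : x = z by rewrite mul1r.
  apply/esym/rowP => i.
  move/eqP: En; rewrite sum_nat_eq0 => /forallP/(_ i); rewrite !mxE.
  by move: (z 0 i) (x 0 i) => a' b /eqP; lia.
have [->|xy] := eqVneq x y.
  by rewrite travelxx// mulr_ile1 ?exprn_ge0 ?exprn_ile1 ?travel_ge0 ?travel_le1.
have [e ne] : exists e, norm1 (z - (x + dir e)) = n.
  have [i zi] : exists i, (z - x) 0 i != 0.
    apply/existsP; rewrite -negb_forall; apply/negP => /forallP zx.
    by move: En; rewrite /norm1 big1// => i _; rewrite (eqP (zx i)).
  (* A step along coordinate i towards z: the flag is set when z lies on the negative side. *)
  exists (i, (z - x) 0 i < 0); rewrite /norm1 (bigD1 i)//=; move: En; rewrite /norm1 (bigD1 i)//=.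
  rewrite [in X in _ -> (_ + X)%N = _](eq_bigr (fun j => `|(z - x)%R 0%R j|%N)) => [|j ji].
    move: (\sum_(_ < _ | _) _)%N => S; rewrite /dir.
    case: ltP zi => /=; rewrite ?expr1 ?expr0 ?mulrNz ?mulr1z !mxE ?eqxx /=;
      move: (z 0 i) (x 0 i) => s t; lia.
  rewrite /dir; case: ltP zi => /=; rewrite ?expr1 ?expr0 ?mulrNz ?mulr1z !mxE (negbTE ji) ?andbF /=; lia.
rewrite (travelE d_gt0 kk xy) exprS -mulrA.
apply: le_trans (_ : (2 * d)%:R^-1 * a * travel k y (x + dir e) <= _).
  by rewrite ler_wpM2l// IH.
rewrite mulrAC mulrC ler_pM ?mulr_ge0 ?invr_ge0 ?ler0n ?travel_ge0//.
by apply: dir_le_avg => t; exact: travel_ge0.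
Qed.

End Histories.

(** * Finitely many Bernoulli coordinates *)

Section Bernoulli.
Context {R : realType} {T : eqType}.
Implicit Types (c : T -> bool) (s : seq T) (F G : (T -> bool) -> R) (r : R).

Definition up c z b : T -> bool := fun t => if t == z then b else c t.

Lemma up_eq c z b : up c z b z = b. Proof. by rewrite /up eqxx. Qed.

Lemma up_up c z a b : up (up c z a) z b = up c z b.
Proof. by apply/funext => t; rewrite /up; case: eqP. Qed.

Lemma upC c z t a b : z != t -> up (up c z a) t b = up (up c t b) z a.
Proof.
move=> zt; apply/funext => u; rewrite /up; case: (eqVneq u t) => [->|//].
by rewrite eq_sym (negbTE zt).
Qed.

(* Expectation of [F] when the coordinates in [s] are independent and equal to
   [false] with probability [r], the others being given by [c]. *)
Fixpoint Er r s F c : R :=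
  if s is z :: s' then r * Er r s' F (up c z false) + (1 - r) * Er r s' F (up c z true)
  else F c.

Lemma ErD r s F G c : Er r s (fun c => F c + G c) c = Er r s F c + Er r s G c.
Proof. by elim: s c => //= z s IH c; rewrite !IH; ring. Qed.

Lemma ErZ r s a F c : Er r s (fun c => a * F c) c = a * Er r s F c.
Proof. by elim: s c => //= z s IH c; rewrite !IH; ring. Qed.

Lemma ErB r s F G c : Er r s (fun c => F c - G c) c = Er r s F c - Er r s G c.
Proof. by elim: s c => //= z s IH c; rewrite !IH; ring. Qed.

Lemma Er_cst r s a c : Er r s (fun=> a) c = a.
Proof. by elim: s c => //= z s IH c; rewrite !IH; ring. Qed.

Lemma Er_sum r s (I : Type) (l : seq I) (F : I -> (T -> bool) -> R) c :
  Er r s (fun c => \sum_(i <- l) F i c) c = \sum_(i <- l) Er r s (F i) c.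
Proof.
elim: s c => //= z s IH c; rewrite !IH 2!mulr_sumr -big_split.
by [].
Qed.

Lemma le_Er r s F G c : 0 <= r <= 1 ->
  (forall c', (forall z, z \notin s -> c' z = c z) -> F c' <= G c') ->
  Er r s F c <= Er r s G c.
Proof.
move=> /andP[r0 r1]; elim: s c => [|z s IH] c FG /=; first exact: FG.
by apply: lerD; apply: ler_wpM2l; rewrite ?subr_ge0//; apply: IH => c' cc'; apply: FG => t;
  rewrite in_cons negb_or => /andP[tz ts]; rewrite cc'// /up (negbTE tz).
Qed.

Lemma eq_Er r s F G c :
  (forall c', (forall z, z \notin s -> c' z = c z) -> F c' = G c') ->
  Er r s F c = Er r s G c.
Proof.
elim: s c => [|z s IH] c FG /=; first exact: FG.
by congr (_ * _ + _ * _); apply: IH => c' cc'; apply: FG => t;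
  rewrite in_cons negb_or => /andP[tz ts]; rewrite cc'// /up (negbTE tz).
Qed.

Lemma Er_ge0 r s F c : 0 <= r <= 1 -> (forall c, 0 <= F c) -> 0 <= Er r s F c.
Proof. by move=> r01 F0; rewrite -(Er_cst r s 0 c) le_Er. Qed.

Lemma Er_out r s z b F c : z \notin s ->
  Er r s F (up c z b) = Er r s (fun c => F (up c z b)) c.
Proof.
elim: s c => //= t s IH c; rewrite in_cons negb_or => /andP[zt zs].
by rewrite !(upC _ _ _ zt) !IH.
Qed.

Lemma Er_in r s z F c : uniq s -> z \in s ->
  Er r s F c = r * Er r s (fun c => F (up c z false)) c +
               (1 - r) * Er r s (fun c => F (up c z true)) c.
Proof.
elim: s c => //= t s IH c /andP[ts us]; rewrite in_cons => /orP[/eqP->|zs].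
  by rewrite -!(Er_out _ _ _ _ ts) !up_up; ring.
by rewrite (IH (up c t false))// (IH (up c t true))//; ring.
Qed.

(** Independence of the coordinate z and a function that does not see it. *)
Lemma Er_factor r s z (phi : bool -> R) G c : uniq s -> z \in s ->
  (forall c b, G (up c z b) = G c) ->
  Er r s (fun c => phi (c z) * G c) c =
  (r * phi false + (1 - r) * phi true) * Er r s G c.
Proof.
move=> us zs Gz; rewrite (Er_in _ _ _ us zs).
have e b : Er r s (fun c => phi (up c z b z) * G (up c z b)) c = phi b * Er r s G c.
  by rewrite -ErZ; apply: eq_Er => c' _; rewrite up_eq Gz.
by rewrite !e; ring.
Qed.

Lemma Er_factor_out r s z (phi : bool -> R) G c : z \notin s ->
  Er r s (fun c => phi (c z) * G c) c = phi (c z) * Er r s G c.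
Proof. by move=> zs; rewrite -ErZ; apply: eq_Er => c' /(_ _ zs) ->. Qed.

Lemma cvg_Er r s (F : nat -> (T -> bool) -> R) G c :
  (forall c, F N c @[N --> \oo] --> G c) -> Er r s (F N) c @[N --> \oo] --> Er r s G c.
Proof.
by move=> FG; elim: s c => //= z s IH c; apply: cvgD; apply: cvgMr; exact: IH.
Qed.

(* Russo's formula. *)
Lemma is_derive_Er r s F c : uniq s ->
  is_derive r 1 (fun r => Er r s F c)
    (\sum_(z <- s) Er r s (fun c => F (up c z false) - F (up c z true)) c).
Proof.
elim: s c => /= [|z s IH] c; first by rewrite big_nil => _; exact: is_derive_cst.
move=> /andP[zs us].
apply: is_derive_eq.
  apply: is_deriveD; apply: is_deriveM; exact: IH.
rewrite big_cons /= big_split/= -!mulr_sumr !ErB -!(Er_out _ _ _ _ zs) !up_up.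
by rewrite /GRing.scale/=; ring.
Qed.

End Bernoulli.

Lemma is_derive_le (R : realType) (f g df dg : R -> R) (p q : R) : p < q ->
  (forall r, p <= r <= q -> is_derive r 1 f (df r)) ->
  (forall r, p <= r <= q -> is_derive r 1 g (dg r)) ->
  (forall r, p <= r <= q -> df r <= dg r) ->
  f q - f p <= g q - g p.
Proof.
move=> pq fd gd fg.
have [] := @MVT R (fun r => f r - g r) (fun r => df r - dg r) p q pq.
- move=> r; rewrite in_itv/= => /andP[/ltW pr /ltW rq].
  have pr_q : p <= r <= q by rewrite pr.
  by have := fd _ pr_q; have := gd _ pr_q => ? ?; exact: is_deriveB.
- apply: derivable_within_continuous => r; rewrite in_itv/= => prq.
  have [fr _] := fd _ prq; have [gr _] := gd _ prq.
  exact: derivableB.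
move=> r; rewrite in_itv/= => /andP[/ltW pr /ltW rq] e.
have : (df r - dg r) * (q - p) <= 0.
  by rewrite mulr_le0_ge0 ?subr_ge0 ?subr_le0 ?(ltW pq)// fg// pr.
by rewrite -e; lra.
Qed.

Lemma is_derive_linear (R : realType) (a r : R) : is_derive r 1 (fun r => a * r) a.
Proof.
apply: (is_derive_eq (is_deriveM (is_derive_cst a r 1) (is_derive_id r 1))).
by rewrite /GRing.scale/= mulr0 addr0 mulr1.
Qed.

(** * Weights in a finite random environment; the lower bounds *)

Section Environment.
Context {R : realType} {d : nat} (d_gt0 : (0 < d)%N).
Local Notation site := 'rV[int]_d.
Local Notation config := (site -> bool).
Variables (lam : R) (y : site).
Hypothesis lam0 : 0 <= lam.
Implicit Types (c : config) (s : seq site) (z : site) (r p q : R).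

Definition env c z : R := expR (- ((c z)%:R + lam)).

Definition weight c : R := travel (env c) y 0.

Definition weight_avoid z c : R := travel (avoid (pred1 z) (env c)) y 0.

Definition weight_hit z c : R := hit (env c) y z 0.

(** The boundary condition off the finite list. Value 1 is the least favourable one, so it bounds
    the weights of the infinite environment from below, and it leaves only finitely many sites of
    value 0. *)
Definition full : config := fun=> true.

Lemma env_killing c : killing (env c).
Proof.
by move=> z; rewrite expR_ge0 -expR0 ler_expR oppr_le0 addr_ge0.
Qed.

#[local] Hint Resolve env_killing killing_avoid : core.

Lemma weight_ge0 c : 0 <= weight c. Proof. exact: travel_ge0. Qed.

Lemma weight_le1 c : weight c <= 1. Proof. exact: travel_le1. Qed.

Lemma weight_lb c : ((2 * d)%:R^-1 * expR (- (1 + lam))) ^+ norm1 y <= weight c.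
Proof.
have := @travel_harnack _ _ d_gt0 (env c) y (expR (- (1 + lam))) 0 y (env_killing c).
rewrite subr0 travelxx// mulr1; apply; rewrite ?expR_ge0// => t.
by rewrite ler_expR lerN2 lerD2r; case: (c t).
Qed.

Lemma weight_gt0 c : 0 < weight c.
Proof.
apply: lt_le_trans (weight_lb c); rewrite exprn_gt0// mulr_gt0 ?expR_gt0//.
by rewrite invr_gt0 ltr0n; lia.
Qed.

Lemma le_env c c' z : (c' z -> c z) -> env c z <= env c' z.
Proof.
move=> cc; rewrite ler_expR lerN2 lerD2r ler_nat.
by move: cc; case: (c' z); case: (c z) => // /(_ isT).
Qed.

Lemma le_weight c c' : (forall z, c' z -> c z) -> weight c <= weight c'.
Proof. by move=> cc; apply: le_travel => // z; exact: (le_env (cc z)). Qed.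

Lemma weight_avoid_up z b c : weight_avoid z (up c z b) = weight_avoid z c.
Proof.
rewrite /weight_avoid; suff -> : avoid (pred1 z) (env (up c z b)) = avoid (pred1 z) (env c) by [].
by apply/funext => t; rewrite /avoid /env /up /=; case: (t == z).
Qed.

Lemma weight_avoid_ge0 z c : 0 <= weight_avoid z c.
Proof. by apply: travel_ge0 => //; exact: killing_avoid. Qed.

Lemma weight_hitE z c : weight_hit z c = weight c - weight_avoid z c.
Proof. by []. Qed.

Lemma weight_hit_ge0 z c : 0 <= weight_hit z c. Proof. exact: hit_ge0. Qed.

Lemma up_self c z : up c z (c z) = c.
Proof. by apply/funext => t; rewrite /up; case: eqP => [->|]. Qed.

Lemma weight_up_le c z b : weight (up c z true) <= weight (up c z b).
Proof.
by apply: le_weight => t; rewrite /up; case: (t == z) => //; case: b.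
Qed.

Lemma le_weight_up c z b : weight (up c z b) <= weight (up c z false).
Proof. by apply: le_weight => t; rewrite /up; case: (t == z). Qed.

(* A walk through [z] collects a factor [e^-1] there at least once. *)
Lemma weight_hit_true z c : weight_hit z (up c z true) <=
  expR (-1) * weight_hit z (up c z false).
Proof.
rewrite !weight_hitE !weight_avoid_up /weight /weight_avoid.
have -> : avoid (pred1 z) (env c) = avoid (pred1 z) (env (up c z true)).
  by apply/funext => t; rewrite /avoid /env /up /=; case: (t == z).
apply: (@travel_ratio _ _ d_gt0 (pred1 z) (env (up c z true)) (env (up c z false)) y).
- exact: expR_ge0.
- exact: env_killing.
- exact: env_killing.
- by move=> t /= tz; rewrite /env /up (negbTE tz).
move=> _ /eqP-> zy; rewrite !(travelE d_gt0 _ zy)//.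
have -> : env (up c z true) z = expR (-1) * env (up c z false) z.
  by rewrite -expRD /env !up_eq; congr expR; rewrite /=; lra.
rewrite -mulrA 2?ler_wpM2l ?expR_ge0//; apply: le_avg => e.
by apply: le_travel => // t; apply: le_env; rewrite /up; case: (t == z).
Qed.

Lemma le_weight_hit_false z c : weight_hit z c <= weight_hit z (up c z false).
Proof.
rewrite -[c in leLHS](up_self c z) !weight_hitE !weight_avoid_up lerD2r.
exact: le_weight_up.
Qed.

(** The walks avoiding z cancel in the difference, which leaves h_0 - h_1. The constant 1 - e^-1 of
    the theorem comes from here. *)
Lemma weight_diff_ge z c : (1 - expR (-1)) * weight_hit z (up c z false) <=
  weight (up c z false) - weight (up c z true).
Proof.
have := weight_hit_true z c; rewrite !weight_hitE !weight_avoid_up; lra.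
Qed.

Lemma expRN1_lt1 : expR (-1) < 1 :> R.
Proof. by rewrite -[ltRHS]expR0 ltr_expR ltrN10. Qed.

Lemma sum_weight_hit_ge s c : (forall z, (norm1 z < norm1 y)%N -> z \in s) ->
  (norm1 y)%:R * weight c <= \sum_(z <- s) weight_hit z c.
Proof. exact: sum_hit_ge. Qed.

Lemma Er_gt0 r s F c : 0 <= r <= 1 -> (forall c, 0 < F c) -> 0 < Er r s F c.
Proof.
move=> /andP[r0 r1] F0; elim: s c => [|z s IH] c //=.
have [r1e|rn1] := eqVneq r 1.
  by move: (IH (up c z false)); rewrite r1e subrr mul0r addr0 mul1r.
have a0 : 0 < (1 - r) * Er r s F (up c z true) by rewrite mulr_gt0// subr_gt0 lt_neqAle rn1.
by apply: (lt_le_trans a0); rewrite lerDr mulr_ge0// ltW.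
Qed.

Lemma is_derive_ln_Er r s F c : 0 <= r <= 1 -> uniq s -> (forall c, 0 < F c) ->
  is_derive r 1 (fun r => ln (Er r s F c))
    ((Er r s F c)^-1 *
     \sum_(z <- s) Er r s (fun c => F (up c z false) - F (up c z true)) c).
Proof.
move=> r01 us F0; have E0 := Er_gt0 s c r01 F0.
have h1 := is_derive_Er r F c us.
have h2 := is_derive1_ln E0.
apply: (is_derive_eq (is_derive1_comp (f := @ln R) h2 h1)).
by rewrite mulrC.
Qed.

Lemma annealed_lower s p q : uniq s -> (forall z, (norm1 z < norm1 y)%N -> z \in s) ->
  0 < p -> p < q -> q < 1 ->
  (1 - expR (-1)) * (q - p) * (norm1 y)%:R <=
  ln (Er q s weight full) - ln (Er p s weight full).
Proof.
move=> us sP p0 pq q1.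
have -> : (1 - expR (-1)) * (q - p) * (norm1 y)%:R =
    (1 - expR (-1)) * (norm1 y)%:R * q - (1 - expR (-1)) * (norm1 y)%:R * p by ring.
apply: (@is_derive_le _ (fun r => (1 - expR (-1)) * (norm1 y)%:R * r)
  (fun r => ln (Er r s weight full)) (fun=> (1 - expR (-1)) * (norm1 y)%:R)) => //.
- by move=> r _; exact: is_derive_linear.
- move=> r /andP[pr rq]; apply: is_derive_ln_Er => //; last exact: weight_gt0.
  by apply/andP; split; lra.
move=> r /andP[pr rq] /=; have r01 : 0 <= r <= 1 by apply/andP; split; lra.
rewrite ler_pdivlMl ?Er_gt0//; last exact: weight_gt0.
rewrite mulrC -ErZ -Er_sum; apply: le_Er => // c _.
rewrite -mulrA; apply: le_trans (_ : (1 - expR (-1)) * \sum_(z <- s) weight_hit z c <= _).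
  by rewrite ler_wpM2l ?sum_weight_hit_ge// subr_ge0 ltW// expRN1_lt1.
rewrite mulr_sumr; apply: ler_sum => z _; apply: le_trans (weight_diff_ge z c).
by rewrite ler_wpM2l ?le_weight_hit_false// subr_ge0 ltW// expRN1_lt1.
Qed.

(** This is ln t <= t - 1 at t = b / a. With the arguments exchanged it gives ln a - ln b <= (a - b)
    / b, the form used in the upper bounds. *)
Lemma ln_ratio_ge (a b : R) : 0 < a -> 0 < b -> (a - b) / a <= ln a - ln b.
Proof.
move=> a0 b0; have ba : 0 < b / a by rewrite divr_gt0.
have := @le_ln1Dx R (b / a - 1); rewrite addrCA subrr addr0 => h.
have : ln (b / a) <= b / a - 1 by apply: h; lra.
rewrite ln_div ?posrE//.
have -> : (a - b) / a = 1 - b / a by rewrite mulrBl divff ?gt_eqF.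
lra.
Qed.

(** The ratio is 1 - v / e: the weight v of the walks avoiding z ignores the value at z, while e
    grows when this value drops. *)
Lemma le_hit_ratio z c : weight_hit z c / weight c <=
  weight_hit z (up c z false) / weight (up c z false).
Proof.
have w0 := weight_gt0 c; have w1 := weight_gt0 (up c z false).
rewrite !weight_hitE weight_avoid_up !mulrBl !divff ?gt_eqF// lerD2l lerN2.
rewrite ler_wpM2l ?weight_avoid_ge0// lef_pV2 ?posrE//.
by rewrite -[c in leLHS](up_self c z) le_weight_up.
Qed.

Lemma quenched_lower s p q : uniq s -> (forall z, (norm1 z < norm1 y)%N -> z \in s) ->
  0 < p -> p < q -> q < 1 ->
  (1 - expR (-1)) * (q - p) * (norm1 y)%:R <=
  Er p s (fun c => - ln (weight c)) full - Er q s (fun c => - ln (weight c)) full.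
Proof.
move=> us sP p0 pq q1.
suff : Er q s (fun c => - ln (weight c)) full - Er p s (fun c => - ln (weight c)) full <=
    - ((1 - expR (-1)) * (norm1 y)%:R) * q - - ((1 - expR (-1)) * (norm1 y)%:R) * p by lra.
apply: (@is_derive_le _ (fun r => Er r s (fun c => - ln (weight c)) full)
  (fun r => - ((1 - expR (-1)) * (norm1 y)%:R) * r) _ (fun=> - ((1 - expR (-1)) * (norm1 y)%:R))) => //.
- by move=> r _; exact: is_derive_Er.
- by move=> r _; exact: is_derive_linear.
move=> r /andP[pr rq] /=; have r01 : 0 <= r <= 1 by apply/andP; split; lra.
rewrite -Er_sum -[leRHS](Er_cst r s _ full); apply: le_Er => // c _.
have e0 : 0 <= 1 - expR (-1) :> R by rewrite subr_ge0 ltW// expRN1_lt1.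
apply: le_trans (_ : - ((1 - expR (-1)) * \sum_(z <- s) (weight_hit z c / weight c)) <= _); last first.
  rewrite lerN2 ler_wpM2l// -mulr_suml ler_pdivlMr ?weight_gt0//.
  exact: sum_weight_hit_ge.
rewrite mulr_sumr -sumrN; apply: ler_sum => z _.
have := @ln_ratio_ge _ _ (weight_gt0 (up c z false)) (weight_gt0 (up c z true)).
set A := (X in X <= _) => h.
suff hA : (1 - expR (-1)) * (weight_hit z c / weight c) <= A.
  by rewrite -opprD lerN2 (le_trans hA).
apply: le_trans (_ : (1 - expR (-1)) * (weight_hit z (up c z false) / weight (up c z false)) <= _).
  by rewrite ler_wpM2l// le_hit_ratio.
by rewrite mulrA /A ler_pM2r ?invr_gt0 ?weight_gt0// weight_diff_ge.
Qed.

End Environment.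

(** Cost per unit length of a straight walk through sites of value 1, apart from e^(-lam): ln(2d)
    for the choice of the step and 1 for the potential. *)
Definition crossing_cost (R : realType) (d : nat) : R := 1 + ln (2 * d)%:R.

Lemma crossing_cost_ge1 (R : realType) (d : nat) : (0 < d)%N -> 1 <= crossing_cost R d.
Proof. by move=> d0; rewrite lerDl ln_ge0// ler1n; lia. Qed.

(** * The mean number of visited sites *)

Section RangeBound.
Context {R : realType} {d : nat} (d_gt0 : (0 < d)%N).
Local Notation site := 'rV[int]_d.
Local Notation config := (site -> bool).
Variables (lam : R) (y : site).
Hypothesis lam0 : 0 <= lam.
Implicit Types (c : config) (s h : seq site) (z : site) (r p q : R).

(* The mean of the factor [e^(- omega z)] collected in one visit to [z]. *)
Definition visit r : R := r + (1 - r) * expR (-1).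

Lemma visit_gt0 r : 0 <= r <= 1 -> 0 < visit r.
Proof.
move=> /andP[r0 r1]; rewrite /visit; have := expR_gt0 (-1 : R).
have : expR (-1) <= 1 :> R by rewrite ltW// expRN1_lt1.
nra.
Qed.

Lemma le_visit r q : r <= q -> visit r <= visit q.
Proof. by move=> rq; rewrite /visit; have := @expRN1_lt1 R; nra. Qed.

Lemma visit_lt1 r : r < 1 -> visit r < 1.
Proof. by move=> r1; rewrite /visit; have := @expRN1_lt1 R; nra. Qed.

Lemma Er_pathsum r s N (Phi : config -> seq site -> R) h x c :
  Er r s (fun c => pathsum y N (Phi c) h x) c =
  pathsum y N (fun h => Er r s (Phi^~ h) c) h x.
Proof.
elim: N h x => [|N IH] h x /=; case: eqP => // _; first exact: Er_cst.
rewrite ErZ Er_sum; congr (_ * _); apply: eq_bigr => e _; exact: IH.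
Qed.

(** Only one factor per visited site is kept, because factors at distinct sites are independent. *)
Lemma prod_undup_le (T : eqType) (f : T -> R) (h : seq T) : (forall t, 0 <= f t <= 1) ->
  \prod_(t <- h) f t <= \prod_(t <- undup h) f t.
Proof.
move=> f01; have f0 t : 0 <= f t by have /andP[] := f01 t.
elim: h => //= t h IH; rewrite big_cons; case: ifP => _.
  by apply: le_trans IH; rewrite ler_piMl ?prodr_ge0//; have /andP[] := f01 t.
by rewrite big_cons ler_wpM2l.
Qed.

Definition occ c z : R := expR (- (c z)%:R).

Lemma occ01 c z : 0 <= occ c z <= 1.
Proof. by rewrite expR_ge0/= -expR0 ler_expR oppr_le0. Qed.

(** Independence over the distinct sites of u. Sites outside [s] have value 1 and contribute e^-1 <=
    [visit r], hence an inequality. *)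
Lemma Er_prod_occ r s u : 0 <= r <= 1 -> uniq s -> uniq u ->
  Er r s (fun c => \prod_(z <- u) occ c z) (full : config) <= visit r ^+ size u.
Proof.
move=> r01 us; have v0 := ltW (visit_gt0 r01).
elim: u => [|z u IH] /=.
  by move=> _; rewrite (@eq_Er _ _ r s _ (fun=> 1)) ?Er_cst// => c _; rewrite big_nil.
move=> /andP[zu uu]; have le0 : 0 <= Er r s (fun c => \prod_(z <- u) occ c z) full.
  by apply: Er_ge0 => // c; apply: prodr_ge0 => t _; rewrite expR_ge0.
rewrite (@eq_Er _ _ r s _ (fun c => expR (- (c z)%:R) * \prod_(z <- u) occ c z)); last first.
  by move=> c _; rewrite big_cons.
have indep c b : \prod_(t <- u) occ (up c z b) t = \prod_(t <- u) occ c t.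
  apply: eq_big_seq => t tu; rewrite /occ /up; case: eqP => // tz.
  by rewrite tz (negbTE zu) in tu.
rewrite exprS; have [zs|zs] := boolP (z \in s).
  rewrite (Er_factor r (fun b => expR (- b%:R)) _ us zs indep) oppr0 expR0 mulr1.
  by rewrite ler_wpM2l// IH.
rewrite (Er_factor_out r (fun b => expR (- b%:R)) _ _ zs) /=.
apply: ler_pM => //; rewrite ?expR_ge0 ?IH//.
have /andP[r0 r1] := r01; rewrite /visit.
have : expR (-1) < 1 :> R by exact: expRN1_lt1.
by move: (expR (-1)) => e e1; nra.
Qed.

Lemma pathsum1_le1 N x : pathsum y N (fun=> 1 : R) [::] x <= 1.
Proof.
have -> : pathsum y N (fun=> 1) [::] x = travelN (fun=> 1 : R) y N x.
  rewrite travelN_pathsum0; congr pathsum; apply/funext => h.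
  by rewrite big1.
by apply: travelN_le1 => // z; rewrite ler01 lexx.
Qed.

(** The exponential moment e^(t n) of the number n of distinct visited sites, with t = - ln rho,
    under the weighted walk. *)
Definition tilted (rho : R) N c : R :=
  pathsum y N (fun h => \prod_(z <- h) env lam c z * rho^-1 ^+ size (undup h)) [::] 0.

(** The factors at n distinct sites have mean at most [visit r ^+ n <= rho ^+ n], which pays for the
    tilt. What remains is e^(-lam) per step, and there are at least |y|_1 steps. *)
Lemma Er_tilted r rho s N : 0 <= r <= 1 -> visit r <= rho -> uniq s ->
  Er r s (tilted rho N) full <= expR (- lam) ^+ norm1 y.
Proof.
move=> r01 vr us; have v0 := visit_gt0 r01; have rho0 := lt_le_trans v0 vr.
rewrite Er_pathsum.
have le1 : expR (- lam) <= 1 by rewrite -expR0 ler_expR oppr_le0.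
apply: le_trans (_ : pathsum y N (fun=> expR (- lam) ^+ norm1 y * 1) [::] 0 <= _); last first.
  by rewrite pathsumZ ler_piMr ?exprn_ge0 ?expR_ge0// pathsum1_le1.
apply: (@pathsum_le _ _ levels) => [h x e lv _|h lv|]; [exact: levels_step| |exact: levels0].
rewrite mulr1; set n := size (undup h).
apply: le_trans (_ : Er r s (fun c => (expR (- lam) ^+ size h * rho^-1 ^+ n) *
    \prod_(z <- undup h) occ c z) full <= _).
  apply: le_Er => // c _.
  have -> : \prod_(z <- h) env lam c z = expR (- lam) ^+ size h * \prod_(z <- h) occ c z.
    elim: (h) => [|z h' IH]; first by rewrite !big_nil mulr1.
    rewrite !big_cons IH /= exprS /env /occ opprD expRD; ring.
  rewrite -!mulrA ler_wpM2l ?exprn_ge0 ?expR_ge0// mulrC ler_wpM2l//.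
    by rewrite exprn_ge0 ?invr_ge0 ?ltW.
  by apply: prod_undup_le => z; exact: occ01.
rewrite ErZ; apply: le_trans (_ : expR (- lam) ^+ size h * rho^-1 ^+ n * rho ^+ n <= _).
  rewrite ler_wpM2l ?mulr_ge0 ?exprn_ge0 ?expR_ge0 ?invr_ge0 ?(ltW rho0)//.
  apply: le_trans (Er_prod_occ r01 us (undup_uniq h)) _.
  by apply: lerXn2r; rewrite ?nnegrE ?(ltW v0) ?(ltW rho0).
rewrite -mulrA -exprMn mulVf ?gt_eqF// expr1n mulr1.
apply: ler_wiXn2l; rewrite ?expR_ge0//.
by apply: leq_trans (levels_size_undup lv) (size_undup _).
Qed.

(* [t * n <= a - 1 + e^-a * e^(t * n)] with [t = - ln rho] and [n] the number of
   sites visited. *)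
Lemma sum_hitN_tilted rho a s N c : 0 < rho < 1 -> uniq s ->
  - ln rho * \sum_(z <- s) hitN (env lam c) y z N 0 <=
  (a - 1) * travelN (env lam c) y N 0 + expR (- a) * tilted rho N c.
Proof.
move=> /andP[rho0 rho1] us; rewrite sum_hitN travelN_pathsum0 /tilted -!pathsumZ -pathsumD.
apply: (@pathsum_le _ _ (fun _ _ => True)) => // h _.
rewrite mulrCA (mulrCA (expR _)) (mulrC (a - 1)) -mulrDr ler_wpM2l//.
  by apply: prodr_ge0 => z _; exact: expR_ge0.
set n := size (undup h).
have le_n : \sum_(z <- s) (z \in h)%:R <= n%:R :> R.
  rewrite -natr_sum ler_nat.
  have -> : (\sum_(z <- s) (z \in h) = size [seq z <- s | z \in h])%N.
    by rewrite -sum1_size big_filter [RHS]big_mkcond; apply: eq_bigr => z _; case: (z \in h).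
  apply: uniq_leq_size; first exact: filter_uniq.
  by move=> z; rewrite mem_filter mem_undup => /andP[].
have l0 : 0 <= - ln rho by rewrite oppr_ge0 ln_le0// ltW.
apply: le_trans (ler_wpM2l l0 le_n) _.
have -> : rho^-1 ^+ n = expR (- ln rho * n%:R).
  by rewrite mulrC expRM_natl expRN lnK// posrE.
rewrite -expRD; have := expR_ge1Dx (- a + - ln rho * n%:R); lra.
Qed.

(** This dictates the Chernoff parameter a = [crossing_cost] times |y|_1: then e^(-a) times the
    bound of [Er_tilted] equals the lower bound of [weight_lb]. *)
Lemma crossing_costE : (expR (- (crossing_cost R d * (norm1 y)%:R))) * expR (- lam) ^+ norm1 y =
  ((2 * d)%:R^-1 * expR (- (1 + lam))) ^+ norm1 y.
Proof.
rewrite mulrC -mulNr mulrC expRM_natr -exprMn -expRD; congr (_ ^+ _).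
rewrite /crossing_cost opprD -[in RHS](@lnK _ (2 * d)%:R) ?posrE ?ltr0n; last by lia.
by rewrite -expRN -expRD; congr expR; ring.
Qed.

(** The counted sites [s'] are kept apart from the random ones [s], because the argument with
    squares counts translates of [s]. *)
Lemma quenched_range rho r s s' : 0 <= r <= 1 -> visit r <= rho -> rho < 1 ->
  uniq s -> uniq s' -> (0 < norm1 y)%N ->
  Er r s (fun c => \sum_(z <- s') weight_hit lam y z c / weight lam y c) full <=
  crossing_cost R d / - ln rho * (norm1 y)%:R.
Proof.
move=> r01 vr rho1 us us' L0; have rho0 := lt_le_trans (visit_gt0 r01) vr.
have l0 : 0 < - ln rho by rewrite oppr_gt0 ln_lt0// rho0.
set L := (norm1 y)%:R; set a := crossing_cost R d * L.
have a1 : 1 <= a.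
  by rewrite -[leLHS]mulr1 ler_pM ?crossing_cost_ge1// ler1n.
have w0 c := @weight_gt0 _ _ d_gt0 lam y lam0 c.
have kk c := @env_killing R d lam lam0 c.
rewrite mulrAC ler_pdivlMr// mulrC -ErZ -/a.
(* Histories are available for finitely many steps only, hence the passage to the limit in N. *)
have cv : Er r s (fun c => - ln rho * (\sum_(z <- s') hitN (env lam c) y z N 0 / weight lam y c)) full
    @[N --> \oo] -->
    Er r s (fun c => - ln rho * (\sum_(z <- s') weight_hit lam y z c / weight lam y c)) full.
  apply: cvg_Er => c; apply: cvgMr; rewrite -!mulr_suml.
  under eq_cvg do rewrite -mulr_suml.
  by apply: cvgMl; exact: sum_hitN_cvg.
rewrite -(cvg_lim _ cv)//; apply: limr_le; first exact: cvgP cv.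
apply: nearW => N.
(* After division by the weight, the term a - 1 is paid for by [travelN <= weight], and the tilted
   term, by [weight >= b], has mean at most the remaining 1 = e^(-a) e^a. *)
have -> : a = (a - 1) + expR (- a) * (expR (- a))^-1 by rewrite divff ?gt_eqF ?expR_gt0// subrK.
set b := ((2 * d)%:R^-1 * expR (- (1 + lam))) ^+ norm1 y.
have bE : b = expR (- a) * expR (- lam) ^+ norm1 y by rewrite crossing_costE.
have b0 : 0 < b by rewrite bE mulr_gt0 ?exprn_gt0 ?expR_gt0.
apply: le_trans (_ : Er r s (fun c => (a - 1) + expR (- a) / b * tilted rho N c) full <= _); last first.
  rewrite ErD Er_cst ErZ lerD2l -mulrA ler_wpM2l ?expR_ge0//.
  rewrite ler_pdivrMl// bE mulrAC divff ?gt_eqF ?expR_gt0// mul1r.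
  exact: Er_tilted.
apply: le_Er => // c _; rewrite -mulr_suml mulrA ler_pdivrMr//.
apply: le_trans (@sum_hitN_tilted rho a s' N c _ us') _; first by rewrite rho0.
rewrite [leRHS]mulrDl; apply: lerD.
  by rewrite ler_wpM2l ?subr_ge0//; exact: travelN_le_travel.
have t0 : 0 <= tilted rho N c.
  rewrite /tilted; apply: le_trans (_ : pathsum y N (fun=> 0 * 1) [::] 0 <= _).
    by rewrite pathsumZ mul0r.
  apply: (@pathsum_le _ _ (fun _ _ => True)) => // h _; rewrite mul0r mulr_ge0//.
    by apply: prodr_ge0 => z _; exact: expR_ge0.
  by rewrite exprn_ge0 ?invr_ge0 ?ltW.
rewrite -!mulrA ler_wpM2l ?expR_ge0// mulrCA ler_peMr//.
by rewrite ler_pdivlMl// mulr1; exact: weight_lb.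
Qed.

Lemma annealed_range rho r s s' : 0 <= r <= 1 -> visit r <= rho -> rho < 1 ->
  uniq s -> uniq s' -> (0 < norm1 y)%N ->
  \sum_(z <- s') Er r s (weight_hit lam y z) full <=
  crossing_cost R d / - ln rho * (norm1 y)%:R * Er r s (weight lam y) full.
Proof.
move=> r01 vr rho1 us us' L0; have rho0 := lt_le_trans (visit_gt0 r01) vr.
have l0 : 0 < - ln rho by rewrite oppr_gt0 ln_lt0// rho0.
set L := (norm1 y)%:R; set a := crossing_cost R d * L.
have a1 : 1 <= a.
  by rewrite -[leLHS]mulr1 ler_pM ?crossing_cost_ge1// ler1n.
have kk c := @env_killing R d lam lam0 c.
rewrite [X in X * _]mulrAC [X in _ <= X]mulrAC ler_pdivlMr// mulrC -Er_sum -ErZ -/a.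
have cv : Er r s (fun c => - ln rho * (\sum_(z <- s') hitN (env lam c) y z N 0)) full
    @[N --> \oo] -->
    Er r s (fun c => - ln rho * (\sum_(z <- s') weight_hit lam y z c)) full.
  by apply: cvg_Er => c; apply: cvgMr; exact: sum_hitN_cvg.
rewrite -(cvg_lim _ cv)//; apply: limr_le; first exact: cvgP cv.
apply: nearW => N.
apply: le_trans (_ : Er r s (fun c => (a - 1) * weight lam y c + expR (- a) * tilted rho N c) full <= _).
  apply: le_Er => // c _.
  apply: le_trans (@sum_hitN_tilted rho a s' N c _ us') _; first by rewrite rho0.
  by rewrite lerD2r ler_wpM2l ?subr_ge0//; exact: travelN_le_travel.
rewrite ErD !ErZ.
have : expR (- a) * Er r s (tilted rho N) full <= Er r s (weight lam y) full.
  apply: le_trans (_ : Er r s (fun=> expR (- a) * expR (- lam) ^+ norm1 y) full <= _).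
    by rewrite Er_cst ler_wpM2l ?expR_ge0// Er_tilted.
  by apply: le_Er => // c _; rewrite crossing_costE weight_lb.
lra.
Qed.

End RangeBound.

(** * Upper bounds from Russo's formula *)

Section UpperBounds.
Context {R : realType} {d : nat} (d_gt0 : (0 < d)%N).
Local Notation site := 'rV[int]_d.
Local Notation config := (site -> bool).
Variables (lam : R) (y : site).
Hypothesis lam0 : 0 <= lam.
Implicit Types (c : config) (s h : seq site) (z : site) (r p q : R).

#[local] Opaque weight weight_hit weight_avoid travel Er ln.

Let w0 c : 0 < weight lam y c. Proof. exact: weight_gt0. Qed.

Lemma weight_diff_le_hit z c :
  weight lam y (up c z false) - weight lam y (up c z true) <=
  weight_hit lam y z (up c z false).
Proof.
have := weight_hit_ge0 d_gt0 y lam0 z (up c z true).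
by rewrite !weight_hitE !weight_avoid_up; lra.
Qed.

Lemma annealed_upper rho s p q : uniq s -> (0 < norm1 y)%N ->
  visit q <= rho -> rho < 1 -> 0 < p -> p < q -> q < 1 ->
  ln (Er q s (weight lam y) full) - ln (Er p s (weight lam y) full) <=
  crossing_cost R d / - ln rho * (norm1 y)%:R * (ln q - ln p).
Proof.
move=> us L0 vq rho1 p0 pq q1; set C := (X in _ <= X * _).
rewrite mulrBr.
apply: (@is_derive_le _ (fun r => ln (Er r s (weight lam y) full)) (fun r => C * ln r)
  _ (fun r => C * r^-1)); first exact: pq.
- move=> r /andP[pr rq]; apply: is_derive_ln_Er => //.
  by apply/andP; split; lra.
- move=> r /andP[pr rq]; have r0 : 0 < r by lra.
  apply: (is_derive_eq (is_deriveM (is_derive_cst C r 1) (is_derive1_ln r0))).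
  by rewrite /GRing.scale/= mulr0 addr0.
move=> r /andP[pr rq] /=; have r01 : 0 <= r <= 1 by apply/andP; split; lra.
have r0 : 0 < r by lra.
have := annealed_range d_gt0 lam0 r01 (le_trans (le_visit rq) vq) rho1 us us L0.
rewrite -/C => h; rewrite ler_pdivrMl ?Er_gt0// mulrA ler_pdivlMr// mulrC.
rewrite [leRHS]mulrC; apply: le_trans h; rewrite mulr_sumr big_seq [leRHS]big_seq; apply: ler_sum => z zs.
(* r E[h_0] is the share of the value 0 at z in E[h]. Hence the factor 1/r, whose integral is the
   logarithm. *)
apply: le_trans (_ : r * Er r s (fun c => weight_hit lam y z (up c z false)) full <= _).
  by rewrite ler_pM2l//; apply: le_Er => // c _; exact: weight_diff_le_hit.
rewrite [leRHS](Er_in _ _ _ us zs) lerDl mulr_ge0 ?subr_ge0//; first by lra.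
by apply: Er_ge0 => // c; exact: weight_hit_ge0.
Qed.

Lemma quenched_upper s p q D : uniq s -> 0 < p -> p < q ->
  (forall r, p <= r <= q -> \sum_(z <- s) Er r s (fun c =>
     ln (weight lam y (up c z false)) - ln (weight lam y (up c z true))) full <= D) ->
  Er p s (fun c => - ln (weight lam y c)) full -
  Er q s (fun c => - ln (weight lam y c)) full <= D * (q - p).
Proof.
move=> us p0 pq hD.
suff : (- D) * q - (- D) * p <= Er q s (fun c => - ln (weight lam y c)) full -
    Er p s (fun c => - ln (weight lam y c)) full by lra.
apply: (@is_derive_le _ (fun r => - D * r)
  (fun r => Er r s (fun c => - ln (weight lam y c)) full) (fun=> - D)); first exact: pq.
- by move=> r _; exact: is_derive_linear.
- by move=> r _; exact: is_derive_Er.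
move=> r prq /=; rewrite -[leRHS]opprK lerN2 -sumrN; apply: le_trans (hD r prq).
rewrite le_eqVlt; apply/orP; left; apply/eqP; apply: eq_bigr => z _.
rewrite -mulN1r -(ErZ r s (-1)); apply: eq_Er => c _; by rewrite mulN1r opprB opprK addrC.
Qed.

Section BoundedRatio.
Variable K : R.
Hypothesis K0 : 0 <= K.
Hypothesis HK : forall c z,
  weight lam y (up c z false) - weight lam y (up c z true) <=
  K * weight_hit lam y z (up c z true).

Lemma weight_hit_true_le z c : weight_hit lam y z (up c z true) <= weight_hit lam y z c.
Proof.
by rewrite !weight_hitE weight_avoid_up lerD2r -{2}[c](up_self c z) weight_up_le.
Qed.

Lemma hit_ratio_true_le z c : weight_hit lam y z (up c z true) / weight lam y (up c z true) <=
  weight_hit lam y z c / weight lam y c.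
Proof.
rewrite !weight_hitE weight_avoid_up !mulrBl !divff ?gt_eqF// lerD2l lerN2.
rewrite ler_wpM2l ?weight_avoid_ge0// lef_pV2 ?posrE//.
by rewrite -[c in leRHS](up_self c z) weight_up_le.
Qed.

Lemma annealed_upper_ratio rho s p q : uniq s -> (0 < norm1 y)%N ->
  visit q <= rho -> rho < 1 -> 0 < p -> p < q -> q < 1 ->
  ln (Er q s (weight lam y) full) - ln (Er p s (weight lam y) full) <=
  K * (crossing_cost R d / - ln rho) * (norm1 y)%:R * (q - p).
Proof.
move=> us L0 vq rho1 p0 pq q1; set C := (X in _ <= X * _).
rewrite mulrBr.
apply: (@is_derive_le _ (fun r => ln (Er r s (weight lam y) full)) (fun r => C * r)
  _ (fun r => C)); first exact: pq.
- move=> r /andP[pr rq]; apply: is_derive_ln_Er => //.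
  by apply/andP; split; lra.
- by move=> r _; exact: is_derive_linear.
move=> r /andP[pr rq] /=; have r01 : 0 <= r <= 1 by apply/andP; split; lra.
have h := annealed_range d_gt0 lam0 r01 (le_trans (le_visit rq) vq) rho1 us us L0.
rewrite ler_pdivrMl ?Er_gt0//.
have -> : Er r s (weight lam y) full * C = K * (crossing_cost R d / - ln rho *
    (norm1 y)%:R * Er r s (weight lam y) full).
  by rewrite /C; move: (_ / _) => a; ring.
apply: le_trans (ler_wpM2l K0 h).
rewrite mulr_sumr; apply: ler_sum => z _.
rewrite -(ErZ r s K); apply: le_Er r01 _ => c _; apply: le_trans (HK c z) _.
apply: (ler_wpM2l K0); exact: weight_hit_true_le.
Qed.

Lemma quenched_upper_ratio rho s p q : uniq s -> (0 < norm1 y)%N ->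
  visit q <= rho -> rho < 1 -> 0 < p -> p < q -> q < 1 ->
  Er p s (fun c => - ln (weight lam y c)) full -
  Er q s (fun c => - ln (weight lam y c)) full <=
  K * (crossing_cost R d / - ln rho) * (norm1 y)%:R * (q - p).
Proof.
move=> us L0 vq rho1 p0 pq q1; apply: quenched_upper => // r /andP[pr rq].
have r01 : 0 <= r <= 1 by apply/andP; split; lra.
have h := quenched_range d_gt0 lam0 r01 (le_trans (le_visit rq) vq) rho1 us us L0.
rewrite -mulrA; apply: le_trans (ler_wpM2l K0 h).
rewrite -Er_sum -ErZ; apply: le_Er => // c _; rewrite mulr_sumr.
apply: ler_sum => z _.
have := @ln_ratio_ge R _ _ (w0 (up c z true)) (w0 (up c z false)).
rewrite -opprB mulNr -[X in _ <= X -> _]opprB lerN2 => h'; apply: le_trans h' _.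
apply: le_trans (_ : K * (weight_hit lam y z (up c z true) / weight lam y (up c z true)) <= _).
  by rewrite mulrA ler_pM2r ?invr_gt0.
by rewrite ler_wpM2l// hit_ratio_true_le.
Qed.

End BoundedRatio.

#[local] Transparent weight weight_hit weight_avoid.

(* [g] bounds the probability of ever hitting [z]. *)
Lemma ratio_of_supersolution z (g : site -> R) eta : 0 < eta ->
  (forall x, 0 <= g x) -> 1 <= g z ->
  (forall x, x != z -> expR (- lam) * avg g x <= g x) ->
  expR (- lam) * avg g z <= 1 - eta ->
  forall c, weight lam y (up c z false) - weight lam y (up c z true) <=
    (expR (-1) * eta)^-1 * weight_hit lam y z (up c z true).
Proof.
move=> eta0 g0 gz gk gez c; apply: le_trans (weight_diff_le_hit z c) _.
have envl c' x : env lam c' x <= expR (- lam).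
  by rewrite ler_expR lerN2 lerDr.
rewrite !weight_hitE !weight_avoid_up -(weight_avoid_up lam y z false).
have := @travel_single_site _ _ d_gt0 (env lam (up c z false)) (env lam (up c z true)) y z
  (expR (-1)) eta (env_killing lam0 _) (env_killing lam0 _) _ _ (expR_gt0 _) eta0 g g0 gz.
apply.
- by move=> x xz; rewrite /env /up (negbTE xz).
- by rewrite /env !up_eq -expRD ler_expR /=; lra.
- by move=> x xz; apply: le_trans (gk x xz); rewrite ler_wpM2r//; exact: avg_ge0.
- by apply: le_trans gez; rewrite ler_wpM2r//; exact: avg_ge0.
Qed.

(** Every step carries a factor of at most e^-1, so a walk from elsewhere reaches z with weight at
    most e^-1, and eta = 1 - e^-1. *)
Lemma ratio_killed : 1 <= lam -> forall z c,
  weight lam y (up c z false) - weight lam y (up c z true) <=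
    (expR (-1) * (1 - expR (-1)))^-1 * weight_hit lam y z (up c z true).
Proof.
move=> lam1 z; have e1 := @expRN1_lt1 R.
have el : expR (- lam) <= expR (-1) by rewrite ler_expR lerN2.
apply: (@ratio_of_supersolution z (fun x => if x == z then 1 else expR (-1))).
- by rewrite subr_gt0.
- by move=> x; case: ifP => // _; exact: expR_ge0.
- by rewrite eqxx.
- move=> x xz; rewrite (negbTE xz) -[leRHS]mulr1 ler_pM ?expR_ge0//.
    by apply: avg_ge0 => t; case: ifP => // _; exact: expR_ge0.
  rewrite -[leRHS](avg_cst d_gt0 1 x); apply: le_avg => e; case: ifP => // _; exact: ltW.
- rewrite opprB addrCA subrr addr0 -[leRHS]mulr1 ler_pM ?expR_ge0//.
    by apply: avg_ge0 => t; case: ifP => // _; exact: expR_ge0.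
  rewrite -[leRHS](avg_cst d_gt0 1 z); apply: le_avg => e; case: ifP => // _; exact: ltW.
Qed.

End UpperBounds.

(** * Transience in dimension d >= 3 *)

Section Transience.
Context {R : realType} {d : nat}.
Local Notation site := 'rV[int]_d.

(** t^(-1/4); taking fourth powers turns inequalities on it into polynomial ones. *)
Definition root4inv (t : R) : R := (Num.sqrt (Num.sqrt t))^-1.

Lemma root4inv_gt0 t : 0 < t -> 0 < root4inv t.
Proof. by move=> t0; rewrite invr_gt0 !sqrtr_gt0. Qed.

Lemma root4invM s t : 0 < s -> root4inv (s * t) = root4inv s * root4inv t.
Proof.
by move=> s0; rewrite /root4inv sqrtrM ?(ltW s0)// sqrtrM ?sqrtr_ge0// invfM.
Qed.

Lemma root4invX t : 0 < t -> root4inv t ^+ 4 = t^-1.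
Proof.
move=> t0; rewrite /root4inv exprVn; congr (_^-1).
by rewrite (exprM _ 2 2) !sqr_sqrtr ?sqrtr_ge0 ?(ltW t0).
Qed.

(** The Taylor coefficient of x^2 is 5/32; the larger 3/16 absorbs the remainder for |x| <= 1/20. *)
Lemma root4inv_ub (x : R) : - 20^-1 <= x <= 20^-1 ->
  root4inv (1 + x) <= 1 - x / 4 + 3 / 16 * x ^+ 2.
Proof.
move=> /andP[x1 x2]; have x0 : 0 < 1 + x by lra.
set P := (X in _ <= X).
have P0 : 0 < P by rewrite /P; have := sqr_ge0 x; lra.
rewrite -(@ler_pXn2r _ 4) ?nnegrE ?(ltW P0) ?(ltW (root4inv_gt0 x0))// root4invX//.
rewrite -[leLHS]div1r ler_pdivrMr//.
have x3 : 0 <= x ^+ 2 * (1 / 3 - x) by rewrite mulr_ge0 ?sqr_ge0//; lra.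
(* P^2 has quadratic coefficient 7/16; the surplus 1/32 over 13/32 pays for the cubic term, since
   x^2/32 - 3 x^3/32 is a multiple of the quantity in [x3]. *)
have Q1 : 1 - x / 2 + 13 / 32 * x ^+ 2 <= P ^+ 2.
  rewrite /P; have := sqr_ge0 (x ^+ 2); nra.
have Q0 : 0 <= 1 - x / 2 + 13 / 32 * x ^+ 2 by have := sqr_ge0 x; lra.
have Q2 : (1 - x / 2 + 13 / 32 * x ^+ 2) ^+ 2 <= P ^+ 4.
  by rewrite (exprM P 2 2) ler_pXn2r ?nnegrE ?sqr_ge0.
apply: le_trans (_ : (1 - x / 2 + 13 / 32 * x ^+ 2) ^+ 2 * (1 + x) <= _); last first.
  by rewrite ler_pM2r.
have -> : (1 - x / 2 + 13 / 32 * x ^+ 2) ^+ 2 * (1 + x) =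
  1 + x ^+ 2 * (1 / 16 + 21 / 32 * x - 13 / 32 * x ^+ 2 + 169 / 1024 * x ^+ 2 * (1 + x)) by field.
rewrite lerDl; apply: mulr_ge0; first exact: sqr_ge0.
have xx : x ^+ 2 <= 400^-1 by nra.
have : 0 <= x ^+ 2 * (1 + x) by rewrite mulr_ge0 ?sqr_ge0// ltW.
lra.
Qed.

Lemma root4inv_lb (x : R) : 0 <= x < 1 -> 1 + x / 4 <= root4inv (1 - x).
Proof.
move=> /andP[x0 x1]; have x2 : 0 < 1 - x by lra.
rewrite -(@ler_pXn2r _ 4) ?nnegrE ?(ltW (root4inv_gt0 x2))//; last by lra.
rewrite root4invX// -[leRHS]div1r ler_pdivlMr//.
have h1 : 0 <= x / 4 <= 4^-1 by lra.
have -> : x = 4 * (x / 4) by field.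
have -> : 4 * (x / 4) / 4 = x / 4 by field.
move: (x / 4) h1 => t /andP[t0 t1].
have -> : (1 + t) ^+ 4 * (1 - 4 * t) =
  1 - t ^+ 2 * (10 + 20 * t + 15 * t ^+ 2 + 4 * t ^+ 3) by ring.
rewrite gerBl; apply: mulr_ge0; first exact: sqr_ge0.
have := exprn_ge0 3 t0; have := sqr_ge0 t; lra.
Qed.

Definition sqnorm (x : site) : R := \sum_(i < d) (x 0 i)%:~R ^+ 2.

Lemma sqnorm_ge0 x : 0 <= sqnorm x.
Proof. by apply: sumr_ge0 => i _; exact: sqr_ge0. Qed.

Lemma sqnorm_dir (x : site) e :
  sqnorm (x + dir e) = sqnorm x + 2 * (-1) ^+ e.2 * (x 0 e.1)%:~R + 1.
Proof.
case: e => i b; rewrite /sqnorm (bigD1 i)//= [in RHS](bigD1 i)//=.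
rewrite (eq_bigr (fun j => (x 0 j)%:~R ^+ 2)) => [|j ji]; last first.
  rewrite /dir; case: b => /=; rewrite ?expr1 ?expr0 ?mulrNz ?mulr1z !mxE (negbTE ji) ?andbF ?oppr0 addr0//.
rewrite /dir; case: b => /=; rewrite ?expr1 ?expr0 ?mulrNz ?mulr1z !mxE !eqxx /= intrD ?rmorphN /=; ring.
Qed.

Lemma sqnorm_coord (x : site) i : (x 0 i)%:~R ^+ 2 <= sqnorm x.
Proof. by rewrite /sqnorm (bigD1 i)//= lerDl sumr_ge0// => j _; exact: sqr_ge0. Qed.

Lemma sqnorm0 : sqnorm 0 = 0.
Proof. by apply: big1 => i _; rewrite mxE expr0n. Qed.

(* [(A + |x|^2)^(-1/4)] is superharmonic for large [A] as soon as [d >= 3]. *)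
Definition potential (x : site) : R := root4inv (399 + sqnorm x).

Lemma potential_gt0 x : 0 < potential x.
Proof. by apply: root4inv_gt0; have := sqnorm_ge0 x; lra. Qed.

Lemma potential_superharmonic x : (3 <= d)%N -> avg potential x <= potential x.
Proof.
(* u is the mean of 399 + |x + e|^2 over the directions e, and [v e] below is the relative deviation
   from it. *)
move=> d3; set t := sqnorm x; set u := t + 400; have t0 : 0 <= t := sqnorm_ge0 x.
have u0 : 0 < u by rewrite /u; lra.
pose v (e : 'I_d * bool) : R := 2 * (-1) ^+ e.2 * (x 0 e.1)%:~R / u.
have le_v e : potential (x + dir e) <= root4inv u * (1 - v e / 4 + 3 / 16 * v e ^+ 2).
  have -> : potential (x + dir e) = root4inv (u * (1 + v e)).
    rewrite /potential sqnorm_dir -/t /v mulrDr mulr1 mulrCA divff ?gt_eqF// mulr1.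
    congr root4inv; rewrite /u; ring.
  rewrite root4invM// ler_wpM2l ?(ltW (root4inv_gt0 u0))//; apply: root4inv_ub.
  rewrite -ler_norml -(@ler_pXn2r _ 2) ?nnegrE ?invr_ge0// real_normK ?num_real//.
  have -> : v e ^+ 2 = 4 * (x 0 e.1)%:~R ^+ 2 / u ^+ 2.
    rewrite /v expr_div_n !exprMn -exprM mulnC exprM sqrrN !expr1n; congr (_ / _); ring.
  rewrite ler_pdivrMr ?exprn_gt0//; have := sqnorm_coord x e.1; rewrite -/t => h.
  apply: le_trans (_ : 4 * t <= _); first by rewrite ler_pM2l.
  have -> : (20^-1 : R) ^+ 2 = 400^-1 by field.
  (* 1600 t <= (t + 400)^2 gives |v e| <= 1/20: the constant 400 = 20^2 is fitted to the range of
     [root4inv_ub]. *)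
  have : 0 <= (t - 400) ^+ 2 by exact: sqr_ge0.
  rewrite /u; lra.
(* The first-order terms cancel between opposite directions. *)
have sum_le : \sum_e potential (x + dir e) <= root4inv u * ((2 * d)%:R + 3 / 2 * (t / u ^+ 2)).
  apply: le_trans (ler_sum _ (fun e _ => le_v e)) _; rewrite -mulr_sumr.
  rewrite ler_pM2l ?root4inv_gt0// le_eqVlt; apply/orP; left; apply/eqP.
  rewrite -(pair_bigA _ (fun i b => 1 - v (i, b) / 4 + 3 / 16 * v (i, b) ^+ 2)) /=.
  rewrite (eq_bigr (fun i => 2 + 3 / 2 * ((x 0 i)%:~R ^+ 2 / u ^+ 2))) => [|i _].
    rewrite big_split/= -mulr_sumr -mulr_suml sumr_const card_ord natrM.
    by rewrite -[2 *+ d]mulr_natr.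
  rewrite big_bool /v /= expr1 expr0; field; lra.
(* The second-order gain 3t / (4 d u^2) has to stay below the 1 / (4u) of [root4inv_lb]; this is
   where d >= 3 enters. *)
have d0 : 3 <= d%:R :> R by rewrite ler_nat.
rewrite /avg mulrC ler_pdivrMr; last by rewrite ltr0n; lia.
apply: le_trans sum_le _.
have -> : potential x = root4inv u * root4inv (1 - u^-1).
  by rewrite -root4invM// mulrBr mulr1 divff ?gt_eqF// /potential /u -/t; congr root4inv; lra.
rewrite -[leRHS]mulrA ler_pM2l ?root4inv_gt0// natrM.
have u1 : u^-1 < 1 by rewrite (invf_lt1 u0) /u; lra.
have ui0 : 0 < u^-1 by rewrite invr_gt0.
have : 1 + u^-1 / 4 <= root4inv (1 - u^-1) by apply: root4inv_lb; lra.
have tu : t / u ^+ 2 <= u^-1.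
  by rewrite expr2 invfM mulrA ler_piMl ?(ltW ui0)// ler_pdivrMr// mul1r /u; lra.
move: (root4inv _) => w hw; nra.
Qed.

Lemma potential_dir e : potential (0 + dir e) = root4inv 400.
Proof.
rewrite /potential sqnorm_dir mxE mulr0 addr0.
by rewrite sqnorm0; congr root4inv; lra.
Qed.

Lemma root4inv_lt (s t : R) : 0 < s -> s < t -> root4inv t < root4inv s.
Proof.
move=> s0 st; have t0 := lt_trans s0 st.
by rewrite ltf_pV2 ?posrE ?sqrtr_gt0// !ltr_sqrt ?sqrtr_gt0.
Qed.

End Transience.

Section RatioTransient.
Context {R : realType} {d : nat} (d_gt0 : (0 < d)%N).
Variables (lam : R) (y : 'rV[int]_d).
Hypothesis lam0 : 0 <= lam.

(** The quotient is that of [potential] at a neighbour of 0 and at 0; it bounds the probability of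
    returning to 0. *)
Definition escape : R := 1 - root4inv 400 / root4inv 399.

Lemma escape_gt0 : 0 < escape.
Proof.
have f0 : 0 < root4inv 399 :> R by apply: root4inv_gt0; lra.
by rewrite subr_gt0 ltr_pdivrMr// mul1r; apply: root4inv_lt; lra.
Qed.

Lemma ratio_transient : (3 <= d)%N -> forall z c,
  weight lam y (up c z false) - weight lam y (up c z true) <=
    (expR (-1) * escape)^-1 * weight_hit lam y z (up c z true).
Proof.
move=> d3 z; have [F FE] : exists F : R, F = root4inv 399 by eexists.
have f0 : 0 < F by rewrite FE; apply: root4inv_gt0; lra.
have el : expR (- lam) <= 1 by rewrite -expR0 ler_expR oppr_le0.
pose g x := potential (x - z) / F : R.
have avg_g x : avg g x = avg potential (x - z) / F.
  rewrite /g -avgZr; congr (_ * _); apply: eq_bigr => e _; by rewrite addrAC.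
have g0 x : 0 <= g x.
  by apply: mulr_ge0; [exact/ltW/potential_gt0|rewrite invr_ge0 ltW].
apply: (@ratio_of_supersolution R d d_gt0 lam y lam0 z g escape escape_gt0 g0).
- by rewrite /g subrr /potential sqnorm0 addr0 -FE divff ?gt_eqF.
- move=> x _; apply: le_trans (_ : 1 * avg g x <= _).
    by rewrite ler_wpM2r//; exact: avg_ge0.
  by rewrite mul1r avg_g ler_pM2r ?invr_gt0// potential_superharmonic.
- rewrite /escape -FE opprB addrCA subrr addr0 avg_g subrr -[leRHS]mul1r ler_pM ?expR_ge0//.
    by rewrite mulr_ge0 ?invr_ge0 ?(ltW f0)//; apply: avg_ge0 => t; exact/ltW/potential_gt0.
  rewrite ler_pM2r ?invr_gt0//.
  by rewrite -[leRHS](avg_cst d_gt0 _ (0 : 'rV[int]_d)); apply: le_avg => e; rewrite potential_dir.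
Qed.

End RatioTransient.

Lemma block_arith (R : realFieldType) (D s a u : R) :
  u * (s - s * (1 - D)) <= s - a -> a <= s * (1 - u * D).
Proof. lra. Qed.

(** * Comparison over a block that contains a site of value 1 *)

Section Box.
Context {R : realType} {d : nat} (d_gt0 : (0 < d)%N).
Local Notation site := 'rV[int]_d.
Local Notation config := (site -> bool).
Variables (lam : R) (y : site).
Hypothesis lam01 : 0 <= lam <= 1.
Implicit Types (c : config) (s h : seq site) (z : site) (r p q : R).

Let lam0 : 0 <= lam. Proof. by have /andP[] := lam01. Qed.
Let dinv : R := (2 * d)%:R^-1.
Let dinv0 : 0 < dinv. Proof. by rewrite invr_gt0 ltr0n; lia. Qed.
Let dinv_half : dinv <= 2^-1. Proof. by rewrite lef_pV2 ?posrE ?ltr0n ?ler_nat; lia. Qed.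

Lemma expRN1_half : expR (-1) <= 2^-1 :> R.
Proof.
rewrite expRN lef_pV2 ?posrE ?expR_gt0//.
by apply: le_trans (expR_ge1Dx 1); lra.
Qed.

(** As [lam] and the values are at most 1, each prescribed step has at least this weight. *)
Let step : R := dinv * expR (- 2).
Let step0 : 0 < step. Proof. by rewrite mulr_gt0 ?expR_gt0. Qed.
Let step1 : step <= 1.
Proof.
apply: mulr_ile1; [exact: ltW|exact: expR_ge0|by apply: le_trans dinv_half _; lra|].
by rewrite -[leRHS]expR0 ler_expR; lra.
Qed.

Let env_lb c t : expR (- 2) <= env lam c t.
Proof.
have /andP[_ l1] := lam01; rewrite ler_expR lerN2.
have : (c t)%:R <= 1 :> R by case: (c t); rewrite ?ler01.
lra.
Qed.

Let harnack c x t : step ^+ norm1 (t - x) * travel (env lam c) y t <= travel (env lam c) y x.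
Proof.
apply: (@travel_harnack R d d_gt0 (env lam c) y (expR (- 2)) x t (env_killing lam0 c)) => [u|].
- exact: env_lb.
- exact: expR_ge0.
Qed.

(* A walk started in [B] is killed at [w] before leaving [B] with probability
   bounded below in terms of the diameter of [B]. *)
Lemma block_ratio (B : pred site) (n : nat) (w : site) c0 c1 :
  (forall b b', B b -> B b' -> (norm1 (b' - b)%R <= n)%N) ->
  (forall b, B b -> b != w -> exists2 e, B (b + dir e) &
     (norm1 (w - (b + dir e))%R).+1 = norm1 (w - b)%R) ->
  B w -> c0 w -> (forall t, ~~ B t -> c0 t = c1 t) ->
  forall b, B b ->
  travel (env lam c0) y b <= (step * dinv) ^- n.+1 * travel (env lam c1) y b.
Proof.
move=> diam conn Bw c0w c01 b Bb.
have kk c := env_killing lam0 c.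
set u0 := travel (env lam c0) y; set u1 := travel (env lam c1) y.
have dh : dinv <= 2^-1 := dinv_half.
have sd0 : 0 < step * dinv by rewrite mulr_gt0.
have sdle : step * dinv <= step by rewrite ler_piMr ?(ltW step0)//; lra.
(* If y lies in B, then u1 b is at least step^n by the Harnack inequality, and u0 b <= 1
   suffices. *)
have [By|nBy] := boolP (B y).
  rewrite ler_pdivlMl ?exprn_gt0//; apply: le_trans (_ : step ^+ n.+1 * 1 <= _).
    rewrite ler_pM ?exprn_ge0 ?travel_ge0 ?travel_le1 ?(ltW sd0)//.
    by apply: lerXn2r; rewrite ?nnegrE ?(ltW sd0) ?(ltW step0).
  apply: le_trans (harnack c1 b y); rewrite travelxx// ler_pM2r//.
  by apply: ler_wiXn2l; rewrite ?(ltW step0)//; exact: leqW (diam _ _ Bb By).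
(* E bounds the weight of reaching y without visiting B from a site one step away from B, as such a
   site is within n + 1 of b. M, the bound to be proved on B, is E divided by the lower bound
   dinv^(n+1) for the probability of dying in B. *)
set E := step ^- n.+1 * u1 b; set M := dinv ^- n.+1 * E.
have E0 : 0 <= E by rewrite mulr_ge0 ?invr_ge0 ?exprn_ge0 ?travel_ge0 ?(ltW step0).
have M0 : 0 <= M by rewrite mulr_ge0 ?invr_ge0 ?exprn_ge0 ?(ltW dinv0).
have EM : E = dinv ^+ n.+1 * M by rewrite /M mulrA divff ?mul1r// expf_neq0 ?gt_eqF.
have -> : (step * dinv) ^- n.+1 * u1 b = M by rewrite /M /E exprMn invfM mulrA [X in X * _]mulrC.
have kv := killing_avoid B (kk c0); set v := travel (avoid B (env lam c0)) y.
have vE t b' e : B b' -> t = b' + dir e -> v t <= E.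
  move=> Bb' te; rewrite /E ler_pdivlMl ?exprn_gt0//.
  apply: le_trans (_ : step ^+ norm1 (t - b) * u1 t <= _); last exact: harnack.
  apply: ler_pM; rewrite ?exprn_ge0 ?(ltW step0) ?travel_ge0//.
    apply: ler_wiXn2l; rewrite ?(ltW step0)// te addrAC.
    by apply: leq_trans (norm1D _ _) _; rewrite norm1_dir addn1 ltnS diam.
  rewrite /v; have -> : avoid B (env lam c0) = avoid B (env lam c1).
    by apply/funext => x; rewrite /avoid /env; case: ifPn => // /c01 ->.
  exact: travel_avoid_le.
(* Bounds the chance of leaving B alive: a straight walk from x to w has probability at least
   dinv^|w - x|, and death at w has probability at least 1/2 >= dinv. *)
pose psi x : R := 1 - dinv ^+ (norm1 (w - x)).+1.
have psi1 x : psi x <= 1 by rewrite gerBl exprn_ge0 ?(ltW dinv0).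
have psi0 x : 0 <= psi x.
  by rewrite subr_ge0 exprn_ile1 ?(ltW dinv0)//; lra.
have psiB x : B x -> (M + E) * psi x <= M.
  move=> Bx; apply: le_trans (_ : (M + E) * (1 - dinv ^+ n.+1) <= _).
    apply: ler_wpM2l; first by rewrite addr_ge0.
    rewrite lerD2l lerN2; apply: ler_wiXn2l; [exact: ltW|lra|].
    exact: diam.
  rewrite mulrDl mulrBr mulr1 (mulrC M) -EM.
  have := mulr_ge0 E0 (exprn_ge0 n.+1 (ltW dinv0)); lra.
(* Off B, either y is reached without visiting B, or B is entered and M bounds the rest. The choice
   of M makes (M + E) psi <= M on B. *)
pose U x := if B x then (M + E) * psi x else v x + M.
have U_ge0 x : 0 <= U x.
  rewrite /U; case: ifP => _; first by apply: mulr_ge0; [exact: addr_ge0|exact: psi0].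
  by apply: addr_ge0 => //; exact: travel_ge0.
have UE b' e : B b' -> U (b' + dir e) <= M + E.
  move=> Bb'; rewrite /U; case: ifP => Bt; first by rewrite ler_piMr ?addr_ge0.
  by rewrite addrC lerD2l (vE _ b' e).
apply: (@le_trans _ _ (U b)); last by rewrite /U Bb psiB.
rewrite /u0; apply: travel_le_super => //.
  by rewrite /U (negbTE nBy) /v travelxx// lerDl.
move=> z zy; right; rewrite {2}/U; case: ifPn => Bz.
  have [->|zw] := eqVneq z w.
    apply: le_trans (_ : 2^-1 * (M + E) <= _).
      apply: ler_pM; rewrite ?expR_ge0 ?avg_ge0//.
        apply: le_trans expRN1_half; by rewrite ler_expR lerN2 c0w lerDl.
      rewrite -[leRHS](avg_cst d_gt0 _ w); apply: le_avg => e; exact: UE.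
    rewrite mulrC; apply: ler_wpM2l; first by rewrite addr_ge0.
    by rewrite /psi subrr norm10 expr1; lra.
  have [e Be ne] := conn z Bz zw.
  have avgU : avg U z <= (M + E) * psi z.
    have := @dir_le_avg _ _ (fun t => (M + E) - U t) z e.
    rewrite avgB avg_cst// => h.
    have : (2 * d)%:R^-1 * (M + E - U (z + dir e)) <= M + E - avg U z.
      by apply: h => e'; rewrite subr_ge0; exact: UE.
    rewrite {1}/U Be -/dinv /psi ne => h'.
    by rewrite exprS; exact: block_arith h'.
  apply: le_trans avgU; rewrite ler_piMl ?avg_ge0//.
  by have /andP[] := kk c0 z.
apply: le_trans (_ : env lam c0 z * avg (fun t => v t + M) z <= _).
  rewrite ler_wpM2l ?expR_ge0//; apply: le_avg => e; rewrite /U; case: ifP => // Bt.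
  rewrite /v travel_avoid0 ?add0r ?psiB//.
  by apply: contraNneq nBy => <-.
rewrite avgD avg_cst// mulrDr; apply: lerD.
  by rewrite {2}/v (travelE d_gt0 kv zy) {1}/avoid (negbTE Bz).
by rewrite ler_piMl//; have /andP[] := kk c0 z.
Qed.

Definition fill (B : pred site) c : config := fun t => B t || c t.

(** The proportion of the weight carried by walks through B once B is filled with ones. It ignores
    the values in B, hence is independent of the event that part of B is vacant. *)
Definition block_hit (B : pred site) c : R :=
  (weight lam y (fill B c) - travel (avoid B (env lam c)) y 0) / weight lam y (fill B c).

Lemma avoid_fill (B : pred site) c : avoid B (env lam (fill B c)) = avoid B (env lam c).
Proof. by apply/funext => t; rewrite /avoid /env /fill; case: (B t). Qed.

Lemma block_hit_ge0 B c : 0 <= block_hit B c.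
Proof.
rewrite mulr_ge0 ?invr_ge0 ?weight_ge0// subr_ge0 -avoid_fill.
by apply: travel_avoid_le => //; exact: env_killing.
Qed.

Lemma block_hit_up (B : pred site) c z b : B z -> block_hit B (up c z b) = block_hit B c.
Proof.
move=> Bz; rewrite /block_hit; have -> : fill B (up c z b) = fill B c.
  by apply/funext => t; rewrite /fill /up; case: eqP => [->|//]; rewrite Bz.
have -> // : avoid B (env lam (up c z b)) = avoid B (env lam c).
by apply/funext => t; rewrite /avoid /env /up; case: eqP => [->|//]; rewrite Bz.
Qed.

(** Going back from the filled block to c raises e but not the weight v of the walks avoiding B, so
    1 - v / e can only grow. The union bound then applies. *)
Lemma block_hit_le (B : seq site) c :
  block_hit (fun t => t \in B) c <= \sum_(b <- B) weight_hit lam y b c / weight lam y c.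
Proof.
set P := fun t => t \in B; have w0 c' := @weight_gt0 _ _ d_gt0 lam y lam0 c'.
rewrite -mulr_suml; apply: le_trans (_ : (weight lam y c - travel (avoid P (env lam c)) y 0) / weight lam y c <= _).
  rewrite /block_hit !mulrBl !divff ?gt_eqF// lerD2l lerN2.
  rewrite ler_wpM2l ?lef_pV2 ?posrE//.
    by apply: travel_ge0 => //; apply: killing_avoid; exact: env_killing.
  by apply: le_weight => // t ct; rewrite /fill ct orbT.
rewrite ler_pM2r ?invr_gt0//; apply: travel_avoid_union => //; exact: env_killing.
Qed.

(** As w differs from z, it keeps the value 1 when z is switched to 0, so [block_ratio] compares
    with the filled block, whose weight also bounds the denominator from below. *)
Lemma ln_ratio_block (B : pred site) (n : nat) (w : site) c z :
  (forall b b', B b -> B b' -> (norm1 (b' - b)%R <= n)%N) ->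
  (forall b, B b -> b != w -> exists2 e, B (b + dir e) &
     (norm1 (w - (b + dir e))%R).+1 = norm1 (w - b)%R) ->
  B w -> B z -> w != z -> c w ->
  ln (weight lam y (up c z false)) - ln (weight lam y (up c z true)) <=
  (step * dinv) ^- n.+1 * block_hit B c.
Proof.
move=> diam conn Bw Bz wz cw; have w0 c' := @weight_gt0 _ _ d_gt0 lam y lam0 c'.
have kk c' := env_killing lam0 c'.
have sd0 : 0 < step * dinv by rewrite mulr_gt0.
have := @ln_ratio_ge R _ _ (w0 (up c z true)) (w0 (up c z false)).
rewrite -opprB mulNr -[X in _ <= X -> _]opprB lerN2 => h'; apply: le_trans h' _.
have fill_up b : fill B (up c z b) = fill B c.
  by apply/funext => t; rewrite /fill /up; case: eqP => [->|//]; rewrite Bz.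
have le1 b : weight lam y (fill B c) <= weight lam y (up c z b).
  by rewrite -(fill_up b); apply: le_weight => // t ct; rewrite /fill ct orbT.
have h : weight lam y (up c z false) - travel (avoid B (env lam (up c z false))) y 0 <=
   (step * dinv) ^- n.+1 * (weight lam y (fill B c) - travel (avoid B (env lam (up c z false))) y 0).
  apply: travel_ratio => //.
  - by rewrite invr_ge0 exprn_ge0 ?(ltW sd0).
  - by move=> t Bt; rewrite /env -(fill_up false) /fill (negbTE Bt).
  move=> t Bt _; apply: (@block_ratio B n w) => //.
    by rewrite /up (negbTE wz).
  by move=> x Bx; rewrite -(fill_up false) /fill (negbTE Bx).
have avE : avoid B (env lam (up c z false)) = avoid B (env lam c).
  by rewrite -avoid_fill fill_up avoid_fill.
have vle : travel (avoid B (env lam c)) y 0 <= weight lam y (fill B c).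
  by rewrite -avoid_fill; apply: travel_avoid_le => //; exact: kk.
rewrite /block_hit mulrA avE in h *.
apply: ler_pM; rewrite ?subr_ge0 ?invr_ge0 ?(ltW (w0 _))//.
- by apply: le_weight => // t; rewrite /up; case: eqP.
- by apply: le_trans h; rewrite lerD2l lerN2; apply: le_trans vle (le1 true).
- by rewrite lef_pV2 ?posrE// le1.
Qed.

End Box.

(** The exponent of r, an area, beats that of Q, a diameter: the terms are at most D / 2^m. *)
Lemma gauss_sum_bounded (R : realType) (Q q : R) : 1 <= Q -> 0 < q < 1 ->
  exists C : R, forall M r, 0 <= r <= q ->
  \sum_(1 <= m < M) Q ^+ (2 * m).+1 * r ^+ (m ^ 2).-1 * (m.+1 ^ 2)%:R <= C.
Proof.
move=> Q1 /andP[q0 q1]; have Q0 : 0 < Q by exact: lt_le_trans Q1.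
(* Q^2 comes from Q^(2m), 4 from (m + 1)^2 <= 4^m, and the last 2 leaves the geometric factor
   2^-m. *)
pose X := 8 * Q ^+ 2.
have X1 : 1 <= X.
  have : 1 <= Q ^+ 2 by rewrite exprn_ege1.
  by rewrite /X; lra.
have X0 : 0 < X by exact: lt_le_trans X1.
have [m0 hm0] : exists m0, forall m, (m0 <= m)%N -> X * q ^+ m <= 1.
  have : X * q ^+ n @[n --> \oo] --> X * 0.
    by apply: cvgMr; apply: cvg_expr; rewrite ger0_norm// ltW.
  rewrite mulr0 => /cvgr_lt /(_ 1 ltr01)[m0 _ h].
  by exists m0 => m m0m; exact/ltW/h.
pose D := Q / q * X ^+ m0.
have D0 : 0 <= D by rewrite /D !mulr_ge0 ?invr_ge0 ?exprn_ge0 ?(ltW q0) ?(ltW Q0) ?(ltW X0).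
have term m r : (0 < m)%N -> 0 <= r <= q ->
    Q ^+ (2 * m).+1 * r ^+ (m ^ 2).-1 * (m.+1 ^ 2)%:R <= D * 2^-1 ^+ m.
  move=> m_gt0 /andP[r0 rq].
  have le1 : (m.+1 ^ 2)%:R <= 4 ^+ m :> R.
    rewrite -(natrX _ 4) ler_nat (_ : 4 = 2 ^ 2)%N// -expnM mulnC expnM leq_exp2r//.
    exact: ltn_expl.
  have le2 : r ^+ (m ^ 2).-1 <= q^-1 * q ^+ (m ^ 2).
    rewrite -[in leRHS](@prednK (m ^ 2)) ?expn_gt0 ?m_gt0// exprS mulrA mulVf ?gt_eqF// mul1r.
    by apply: lerXn2r => //; rewrite nnegrE// ltW.
  apply: le_trans (_ : Q ^+ (2 * m).+1 * (q^-1 * q ^+ (m ^ 2)) * 4 ^+ m <= _).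
    by rewrite !ler_pM ?mulr_ge0 ?exprn_ge0 ?ler0n ?(ltW Q0).
  have -> : Q ^+ (2 * m).+1 * (q^-1 * q ^+ (m ^ 2)) * 4 ^+ m =
      Q / q * ((X * q ^+ m) ^+ m * 2^-1 ^+ m).
    have e8 : 8 = 4 * 2 :> R by ring.
    rewrite /X e8 !exprMn -!exprM (_ : m * m = m ^ 2)%N// exprS.
    have eQ : Q ^+ (2 * m) = Q ^+ m * Q ^+ m by rewrite mul2n -addnn exprD.
    rewrite eQ.
    have e : 2 ^+ m * 2^-1 ^+ m = 1 :> R by rewrite -exprMn divff ?expr1n// pnatr_eq0.
    move: (4 ^+ m) (2 ^+ m) (2^-1 ^+ m) (Q ^+ m) (q ^+ (m ^ 2)) (q^-1) e => a1 a2 a3 a4 a5 a6 e.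
    by rewrite -[LHS]mulr1 -e; ring.
  rewrite /D -[leRHS]mulrA; apply: ler_wpM2l; first by rewrite mulr_ge0 ?invr_ge0 ?(ltW Q0) ?(ltW q0).
  apply: ler_wpM2r; first by rewrite exprn_ge0// invr_ge0.
  have [mm0|mm0] := leqP m0 m.
    apply: le_trans (_ : 1 <= _); last by rewrite exprn_ege1.
    by apply: exprn_ile1; rewrite ?hm0// mulr_ge0 ?exprn_ge0 ?(ltW X0) ?(ltW q0).
  apply: le_trans (_ : X ^+ m <= _); last by apply: ler_weXn2l => //; exact: ltnW.
  have Xq : 0 <= X * q ^+ m by apply: mulr_ge0; [exact: ltW|exact/exprn_ge0/ltW].
  apply: lerXn2r; [exact: Xq|exact: ltW|].
  by rewrite ler_piMr ?(ltW X0)// exprn_ile1 ?(ltW q0) ?(ltW q1).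
have geo M : \sum_(0 <= m < M) 2^-1 ^+ m <= 2 :> R.
  suff -> : \sum_(0 <= m < M) 2^-1 ^+ m = 2 - 2 * 2^-1 ^+ M :> R.
    by rewrite gerBl mulr_ge0// exprn_ge0// invr_ge0.
  elim: M => [|M IH]; first by rewrite big_geq// expr0 mulr1 subrr.
  by rewrite big_nat_recr//= IH exprS; lra.
exists (D * 2) => M r r01.
have [M1|M1] := leqP M 1; first by rewrite big_geq// mulr_ge0.
apply: le_trans (_ : \sum_(1 <= m < M) D * 2^-1 ^+ m <= _).
  by rewrite big_nat [leRHS]big_nat; apply: ler_sum => m /andP[m1 _]; exact: term.
rewrite -mulr_sumr ler_wpM2l//; apply: le_trans (geo M).
by rewrite [leRHS]big_ltn ?lerDr ?exprn_ge0 ?invr_ge0//; exact: ltnW.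
Qed.

(** Vacancy of A is independent of G. A site of A outside [s] has value 1 and makes the product 0,
    hence an inequality. *)
Lemma Er_block (R : realType) (T : eqType) r s (A : seq T) (G : (T -> bool) -> R) :
  0 <= r <= 1 -> uniq s -> uniq A -> (forall c, 0 <= G c) ->
  (forall c z b, z \in A -> G (up c z b) = G c) ->
  Er r s (fun c => \prod_(a <- A) (~~ c a)%:R * G c) (fun=> true) <= r ^+ size A * Er r s G (fun=> true).
Proof.
move=> r01 us; elim: A => [|a A IH] /=.
  move=> _ G0 _; rewrite mul1r; apply: le_Er => // c _; by rewrite big_nil mul1r.
move=> /andP[aA uA] G0 Gup; have /andP[r0 r1] := r01.
pose F c := \prod_(a <- A) (~~ c a)%:R * G c.
have F0 c : 0 <= F c by rewrite mulr_ge0// prodr_ge0.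
have Fa c b : F (up c a b) = F c.
  rewrite /F Gup ?mem_head//; congr (_ * _); apply: eq_big_seq => t tA.
  by rewrite /up; case: eqP => // ta; rewrite -ta tA in aA.
rewrite (@eq_Er _ _ r s _ (fun c => (~~ c a)%:R * F c)); last first.
  by move=> c _; rewrite big_cons mulrA.
have IHA : Er r s F (fun=> true) <= r ^+ size A * Er r s G (fun=> true).
  by apply: IH => // c z b zA; apply: Gup; rewrite in_cons zA orbT.
have [as_|as_] := boolP (a \in s).
  rewrite (Er_factor r (fun b => (~~ b)%:R) _ us as_ Fa) /= mulr1 mulr0 addr0 exprS -mulrA.
  by rewrite ler_wpM2l.
rewrite (Er_factor_out r (fun b => (~~ b)%:R) _ _ as_) mul0r mulr_ge0 ?exprn_ge0//.
exact: Er_ge0.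
Qed.

(** * Squares in a coordinate plane *)

Section Square.
Context {R : realType} {d : nat} (d_gt0 : (0 < d)%N).
Local Notation site := 'rV[int]_d.
Local Notation config := (site -> bool).
Variables (i0 i1 : 'I_d).
Hypothesis i01 : i0 != i1.
Implicit Types (c : config) (s h : seq site) (z : site).

Definition pt (a b : nat) : site :=
  \row_i (if i == i0 then a%:Z else if i == i1 then b%:Z else 0).

Definition box m : seq site := [seq pt a b | a <- iota 0 m, b <- iota 0 m].

Lemma pt_inj a b a' b' : pt a b = pt a' b' -> a = a' /\ b = b'.
Proof.
move=> /rowP e; split; first by have := e i0; rewrite !mxE eqxx => -[].
by have := e i1; rewrite !mxE eq_sym (negbTE i01) eqxx => -[].
Qed.

Lemma mem_box m x : reflect (exists2 a, (a < m)%N & exists2 b, (b < m)%N & x = pt a b) (x \in box m).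
Proof.
apply: (iffP allpairsP) => [[[a b]] /= [am bm ->]|[a am [b bm ->]]].
  by exists a; [rewrite mem_iota in am|exists b; [rewrite mem_iota in bm|]].
by exists (a, b); rewrite !mem_iota.
Qed.

Lemma box_uniq m : uniq (box m).
Proof.
by apply: allpairs_uniq; rewrite ?iota_uniq// => -[a b] [a' b'] _ _ /= /pt_inj[-> ->].
Qed.

Lemma size_box m : size (box m) = (m ^ 2)%N.
Proof. by rewrite size_allpairs size_iota. Qed.

Lemma pt00 : pt 0 0 = 0.
Proof. by apply/rowP => i; rewrite !mxE; case: ifP => // _; case: ifP. Qed.

Lemma norm1_pt a b a' b' :
  norm1 (pt a b - pt a' b') = (`|a%:Z - a'%:Z| + `|b%:Z - b'%:Z|)%N.
Proof.
rewrite /norm1 (bigD1 i0)//= (bigD1 i1) 1?eq_sym//= big1 ?addn0 => [|i /andP[/negbTE ii0 /negbTE ii1]].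
  by rewrite !mxE eqxx eq_sym (negbTE i01) eqxx.
by rewrite !mxE ii0 ii1 subrr.
Qed.

Lemma pt_succ1 a b : pt a b + dir (i0, false) = pt a.+1 b.
Proof.
apply/rowP => i; rewrite /dir /= expr0 mulr1z !mxE eqxx /=.
case: (eqVneq i i0) => _; last by rewrite addr0.
by rewrite intS addrC.
Qed.

Lemma pt_pred1 a b : pt a.+1 b + dir (i0, true) = pt a b.
Proof.
rewrite -pt_succ1 /dir /= expr0 expr1 mulr1z mulrNz mulr1z addrK//.
Qed.

Lemma pt_succ2 a b : pt a b + dir (i1, false) = pt a b.+1.
Proof.
apply/rowP => i; rewrite /dir /= expr0 mulr1z !mxE eqxx /=.
case: (eqVneq i i0) => [->|_]; first by rewrite (negbTE i01) addr0.
by case: eqVneq => _; rewrite ?addr0// intS addrC.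
Qed.

Lemma pt_pred2 a b : pt a b.+1 + dir (i1, true) = pt a b.
Proof.
rewrite -pt_succ2 /dir /= expr0 expr1 mulr1z mulrNz mulr1z addrK//.
Qed.

Lemma box_diam m x x' : x \in box m.+1 -> x' \in box m.+1 -> (norm1 (x' - x) <= 2 * m)%N.
Proof. by move=> /mem_box[a am [b bm ->]] /mem_box[a' am' [b' bm' ->]]; rewrite norm1_pt; lia. Qed.

Lemma box_connected m w x : w \in box m -> x \in box m -> x != w ->
  exists2 e, x + dir e \in box m & (norm1 (w - (x + dir e))).+1 = norm1 (w - x).
Proof.
move=> /mem_box[a am [b bm ->]] /mem_box[a' am' [b' bm' ->]] ne.
have [aa|aa|aa] := ltngtP a a'.
- case: a' am' aa {ne} => // a' am' aa; exists (i0, true); rewrite pt_pred1.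
    by apply/mem_box; exists a'; [lia|exists b'].
  by rewrite !norm1_pt; lia.
- exists (i0, false); rewrite pt_succ1.
    by apply/mem_box; exists a'.+1; [lia|exists b'].
  by rewrite !norm1_pt; lia.
have [bb|bb|bb] := ltngtP b b'.
- case: b' bm' bb {ne} => // b' bm' bb; exists (i1, true); rewrite pt_pred2.
    by apply/mem_box; exists a' => //; exists b' => //; lia.
  by rewrite !norm1_pt; lia.
- exists (i1, false); rewrite pt_succ2.
    by apply/mem_box; exists a' => //; exists b'.+1 => //; lia.
  by rewrite !norm1_pt; lia.
by rewrite aa bb eqxx in ne.
Qed.

(** Only sites of [s] can have value 0, and the square of side [size s + 2] has more than [size s]
    sites besides its corner; the least m whose next square meets the value 1 is taken. *)
Lemma box_scale s c z : (forall x, x \notin s -> c x) ->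
  exists m, [/\ (0 < m < (size s).+2)%N,
    forall x, x \in box m -> x != 0 -> ~~ c (z + x) &
    exists2 x, x \in box m.+1 & (x != 0) && c (z + x)].
Proof.
move=> cs; pose P m := has (fun x => (x != 0) && c (z + x)) (box m.+1).
have Pn : P (size s).+1.
  apply/negPn/negP => /hasPn h.
  have sub : {subset [seq z + x | x <- rem 0 (box (size s).+2)] <= s}.
    move=> t /mapP[x]; rewrite mem_rem_uniq ?box_uniq// inE => /andP[x0 xb] ->{t}.
    by apply/negPn/negP => /cs czx; have := h x xb; rewrite x0 czx.
  have := uniq_leq_size _ sub; rewrite map_inj_uniq; last exact: addrI.
  rewrite rem_uniq ?box_uniq// size_map size_rem ?size_box; last first.
    by apply/mem_box; exists 0%N => //; exists 0%N => //; rewrite pt00.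
  by move=> /(_ isT); rewrite -mulnn 2!mulSn; move: (size s) => n; move: (n * _)%N => k; lia.
have exP : exists m, P m by exists (size s).+1.
case: (ex_minnP exP) => m Pm mmin; exists m; split.
- rewrite ltnS (mmin _ Pn) andbT lt0n; apply/eqP => m0; move: Pm; rewrite m0.
  move=> /hasP[x /mem_box[a a1 [b b1 ->]]]; have -> : a = 0%N by lia. have -> : b = 0%N by lia.
  by rewrite pt00 eqxx.
- case: m Pm mmin => // m Pm mmin x xb x0; apply/negP => cx.
  have : P m by apply/hasP; exists x => //; rewrite x0.
  by move=> /mmin; rewrite ltnn.
- by move/hasP: Pm.
Qed.

End Square.

(** The inverse of [step * dinv] from the block comparison. *)
Definition block_rate (R : realType) (d : nat) : R := ((2 * d)%:R^-1 * expR (- 2) * (2 * d)%:R^-1)^-1.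

Lemma block_rate_ge1 (R : realType) (d : nat) : (0 < d)%N -> 1 <= block_rate R d.
Proof.
move=> d_gt0.
have d1 : 0 < (2 * d)%:R^-1 :> R by rewrite invr_gt0 ltr0n; lia.
have d2 : (2 * d)%:R^-1 <= 1 :> R by rewrite invf_le1 ?ler1n ?ltr0n; lia.
have e1 : expR (- 2) <= 1 :> R by rewrite -[leRHS]expR0 ler_expR; lra.
rewrite /block_rate invf_ge1 ?mulr_gt0 ?expR_gt0// !mulr_ile1 ?mulr_ge0 ?expR_ge0 ?(ltW d1)//.
Qed.

(** * Quenched upper bound for d >= 2 and lam <= 1 *)

Section QuenchedPlane.
Context {R : realType} {d : nat} (d_gt0 : (0 < d)%N).
Local Notation site := 'rV[int]_d.
Local Notation config := (site -> bool).
Variables (i0 i1 : 'I_d).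
Hypothesis i01 : i0 != i1.
Variables (lam : R) (y : site).
Hypothesis lam01 : 0 <= lam <= 1.
Implicit Types (c : config) (s h : seq site) (z : site).

Let lam0 : 0 <= lam. Proof. by have /andP[] := lam01. Qed.

Let block z m : seq site := [seq z + x | x <- box i0 i1 m].
Let vacant m : seq site := rem 0 (box i0 i1 m).

(* [m] ranges over the possible sides of the largest square at [z] that has no
   site with value 1, apart perhaps from [z]: the ratio is at most
   [block_rate ^+ (2 * m).+1], while such a square has probability
   [r ^+ (m ^ 2).-1]. *)
Lemma ln_ratio_block_sum s c z : (forall x, x \notin s -> c x) ->
  ln (weight lam y (up c z false)) - ln (weight lam y (up c z true)) <=
  \sum_(1 <= m < (size s).+2) block_rate R d ^+ (2 * m).+1 *
    (\prod_(a <- [seq z + x | x <- vacant m]) (~~ c a)%:R *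
     block_hit lam y (fun t => t \in block z m.+1) c).
Proof.
move=> cs; have [m [mM vac [x xb /andP[x0 cx]]]] := box_scale d_gt0 i01 z cs.
have term0 k : 0 <= block_rate R d ^+ (2 * k).+1 *
    (\prod_(a <- [seq z + x | x <- vacant k]) (~~ c a)%:R *
     block_hit lam y (fun t => t \in block z k.+1) c).
  rewrite mulr_ge0 ?exprn_ge0 ?(le_trans _ (block_rate_ge1 R d_gt0))// mulr_ge0 ?block_hit_ge0//.
  exact: prodr_ge0.
have mB : m \in index_iota 1 (size s).+2 by rewrite mem_index_iota.
rewrite (bigD1_seq m) ?iota_uniq//=.
apply: (@le_trans _ _ (block_rate R d ^+ (2 * m).+1 *
    (\prod_(a <- [seq z + x | x <- vacant m]) (~~ c a)%:R *
     block_hit lam y (fun t => t \in block z m.+1) c))); last first.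
  by rewrite lerDl; apply: sumr_ge0 => k _; exact: term0.
have -> : \prod_(a <- [seq z + x | x <- vacant m]) (~~ c a)%:R = 1 :> R.
  rewrite big_seq big1// => t /mapP[u]; rewrite mem_rem_uniq ?box_uniq// inE => /andP[u0 ub] ->.
  by rewrite vac.
rewrite mul1r /block_rate exprVn.
have inB t : t \in block z m.+1 -> exists2 u, u \in box i0 i1 m.+1 & t = z + u by move/mapP.
apply: (@ln_ratio_block _ _ d_gt0 _ _ lam01 (fun t => t \in block z m.+1) (2 * m) (z + x)).
- move=> b b' /inB[u ub ->] /inB[u' ub' ->].
  by rewrite opprD addrACA subrr add0r; exact: (box_diam d_gt0 i01).
- move=> b /inB[u ub ->]; rewrite (inj_eq (addrI z)) => ux.
  have [e eb en] := box_connected d_gt0 i01 xb ub ux.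
  exists e; first by rewrite -addrA map_f.
  have sub_z t : z + x - (z + t) = x - t by rewrite opprD addrACA subrr add0r.
  by rewrite -(addrA z u) 2!sub_z.
- exact: map_f.
- rewrite -[X in X \in _]addr0; apply: map_f; rewrite -(pt00 i0 i1).
  by apply/mem_box; exists 0%N => //; exists 0%N.
- by rewrite -[X in _ != X]addr0 (inj_eq (addrI z)).
- exact: cx.
Qed.

Lemma quenched_plane (rho r C : R) s : 0 <= r <= 1 -> visit r <= rho -> rho < 1 ->
  uniq s -> (0 < norm1 y)%N -> 0 <= C ->
  (forall M, \sum_(1 <= m < M) block_rate R d ^+ (2 * m).+1 * r ^+ (m ^ 2).-1 * (m.+1 ^ 2)%:R <= C) ->
  \sum_(z <- s) Er r s (fun c =>
     ln (weight lam y (up c z false)) - ln (weight lam y (up c z true))) full <=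
  C * (crossing_cost R d / - ln rho * (norm1 y)%:R).
Proof.
move=> r01 vr rho1 us L0 C0 hC; set D := _ * (norm1 y)%:R.
have br0 : 0 <= block_rate R d by apply: le_trans (block_rate_ge1 R d_gt0).
have [r0 r1] := andP r01.
have rho0 : 0 < rho by exact: lt_le_trans (visit_gt0 r01) vr.
have D0 : 0 <= D.
  have cc0 : 0 <= crossing_cost R d := le_trans ler01 (crossing_cost_ge1 R d_gt0).
  apply: mulr_ge0 => //; apply: divr_ge0 => //.
  by rewrite oppr_ge0 ln_le0// ltW.
pose hitr t c := weight_hit lam y t c / weight lam y c.
pose T m z := \sum_(x <- box i0 i1 m.+1) Er r s (hitr (z + x)) full.
apply: (@le_trans _ _ (\sum_(z <- s) \sum_(1 <= m < (size s).+2)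
    block_rate R d ^+ (2 * m).+1 * (r ^+ (m ^ 2).-1 * T m z))).
  apply: ler_sum => z _.
  apply: (@le_trans _ _ (Er r s (fun c => \sum_(1 <= m < (size s).+2) block_rate R d ^+ (2 * m).+1 *
    (\prod_(a <- [seq z + x | x <- vacant m]) (~~ c a)%:R *
     block_hit lam y (fun t => t \in block z m.+1) c)) full)).
    by apply: le_Er r01 _ => c cs; apply: ln_ratio_block_sum => x xs; rewrite cs.
  rewrite Er_sum; apply: ler_sum => m _; rewrite ErZ ler_wpM2l ?exprn_ge0//.
  (* The vacant square lies inside the block, whose values [block_hit] ignores. *)
  apply: le_trans (Er_block r01 us _ _ _) _.
  - by rewrite map_inj_uniq ?rem_uniq ?box_uniq//; exact: addrI.
  - by move=> c; exact: block_hit_ge0.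
  - move=> c t b /mapP[x xv ->]; apply: block_hit_up; apply: map_f.
    move: xv => /mem_rem /mem_box[a am [b' bm ->]].
    by apply/mem_box; exists a; [exact: ltnW|exists b'; [exact: ltnW|]].
  rewrite size_map /vacant; case: (posnP m) => [->|m0].
    rewrite /= !expr0 !mul1r /T -Er_sum; apply: le_Er r01 _ => c _.
    by apply: le_trans (block_hit_le d_gt0 y lam01 (block z 1) c) _; rewrite big_map.
  rewrite size_rem ?size_box; last first.
    by apply/mem_box; exists 0%N => //; exists 0%N => //; rewrite pt00.
  rewrite ler_wpM2l ?exprn_ge0// /T -Er_sum; apply: le_Er r01 _ => c _.
  by apply: le_trans (block_hit_le d_gt0 y lam01 (block z m.+1) c) _; rewrite big_map.
(* With the sums exchanged, each x in the square contributes the range counted over the translate of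
   [s] by x; altogether (m + 1)^2 times D. *)
rewrite exchange_big/=.
apply: (@le_trans _ _ (\sum_(1 <= m < (size s).+2)
   block_rate R d ^+ (2 * m).+1 * r ^+ (m ^ 2).-1 * (m.+1 ^ 2)%:R * D)); last first.
  by rewrite -mulr_suml ler_wpM2r.
apply: ler_sum => m _; rewrite -2!mulr_sumr mulrA -[leRHS]mulrA.
apply: ler_wpM2l; first by rewrite mulr_ge0 ?exprn_ge0.
rewrite /T exchange_big/=.
apply: (@le_trans _ _ (\sum_(x <- box i0 i1 m.+1) D)); last first.
  by rewrite big_const_seq count_predT iter_addr_0 (size_box i0 i1) mulr_natl.
apply: ler_sum => x _; rewrite -Er_sum.
have := @quenched_range _ _ d_gt0 lam y lam0 rho r s [seq z + x | z <- s] r01 vr rho1 us _ L0.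
rewrite map_inj_uniq; last exact: addIr.
move=> /(_ us); apply: le_trans; apply: le_Er r01 _ => c _.
by rewrite big_map.
Qed.

End QuenchedPlane.

Lemma arith_geo_sum_le (R : realFieldType) (q : R) M : 0 <= q < 1 ->
  \sum_(0 <= m < M) m.+1%:R * q ^+ m <= (1 - q) ^- 2.
Proof.
move=> /andP[q0 q1]; have q2 : 0 < (1 - q) ^+ 2 by rewrite exprn_gt0// subr_gt0.
rewrite -[leRHS]mul1r ler_pdivlMr//.
have -> : (\sum_(0 <= m < M) m.+1%:R * q ^+ m) * (1 - q) ^+ 2 =
    1 - M.+1%:R * q ^+ M + M%:R * q ^+ M.+1.
  elim: M => [|M IH]; first by rewrite big_geq// mul0r expr0; ring.
  by rewrite big_nat_recr//= mulrDl IH !exprS -!natr1; ring.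
rewrite -addrA gerDl addrC subr_le0 exprS mulrA ler_wpM2r ?exprn_ge0//.
apply: le_trans (_ : M%:R <= _); last by rewrite ler_nat.
by rewrite ler_piMr ?ler0n// ltW.
Qed.

Lemma sum_subseq_le (R : numDomainType) (T : eqType) (s t : seq T) (f : T -> R) :
  uniq s -> {subset s <= t} -> (forall x, 0 <= f x) ->
  \sum_(x <- s) f x <= \sum_(x <- t) f x.
Proof.
move=> us st f0; elim: s t us st => [|x s IH] t /=.
  by move=> _ _; rewrite big_nil sumr_ge0.
move=> /andP[xs us] st; rewrite big_cons [leRHS](big_rem x) ?st ?mem_head//= lerD2l.
apply: IH => // v vs; have vt : v \in t by rewrite st// in_cons vs orbT.
have vx : v != x by apply: contraNneq xs => <-.
by move: vt; rewrite (perm_mem (perm_to_rem (st _ (mem_head x s)))) in_cons (negbTE vx).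
Qed.

(** * Walks on Z *)

Section Line.
Context {R : realType}.
Local Notation site := 'rV[int]_1.
Local Notation config := (site -> bool).
Implicit Types (k : site -> R) (a b : int).

Definition pos a : site := const_mx a.

Lemma site_posE (x : site) : x = pos (x 0 0).
Proof. by apply/rowP => i; rewrite !mxE ord1. Qed.

Lemma pos_inj : injective pos.
Proof. by move=> a b /rowP/(_ 0); rewrite !mxE. Qed.

Lemma pos0 : pos 0 = 0. Proof. by apply/rowP => i; rewrite !mxE. Qed.

Lemma pos_dir a (e : 'I_1 * bool) : pos a + dir e = pos (a + (-1) ^+ e.2).
Proof.
apply/rowP => i; case: e => j b; rewrite /dir !mxE !ord1 /=; case: b;
  by rewrite ?expr1 ?expr0 ?mulrNz ?mulr1z !mxE.
Qed.

Lemma avg_pos (f : site -> R) a : avg f (pos a) = (f (pos (a + 1)) + f (pos (a - 1))) / 2.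
Proof.
rewrite /avg -(pair_bigA _ (fun i (s : bool) => f (pos a + dir (i, s)))) /= big_ord1 big_bool.
by rewrite !pos_dir /= expr1 expr0 mulrC addrC.
Qed.

Lemma pos_addI b : injective (fun i : nat => pos (b + i%:Z)).
Proof. by move=> i j /pos_inj; lia. Qed.

Lemma pos_subI b : injective (fun j : nat => pos (b - j.+1%:Z)).
Proof. by move=> i j /pos_inj; lia. Qed.

Lemma pos_add_neq b (i : nat) : (0 < i)%N -> (pos (b + i%:Z) == pos b) = false.
Proof. by move=> i0; rewrite (inj_eq pos_inj); lia. Qed.

Lemma pos_add_sub_neq b (i j : nat) : (pos (b + i%:Z) == pos (b - j.+1%:Z)) = false.
Proof. by rewrite (inj_eq pos_inj); lia. Qed.

Lemma abs_coord_inj (u v : site) : (u 0 0 < 0) = (v 0 0 < 0) ->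
  absz (u 0 0) = absz (v 0 0) -> u = v.
Proof.
move=> uv abs_uv; rewrite (site_posE u) (site_posE v); congr pos.
by move: uv abs_uv; move: (u 0 0) (v 0 0) => a b; lia.
Qed.

Lemma ltn_abs a b : ~~ (a < 0) -> a < b -> (`|a| < `|b|)%N.
Proof. lia. Qed.

Lemma norm1_pos a : norm1 (pos a) = `|a|%N.
Proof. by rewrite /norm1 big_ord1 mxE. Qed.

Section Killing.
Variables (k : site -> R) (L : int).
Hypothesis kk : killing k.
Let d1 : (0 < 1)%N := isT.
Let u := travel k (pos L).

Let u0 x : 0 <= u x. Proof. exact: travel_ge0. Qed.

Let k_le a (v w : R) : 0 <= v -> v <= w -> k (pos a) * v <= w.
Proof.
move=> v0 vw; apply: le_trans vw; have /andP[k0 k1] := kk (pos a).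
by rewrite ler_piMl.
Qed.

(** A walk from a to L passes through b, and reaching b costs a factor of at most 1. *)
Lemma travel_line_nd a b : a <= b -> b < L -> u (pos a) <= u (pos b).
Proof.
move=> ab bL; pose g (x : site) := if x 0 0 <= b then u (pos b) else u x.
have -> : u (pos b) = g (pos a) by rewrite /g mxE ab.
apply: travel_le_super => //.
- by move=> x; rewrite /g; case: ifP.
- by rewrite /g mxE ifF ?/u ?travelxx//; lia.
move=> x; rewrite (site_posE x); move: (x 0 0) => t tL.
have [tb|bt] := ltP t b; last first.
  left; rewrite /g mxE; case: ifP => // tb; suff -> : t = b by [].
  by apply/eqP; rewrite eq_le tb.
right; rewrite avg_pos /g !mxE (ltW tb).
have -> : (t + 1 <= b) = true by lia.
have -> : (t - 1 <= b) = true by lia.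
apply: k_le; last by lra.
by apply: divr_ge0 => //; apply: addr_ge0.
Qed.

(* A walk to [L] from the left never goes beyond [L]. *)
Lemma hit_beyond a b : a <= L -> L <= b -> hit k (pos L) (pos b) (pos a) <= 0.
Proof.
move=> aL Lb; rewrite subr_le0; set v := travel (avoid _ _) _.
have ka := killing_avoid (pred1 (pos b)) kk.
pose g (x : site) := if x 0 0 <= L then v x else u x.
have -> : v (pos a) = g (pos a) by rewrite /g mxE aL.
apply: travel_le_super => //.
- by move=> x; rewrite /g; case: ifP => // _; exact: travel_ge0.
- by rewrite /g mxE lexx /v travelxx.
move=> x; rewrite (site_posE x); move: (x 0 0) => t tL.
have [tL'|Lt] := ltP t L; last first.
  left; rewrite /g mxE; case: ifP => // tL2; exfalso; move/eqP: tL; apply.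
  by congr pos; apply/eqP; rewrite eq_le tL2.
right; rewrite avg_pos /g !mxE (ltW tL').
have -> : (t + 1 <= L) = true by lia.
have -> : (t - 1 <= L) = true by lia.
have vE : v (pos t) = avoid (pred1 (pos b)) k (pos t) * avg v (pos t) := travelE d1 ka tL.
by rewrite vE avg_pos /avoid /= (inj_eq pos_inj) ifF//; lia.
Qed.

(* To hit [pos b] from the right the walk is killed with the product of the
   survival factors in between. *)
Lemma hit_left b : b < 0 -> 0 < L ->
  hit k (pos L) (pos b) 0 <= \prod_(i <- iota 1 `|b|) k (pos (b + i%:Z)) * u 0.
Proof.
move=> b0 L0; rewrite lerBlDl; set v := travel (avoid _ _) _.
have ka := killing_avoid (pred1 (pos b)) kk.
have ub : u (pos b) <= u 0 by rewrite -pos0; apply: travel_line_nd; lia.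
pose P (n : nat) := \prod_(i <- iota 1 n) k (pos (b + i%:Z)).
have P0 n : 0 <= P n by apply: prodr_ge0 => i _; exact: killing_ge0.
have PS n : P n.+1 = P n * k (pos (b + n.+1%:Z)).
  have iS : iota 1 n.+1 = iota 1 n ++ [:: n.+1] by rewrite -(addn1 n) iotaD add1n addn1.
  by rewrite /P iS big_cat big_seq1.
have v0 x : 0 <= v x by exact: travel_ge0.
pose g (x : site) := if b <= x 0 0 then P (absz (x 0 0 - b)%R) else 1.
have g0 x : 0 <= g x by rewrite /g; case: ifP.
apply: (@le_trans _ _ (v 0 + g 0 * u (pos b))); last first.
  rewrite lerD2l /g mxE (ltW b0) sub0r abszN; apply: ler_wpM2l => //; exact: P0.
apply: (@travel_le_super _ _ d1 k (pos L) (fun x => v x + g x * u (pos b))) => //.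
- by move=> x; rewrite addr_ge0 ?mulr_ge0.
- by rewrite /v travelxx// lerDl mulr_ge0.
move=> x; rewrite (site_posE x); move: (x 0 0) => t tL.
have [tb|bt] := leP t b.
  left; apply: le_trans (_ : 1 * u (pos b) <= _).
    by rewrite mul1r; apply: travel_line_nd => //; lia.
  rewrite ler_wpDl// ler_wpM2r// /g mxE; case: ifP => // bt.
  have -> : t = b by apply/eqP; rewrite eq_le tb.
  by rewrite subrr /P big_nil.
right; rewrite avgD avgZr mulrDr; apply: lerD.
  have vE : v (pos t) = avoid (pred1 (pos b)) k (pos t) * avg v (pos t) := travelE d1 ka tL.
  by rewrite vE /avoid /= (inj_eq pos_inj) gt_eqF.
rewrite mulrA ler_wpM2r// avg_pos /g !mxE.
have -> : (b <= t + 1) = true by lia.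
have -> : (b <= t - 1) = true by lia.
rewrite (ltW bt).
have [n tn] : exists n : nat, t = b + n.+1%:Z by exists (`|t - b|%N.-1); lia.
have -> : `|(t + 1 - b)%R|%N = n.+2 by lia.
have -> : `|(t - 1 - b)%R|%N = n by lia.
have -> : `|(t - b)%R|%N = n.+1 by lia.
(* [g] is a supersolution: the step towards b satisfies k(t) P(n) = P(n + 1), and the step away k(t)
   P(n + 2) <= P(n + 1). *)
have e : k (pos t) * P n = P n.+1 by rewrite PS -tn mulrC.
rewrite mulrA mulrDr e.
suff : k (pos t) * P n.+2 <= P n.+1 by move=> h; rewrite ler_pdivrMr// mulr_natr mulr2n lerD2r.
apply: k_le => //; rewrite PS; rewrite ler_piMr//; exact: killing_le1.
Qed.

End Killing.

End Line.

Lemma geo_sum_le (R : realFieldType) (q : R) M : 0 <= q < 1 ->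
  \sum_(i <- iota 0 M) q ^+ i <= (1 - q)^-1.
Proof.
move=> /andP[q0 q1]; have q2 : 0 < 1 - q by rewrite subr_gt0.
rewrite -[leRHS]mul1r ler_pdivlMr//.
have -> : (\sum_(i <- iota 0 M) q ^+ i) * (1 - q) = 1 - q ^+ M.
  elim: M => [|M IH]; first by rewrite big_nil mul0r subrr.
  rewrite -(addn1 M) iotaD add0n big_cat big_seq1 mulrDl IH addn1 exprS; ring.
by rewrite gerBl exprn_ge0.
Qed.

(** * Quenched upper bound for d = 1 *)

Section QuenchedLine.
Context {R : realType}.
Local Notation site := 'rV[int]_1.
Local Notation config := (site -> bool).
Variables (lam : R) (L : int).
Hypotheses (lam0 : 0 <= lam) (L0 : 0 < L).
Implicit Types (c : config) (s : seq site) (b : int).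
Let y : site := pos L.
Let d1 : (0 < 1)%N := isT.
Let w0 c : 0 < weight lam y c. Proof. exact: weight_gt0. Qed.

(** The constant of [travel_single_site] for a = e^-1 and eta = (1 - e^-1) / (2 (m + 1)), apart from
    the factor m + 1. *)
Definition line_rate : R := (expR (-1) * ((1 - expR (-1)) / 2))^-1.

Lemma line_rate_gt0 : 0 < line_rate.
Proof.
by rewrite invr_gt0 mulr_gt0 ?expR_gt0// divr_gt0// subr_gt0 expRN1_lt1.
Qed.

(** Gambler's ruin: from b the walk steps left with probability 1/2, then meets the site of value 1
    at distance m + 1 before returning with probability 1 / (m + 1), and dies there with probability
    at least 1 - e^-1. *)
Lemma left_gap_ratio c b (m : nat) : c (pos (b - m.+1%:Z)) ->
  weight lam y (up c (pos b) false) - weight lam y (up c (pos b) true) <=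
  line_rate * m.+1%:R * weight_hit lam y (pos b) (up c (pos b) true).
Proof.
move=> cw; set z := pos b; set M : R := m.+1%:R; have M0 : 0 < M by rewrite ltr0n.
have e1 := @expRN1_lt1 R; have e0 := expR_gt0 (-1 : R).
pose q : R := 1 - expR (-1); have q0 : 0 < q by rewrite subr_gt0.
apply: le_trans (weight_diff_le_hit d1 y lam0 z c) _.
rewrite !weight_hitE !weight_avoid_up -(weight_avoid_up lam y z false).
(* Linear, hence harmonic, between the values e^-1 at b - m - 1 and 1 at b. *)
pose lin t : R := 1 - q / M * (b - t)%:~R.
pose g (x : site) : R := if b - m.+1%:Z <= x 0 0 <= b then lin (x 0 0) else 1.
have lin01 t : b - m.+1%:Z <= t <= b -> 0 <= lin t <= 1.
  move=> /andP[t1 t2].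
  have h0 : 0 <= (b - t)%:~R :> R by rewrite ler0z; lia.
  have h1 : (b - t)%:~R <= M.
    by rewrite /M -[m.+1%:R]/(m.+1%:Z%:~R) ler_int; lia.
  rewrite /lin gerBl mulr_ge0 ?divr_ge0 ?(ltW q0) ?(ltW M0)// andbT subr_ge0.
  rewrite mulrAC ler_pdivrMr// mul1r; apply: le_trans (_ : 1 * (b - t)%:~R <= _).
    by apply: ler_wpM2r => //; rewrite /q gerBl ltW.
  by rewrite mul1r.
have g01 x : 0 <= g x <= 1 by rewrite /g; case: ifP => [/lin01 //|_]; rewrite ler01 lexx.
have avg01 x : 0 <= avg g x <= 1.
  apply/andP; split; first by apply: avg_ge0 => t; have /andP[] := g01 t.
  by rewrite -[leRHS](avg_cst d1 1 x); apply: le_avg => e; have /andP[] := g01 (x + dir e).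
have lin_avg t : (lin (t + 1) + lin (t - 1)) / 2 = lin t.
  rewrite /lin !(rmorphB, rmorphD) /=; field; lra.
have gE t : b - m.+1%:Z <= t <= b -> g (pos t) = lin t by rewrite /g mxE => ->.
have linb : lin b = 1 by rewrite /lin subrr mulr0 subr0.
have := @travel_single_site _ _ d1 (env lam (up c z false)) (env lam (up c z true)) y z
  (expR (-1)) (q / (2 * M)) (env_killing lam0 _) (env_killing lam0 _) _ _ (expR_gt0 _) _ g.
have -> : (expR (-1) * (q / (2 * M)))^-1 = line_rate * M.
  by rewrite /line_rate -/q; field; rewrite !gt_eqF.
apply.
- by move=> x xz; rewrite /env /up (negbTE xz).
- by rewrite /env !up_eq -expRD ler_expR /=; lra.
- by rewrite divr_gt0// mulr_gt0.
- by move=> x; have /andP[] := g01 x.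
- by rewrite /g mxE lexx andbT; case: ifP => // _; rewrite linb.
- move=> x xz; have /andP[a0 a1] := avg01 x.
  have kle1 : env lam (up c z false) x <= 1 by have /andP[] := env_killing lam0 (up c z false) x.
  have [xw|xw] := eqVneq (x 0 0) (b - m.+1%:Z).
    apply: (@le_trans _ _ (expR (-1) * 1)).
      rewrite ler_pM ?expR_ge0// /env ler_expR lerN2.
      have -> : up c z false x by rewrite /up (negbTE xz) (site_posE x) xw.
      by rewrite lerDl.
    rewrite mulr1 /g xw lexx; case: ifP => [_|/negP[]]; last by lia.
    rewrite /lin opprB addrCA subrr addr0 divfK ?gt_eqF// /q.
    by lra.
  have [inn|out] := boolP (b - m.+1%:Z <= x 0 0 <= b); last first.
    by rewrite {2}/g (negbTE out) mulr_ile1 ?expR_ge0.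
  have [t xt] : exists t, x = pos t by exists (x 0 0); rewrite -site_posE.
  rewrite xt mxE (inj_eq pos_inj) in xz xw inn kle1 a0 a1 *.
  rewrite (gE _ inn); apply: le_trans (_ : avg g (pos t) <= _); first by rewrite ler_piMl.
  by rewrite avg_pos !gE ?lin_avg//; lia.
- have /andP[a0 a1] := avg01 z.
  apply: le_trans (_ : avg g z <= _).
    by rewrite ler_piMl//; have /andP[] := env_killing lam0 (up c z false) z.
  rewrite /z avg_pos /g !mxE.
  have -> : (b - m.+1%:Z <= b + 1 <= b) = false by lia.
  have -> : (b - m.+1%:Z <= b - 1 <= b) = true by lia.
  have -> : lin (b - 1) = 1 - q / M.
    by rewrite /lin (_ : b - (b - 1) = 1) ?mulr1//; lia.
  rewrite [leRHS](_ : _ = (1 + (1 - q / M)) / 2) //; field; rewrite gt_eqF//.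
Qed.

(** The number of sites b + 1, ..., 0 that a walk from 0 has to survive in order to reach b. *)
Definition depth b : nat := if b < 0 then `|b|%N else 0.

Lemma hit_ratio_depth c b : b < L -> weight_hit lam y (pos b) c / weight lam y c <=
  \prod_(t <- [seq pos (b + i%:Z) | i <- iota 1 (depth b)]) occ c t.
Proof.
move=> bL; rewrite ler_pdivrMr// big_map /depth; case: ifPn => b0; last first.
  rewrite big_nil mul1r weight_hitE gerBl; exact: weight_avoid_ge0.
apply: le_trans (hit_left (env_killing lam0 c) b0 L0) _.
apply: (ler_wpM2r (ltW (w0 c))); apply: ler_prod => i _; rewrite expR_ge0 /= /env /occ ler_expR lerN2.
by rewrite lerDl.
Qed.

Lemma left_gap s c b : (forall x, x \notin s -> c x) ->
  exists m, [/\ (m <= size s)%N, c (pos (b - m.+1%:Z)) &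
    forall j, (j < m)%N -> ~~ c (pos (b - j.+1%:Z))].
Proof.
move=> cs; pose P m := c (pos (b - m.+1%:Z)).
have [m mP] : exists m, (m <= size s)%N && P m.
  apply: contrapT => nP.
  have sub : {subset [seq pos (b - j.+1%:Z) | j <- iota 0 (size s).+1] <= s}.
    move=> t /mapP[j]; rewrite mem_iota /= add0n ltnS => js ->.
    by apply/negPn/negP => /cs cj; apply: nP; exists j; rewrite js.
  have := uniq_leq_size _ sub; rewrite map_inj_uniq ?iota_uniq; last first.
    exact: pos_subI.
  by rewrite size_map size_iota => /(_ isT); rewrite ltnn.
have exP : exists m, (m <= size s)%N && P m by exists m.
case: (ex_minnP exP) => n /andP[ns Pn] nmin; exists n; split => // j jn.
apply/negP => Pj; have := nmin j; rewrite -/(P j) in Pj *.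
by rewrite Pj (leq_trans (ltnW jn) ns) => /(_ isT); rewrite leqNgt jn.
Qed.

(* [m] is the distance from [b] to the nearest site with value 1 on its left,
   minus 1. *)
Lemma ln_ratio_line s c b : b < L -> (forall x, x \notin s -> c x) ->
  ln (weight lam y (up c (pos b) false)) - ln (weight lam y (up c (pos b) true)) <=
  \sum_(0 <= m < (size s).+1) line_rate * m.+1%:R *
    (\prod_(a <- [seq pos (b - j.+1%:Z) | j <- iota 0 m]) (~~ c a)%:R *
     \prod_(t <- [seq pos (b + i%:Z) | i <- iota 1 (depth b)]) occ c t).
Proof.
move=> bL cs; have [m [ms cm vac]] := left_gap b cs.
have lr0 := ltW line_rate_gt0.
have occ0 c' : 0 <= \prod_(t <- [seq pos (b + i%:Z) | i <- iota 1 (depth b)]) occ c' t.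
  by apply: prodr_ge0 => t _; exact: expR_ge0.
have mB : m \in index_iota 0 (size s).+1 by rewrite mem_index_iota.
rewrite (bigD1_seq m) ?iota_uniq//=.
apply: (@le_trans _ _ (line_rate * m.+1%:R *
    (\prod_(a <- [seq pos (b - j.+1%:Z) | j <- iota 0 m]) (~~ c a)%:R *
     \prod_(t <- [seq pos (b + i%:Z) | i <- iota 1 (depth b)]) occ c t))); last first.
  rewrite lerDl; apply: sumr_ge0 => k _; apply: mulr_ge0; first by rewrite mulr_ge0.
  by apply: mulr_ge0; [apply: prodr_ge0 => t _; exact: ler0n|exact: occ0].
have -> : \prod_(a <- [seq pos (b - j.+1%:Z) | j <- iota 0 m]) (~~ c a)%:R = 1 :> R.
  rewrite big_map big_seq big1// => j; rewrite mem_iota add0n => /= jm.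
  by rewrite vac.
rewrite mul1r; have := @ln_ratio_ge R _ _ (w0 (up c (pos b) true)) (w0 (up c (pos b) false)).
rewrite -opprB mulNr -[X in _ <= X -> _]opprB lerN2 => h'; apply: le_trans h' _.
apply: (@le_trans _ _ (line_rate * m.+1%:R * (weight_hit lam y (pos b) (up c (pos b) true) /
   weight lam y (up c (pos b) true)))).
  by rewrite mulrA ler_pM2r ?invr_gt0//; exact: left_gap_ratio.
rewrite ler_wpM2l ?mulr_ge0//; apply: le_trans (hit_ratio_depth _ bL) _.
rewrite le_eqVlt; apply/orP; left; apply/eqP; rewrite !big_map; apply: eq_big_seq => i.
rewrite mem_iota /occ /up => /andP[i1 _].
by rewrite pos_add_neq.
Qed.

Lemma ln_ratio_beyond c b : L <= b ->
  ln (weight lam y (up c (pos b) false)) - ln (weight lam y (up c (pos b) true)) <= 0.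
Proof.
move=> Lb; rewrite subr_le0 ler_ln ?posrE//.
have h c' : weight_hit lam y (pos b) c' <= 0.
  rewrite /weight_hit -pos0; apply: hit_beyond => //; [exact: env_killing|exact: ltW].
have := h (up c (pos b) false); rewrite weight_hitE weight_avoid_up.
have := weight_hit_ge0 d1 y lam0 (pos b) (up c (pos b) true).
rewrite weight_hitE weight_avoid_up; lra.
Qed.

(** The gap lies to the left of b and the sites b + 1, ..., 0 to its right, so their contributions
    are independent. The gap gives (1 - q)^-2 after summation over m. The sites give rho^depth,
    which sums to at most L over 0 <= b < L and to at most (1 - rho)^-1 <= (1 - rho)^-1 L over b <
    0. *)
Lemma quenched_line (rho r q : R) s : 0 <= r <= q -> q < 1 -> visit r <= rho -> rho < 1 ->
  uniq s ->
  \sum_(z <- s) Er r s (fun c =>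
     ln (weight lam y (up c z false)) - ln (weight lam y (up c z true))) full <=
  line_rate * (1 - q) ^- 2 * (1 + (1 - rho)^-1) * L%:~R.
Proof.
move=> /andP[r0 rq] q1 vr rho1 us.
have r01 : 0 <= r <= 1 by apply/andP; split => //; lra.
have rho0 : 0 < rho by exact: lt_le_trans (visit_gt0 r01) vr.
have lr0 := ltW line_rate_gt0.
set D := line_rate * (1 - q) ^- 2.
have D0 : 0 <= D by rewrite mulr_ge0// invr_ge0 exprn_ge0// subr_ge0 ltW.
pose f (z : site) := if z 0 0 < L then rho ^+ depth (z 0 0) else 0.
apply: (@le_trans _ _ (\sum_(z <- s) D * f z)).
  apply: ler_sum => z _; rewrite (site_posE z); move: (z 0 0) => b; rewrite /f mxE.
  case: ltP => bL; last first.
    by rewrite mulr0 -[leRHS](Er_cst r s 0 full); apply: le_Er r01 _ => c _; exact: ln_ratio_beyond.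
  apply: (@le_trans _ _ (Er r s (fun c => \sum_(0 <= m < (size s).+1) line_rate * m.+1%:R *
    (\prod_(a <- [seq pos (b - j.+1%:Z) | j <- iota 0 m]) (~~ c a)%:R *
     \prod_(t <- [seq pos (b + i%:Z) | i <- iota 1 (depth b)]) occ c t)) full)).
    by apply: le_Er r01 _ => c cs; apply: ln_ratio_line => // x xs; rewrite cs.
  rewrite Er_sum; apply: (@le_trans _ _ (\sum_(0 <= m < (size s).+1)
     line_rate * (m.+1%:R * q ^+ m) * rho ^+ depth b)); last first.
    rewrite -mulr_suml -mulr_sumr ler_wpM2r ?exprn_ge0 ?(ltW rho0)// ler_wpM2l//.
    by apply: arith_geo_sum_le; rewrite q1 andbT; exact: le_trans rq.
  apply: ler_sum => m _; rewrite ErZ -!mulrA ler_wpM2l// ler_wpM2l//.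
  apply: le_trans (Er_block r01 us _ _ _) _.
  - by rewrite map_inj_uniq ?iota_uniq//; exact: pos_subI.
  - by move=> c; apply: prodr_ge0 => t _; exact: expR_ge0.
  - move=> c t v /mapP[j _ ->]; rewrite !big_map; apply: eq_big_seq => i.
    rewrite mem_iota /occ /up => /andP[i1 _].
    by rewrite pos_add_sub_neq.
  rewrite size_map size_iota; apply: ler_pM; rewrite ?exprn_ge0//.
  - by apply: Er_ge0 => // c; apply: prodr_ge0 => t _; exact: expR_ge0.
  - by apply: lerXn2r; rewrite ?nnegrE//; exact: le_trans rq.
  apply: le_trans (Er_prod_occ r01 us _) _.
    by rewrite map_inj_uniq ?iota_uniq//; exact: pos_addI.
  rewrite size_map size_iota; apply: lerXn2r; rewrite ?nnegrE ?(ltW rho0)//.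
  exact/ltW/visit_gt0.
rewrite -mulr_sumr -mulrA; apply: ler_wpM2l => //.
rewrite (bigID (fun z : site => z 0 0 < 0)) /= [leRHS]mulrDl addrC; apply: lerD.
  rewrite mul1r (bigID (fun z : site => z 0 0 < L)) /= [X in _ + X]big1 => [|z /andP[_ /negbTE zL]]; last first.
    by rewrite /f zL.
  rewrite addr0 (eq_bigr (fun=> 1)) => [|z /andP[z0 zL]]; last first.
    by rewrite /f zL /depth (negbTE z0) expr0.
  rewrite -big_filter -[X in X <= _](big_map (fun z : site => absz (z 0 0)) predT (fun=> 1)).
  apply: (@le_trans _ _ (\sum_(i <- iota 0 `|L|) 1)).
    apply: sum_subseq_le => //.
      rewrite map_inj_in_uniq ?filter_uniq// => u v.
      rewrite !mem_filter => /andP[/andP[/negbTE u0 _] _] /andP[/andP[/negbTE v0 _] _] uv.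
      by apply: abs_coord_inj; rewrite ?u0 ?v0.
    by move=> i /mapP[z]; rewrite mem_filter mem_iota => /andP[/andP[z0 zL] _] ->; exact: ltn_abs.
  rewrite big_const_seq count_predT size_iota iter_addr_0.
  by rewrite -[in leRHS](gtz0_abs L0).
apply: (@le_trans _ _ ((1 - rho)^-1 * 1)); last first.
  by rewrite ler_wpM2l ?invr_ge0 ?subr_ge0 ?(ltW rho1)// ler1z -gtz0_ge1.
rewrite mulr1 (eq_bigr (fun z : site => rho ^+ absz (z 0 0))) => [|z z0]; last first.
  by rewrite /f /depth z0 (lt_trans z0).
rewrite -big_filter -[X in X <= _](big_map (fun z : site => absz (z 0 0)) predT (fun i => rho ^+ i)).
set l := map _ _.
apply: le_trans (geo_sum_le (\max_(i <- l) i).+1 _); last by rewrite (ltW rho0).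
apply: sum_subseq_le.
- rewrite map_inj_in_uniq ?filter_uniq// => u v.
  rewrite !mem_filter => /andP[u0 _] /andP[v0 _] uv.
  by apply: abs_coord_inj; rewrite ?u0 ?v0.
- by move=> i il; rewrite mem_iota /= add0n ltnS; exact: leq_bigmax_seq.
- by move=> i; rewrite exprn_ge0 ?(ltW rho0).
Qed.

End QuenchedLine.

(** * The law of the walk and the recursion for the weights *)

Section WalkLaw.
Context {R : realType} {d : nat} (d_gt0 : (0 < d)%N).
Local Notation site := 'rV[int]_d.
Implicit Types (k : site -> R) (y z : site) (s : nat -> site).

(** The functional of one trajectory whose expectation is [travelN]. *)
Fixpoint walkN k y N s : R :=
  if s 0%N == y then 1 else
  if N is N'.+1 then k (s 0%N) * walkN k y N' (fun n => s n.+1) else 0.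

Lemma walkN01 k y N s : killing k -> 0 <= walkN k y N s <= 1.
Proof.
move=> kk; elim: N s => [|N IH] s /=; case: eqP; rewrite ?ler01 ?lexx// => _.
have /andP[k0 k1] := kk (s 0%N); have /andP[w0 w1] := IH (fun n => s n.+1).
by rewrite mulr_ge0// mulr_ile1.
Qed.

Lemma walkN_hit k y n N s : (forall j, (j < n)%N -> s j != y) -> s n = y ->
  (n <= N)%N -> walkN k y N s = \prod_(j < n) k (s j).
Proof.
elim: n N s => [|n IH] N s sn sy nN.
  by case: N nN => [|N] _ /=; rewrite sy eqxx big_ord0.
case: N nN => // N nN /=; rewrite (negbTE (sn 0%N isT)) big_ord_recl.
by congr (_ * _); apply: IH => // j jn; exact: sn.
Qed.

Lemma walkN_nohit k y N s : (forall j, s j != y) -> walkN k y N s = 0.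
Proof.
elim: N s => [|N IH] s sy /=; rewrite (negbTE (sy 0%N))//.
by rewrite IH ?mulr0.
Qed.

Lemma walkN_cvg (V : site -> R) y s :
  walkN (fun z => expR (- V z)) y N s @[N --> \oo] --> hitting_weight V y s.
Proof.
rewrite /hitting_weight /hitting_time; case: pselect => [ex|nex] /=.
  case: ex_minnP => n /eqP sn nmin; apply: cvg_near_cst.
  exists n => // N /= nN; rewrite (walkN_hit _ _ sn nN) => [|j jn].
    by rewrite -sumrN expR_sum.
  by apply/negP => /nmin; rewrite leqNgt jn.
apply: cvg_near_cst; apply: nearW => N; rewrite walkN_nohit// => j.
by apply/negP => sj; apply: nex; exists j.
Qed.

Variables (dW : measure_display) (W : measurableType dW).
Variables (Px : site -> probability W R) (S : nat -> W -> site).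
Hypothesis srw : simple_random_walk Px S.

Lemma walk_measurable n (A : set site) : measurable [set w | A (S n w)].
Proof.
pose F i : set W := if unpickle i is Some z then
  (if `[< A z >] then [set w | S n w = z] else set0) else set0.
have -> : [set w | A (S n w)] = \bigcup_(i in setT) F i.
  apply/seteqP; split => [w /= Aw|w [i _]].
    by exists (pickle (S n w)) => //; rewrite /F pickleK asboolT.
  by rewrite /F; case: unpickle => //= z; case: asboolP => // Az /= ->.
apply: bigcup_measurable => i _; rewrite /F; case: unpickle => // z.
by case: ifP => // _; exact: srw.1.
Qed.

Lemma walk_measurable_fun n (f : site -> R) : measurable_fun setT (fun w => f (S n w)).
Proof. by move=> _ Y mY; rewrite setTI; exact: (walk_measurable n (f @^-1` Y)). Qed.

Lemma walkN_measurable k y N n :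
  measurable_fun setT (fun w => walkN k y N (fun j => S (n + j) w)).
Proof.
elim: N n => [|N IH] n /=; rewrite addn0.
  exact: (walk_measurable_fun n (fun z => if z == y then 1 else 0)).
apply: measurable_fun_ifT => //.
  apply: (measurable_fun_bool true); rewrite setTI.
  exact: (walk_measurable n (fun z => z == y)).
apply: measurable_funM; first exact: walk_measurable_fun.
have -> : (fun w => walkN k y N (fun j => S (n + j.+1) w)) =
    (fun w => walkN k y N (fun j => S (n.+1 + j) w)).
  by apply/funext => w; congr walkN; apply/funext => j; rewrite addnS.
exact: IH.
Qed.

Definition prefix_event (g : nat -> site) n : set W :=
  [set w | forall j, (j <= n)%N -> S j w = g j].

Lemma prefix_eventS g n :
  prefix_event g n.+1 = prefix_event g n `&` [set w | S n.+1 w = g n.+1].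
Proof.
apply/seteqP; split => w /=.
  by move=> h; split; [move=> j jn; apply: h; exact: leqW|exact: h].
move=> [h e] j; rewrite leq_eqVlt => /orP[/eqP->//|]; exact: h.
Qed.

Lemma prefix_event_measurable g n : measurable (prefix_event g n).
Proof.
elim: n => [|n IH]; last by rewrite prefix_eventS; apply: measurableI => //; exact: srw.1.
have -> : prefix_event g 0 = [set w | S 0 w = g 0%N].
  by apply/seteqP; split => w /= h; [exact: h|move=> j; rewrite leqn0 => /eqP->].
exact: srw.1.
Qed.

Definition extend (g : nat -> site) n z : nat -> site := fun j => if j == n.+1 then z else g j.

Lemma prefix_event_extend g n z :
  prefix_event (extend g n z) n.+1 = prefix_event g n `&` [set w | S n.+1 w = z].
Proof.
rewrite prefix_eventS; congr (_ `&` _); last by rewrite /extend eqxx.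
by apply/seteqP; split => w /= h j jn; rewrite (h j jn) /extend ltn_eqF.
Qed.

Lemma l1norm_dir (e : 'I_d * bool) : l1norm (dir e) = 1.
Proof.
have -> : l1norm (dir e) = (norm1 (dir e))%:Z; last by rewrite norm1_dir.
by rewrite /l1norm /norm1 (big_morph Posz PoszD (erefl _)); apply: eq_bigr => i _; rewrite abszE.
Qed.

Local Open Scope ereal_scope.

Lemma prefix_event_step x g n e :
  Px x (prefix_event (extend g n (g n + dir e)%R) n.+1) =
  Px x (prefix_event g n) * ((2 * d)%:R^-1)%:E.
Proof.
have e0 : extend g n (g n + dir e)%R 0 = g 0%N by [].
rewrite /prefix_event !srw.2 e0; case: ifP => _; last by rewrite mul0e.
rewrite -EFinM big_ord_recr /=; congr ((_ * _)%:E).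
  apply: eq_bigr => i _; have iln := ltn_ord i.
  have -> : extend g n (g n + dir e)%R i = g i by rewrite /extend ltn_eqF// ltnS ltnW.
  by have -> : extend g n (g n + dir e)%R i.+1 = g i.+1 by rewrite /extend ltn_eqF.
rewrite /extend eqxx ltn_eqF// /srw_kernel addrAC subrr add0r.
by rewrite l1norm_dir eqxx.
Qed.

Lemma dir_inj : injective (@dir d).
Proof.
move=> [i b] [i' b'] /rowP h; have := h i; have := h i'; rewrite /dir /=.
case: b {h}; case: b'; rewrite ?expr1 ?expr0 ?mulrNz ?mulr1z !mxE !eqxx /=;
  case: (eqVneq i i') => [->|] //=; rewrite ?oppr0//.
Qed.

Lemma sum_dir_cst (a : R) : (\sum_(e : 'I_d * bool) a * (2 * d)%:R^-1 = a)%R.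
Proof.
rewrite -mulr_sumr sumr_const card_prod card_ord card_bool (mulnC d) -[X in (_ * X)%R]mulr_natl.
by rewrite mulfV ?mulr1// pnatr_eq0; lia.
Qed.

(** The continuations of a prefix along an edge of the lattice. They exhaust the prefix event up to
    a null set, since 2d probabilities, each (2d)^-1 times that of the prefix, add up to it. *)
Definition next_event g n : set W :=
  \big[setU/set0]_(e <- index_enum {: 'I_d * bool})
    prefix_event (extend g n (g n + dir e)%R) n.+1.

Lemma next_event_measurable g n : measurable (next_event g n).
Proof. by apply: bigsetU_measurable => e _; exact: prefix_event_measurable. Qed.

Lemma integral_next_event x g n (f : W -> \bar R) :
  measurable_fun setT f -> (forall w, 0 <= f w) ->
  \int[Px x]_(w in next_event g n) f w =
  \sum_(e : 'I_d * bool) \int[Px x]_(w in prefix_event (extend g n (g n + dir e)%R) n.+1) f w.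
Proof.
move=> mf f0; rewrite ge0_integral_bigsetU//.
- by move=> e; exact: prefix_event_measurable.
- exact: index_enum_uniq.
- apply/trivIsetP => e e' _ _ ee'; rewrite !prefix_event_extend.
  apply/seteqP; split => w //= [[_ h] [_ h']].
  by move/eqP: ee'; apply; apply: dir_inj; apply: (addrI (g n)); rewrite -h.
- exact: measurable_funTS.
Qed.

Lemma prefix_event_prob x g n : exists2 a : R, (0 <= a)%R & Px x (prefix_event g n) = a%:E.
Proof.
exists (fine (Px x (prefix_event g n))); first by rewrite fine_ge0.
by rewrite fineK// fin_num_measure//; exact: prefix_event_measurable.
Qed.

Lemma next_event_prob x g n : Px x (next_event g n) = Px x (prefix_event g n).
Proof.
transitivity (\int[Px x]_(w in next_event g n) cst 1 w).
  by rewrite integral_cst ?mul1e//; exact: next_event_measurable.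
rewrite integral_next_event//.
have [a a0 aE] := prefix_event_prob x g n; rewrite aE -[in RHS](sum_dir_cst a).
rewrite -sumEFin; apply: eq_bigr => e _.
rewrite integral_cst; last exact: prefix_event_measurable.
by rewrite mul1e; apply: etrans (prefix_event_step x g n e) _; rewrite aE EFinM.
Qed.

Lemma next_event_sub g n : next_event g n `<=` prefix_event g n.
Proof.
rewrite /next_event; elim: (index_enum _) => [|e l IH]; first by rewrite big_nil.
rewrite big_cons => w [|]; last exact: IH.
by rewrite prefix_event_extend => -[].
Qed.

Lemma next_event_null x g n : Px x (prefix_event g n `\` next_event g n) = 0.
Proof.
have [a a0 aE] := prefix_event_prob x g n.
transitivity (Px x (prefix_event g n) - Px x (prefix_event g n `&` next_event g n)).
  apply: measureD; [exact: prefix_event_measurable|exact: next_event_measurable|].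
  by rewrite [X in X < _]aE ltry.
by rewrite (setIidr (@next_event_sub g n)) next_event_prob aE subee.
Qed.

(** The Markov property, drawn from the finite-dimensional distributions by splitting a prefix
    according to its next step. *)
Lemma integral_walkN x k y N g n : killing k ->
  \int[Px x]_(w in prefix_event g n) (walkN k y N (fun j => S (n + j) w))%:E =
  Px x (prefix_event g n) * (travelN k y N (g n))%:E.
Proof.
move=> kk; have cstE (a : R) : \int[Px x]_(w in prefix_event g n) cst a%:E w =
    Px x (prefix_event g n) * a%:E.
  by rewrite integral_cst 1?muleC//; exact: prefix_event_measurable.
elim: N g n cstE => [|N IH] g n cstE /=.
  rewrite -cstE; apply: eq_integral => w; rewrite inE => /= h.
  by rewrite addn0 (h n)//; case: eqP.
have [gy|gy] := eqVneq (g n) y.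
  rewrite -cstE; apply: eq_integral => w; rewrite inE => /= h.
  by rewrite addn0 (h n)// gy eqxx.
pose f w := (walkN k y N (fun j => S (n.+1 + j) w))%:E.
have f0 w : 0 <= f w by rewrite lee_fin; have /andP[] := walkN01 y N (fun j => S (n.+1 + j) w) kk.
have mf : measurable_fun setT f by apply/measurable_EFinP; exact: walkN_measurable.
transitivity (\int[Px x]_(w in prefix_event g n) ((k (g n))%:E * f w)).
  apply: eq_integral => w; rewrite inE => /= h.
  rewrite addn0 (h n)// (negbTE gy) EFinM; congr (_ * (walkN _ _ _ _)%:E).
  by apply/funext => j; rewrite addnS.
have mD := prefix_event_measurable g n.
rewrite ge0_integralZl//; last 2 first.
- exact: measurable_funTS.
- by rewrite lee_fin; exact: killing_ge0.
have mU := next_event_measurable g n.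
rewrite (@ge0_negligible_integral _ _ _ _ _ (prefix_event g n `\` next_event g n))//; last 3 first.
- exact: measurableD.
- exact: measurable_funTS.
- exact: next_event_null.
rewrite setDD (setIidr (@next_event_sub g n)) integral_next_event//.
have [a a0 aE] := prefix_event_prob x g n.
rewrite (eq_bigr (fun e => (a * (2 * d)%:R^-1 * travelN k y N (g n + dir e))%:E)) => [|e _].
  rewrite sumEFin aE -!EFinM; congr (_%:E); rewrite /avg -mulr_sumr; ring.
rewrite IH; last first.
  by move=> b; rewrite integral_cst 1?muleC//; exact: prefix_event_measurable.
by rewrite prefix_event_step aE /extend eqxx !EFinM.
Qed.

Lemma expectation_walkN x k y N : killing k ->
  \int[Px x]_w (walkN k y N (fun j => S j w))%:E = (travelN k y N x)%:E.
Proof.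
move=> kk; have := integral_walkN x y N (fun=> x) 0 kk.
have P1 : Px x (prefix_event (fun=> x) 0) = 1.
  by rewrite /prefix_event srw.2 eqxx big_ord0.
rewrite P1 mul1e => <-.
rewrite (@ge0_negligible_integral _ _ _ _ setT (~` prefix_event (fun=> x) 0))//.
- by rewrite setDE setCK setTI.
- by apply: measurableC; exact: prefix_event_measurable.
- by apply/measurable_EFinP; exact: (walkN_measurable k y N 0).
- by move=> w _; rewrite lee_fin; have /andP[] := walkN01 y N (fun j => S j w) kk.
- have mA := prefix_event_measurable (fun=> x) 0.
  by apply: etrans (probability_setC (Px x) mA) _; rewrite P1 subee.
Qed.

Lemma travel_weightE x y (V : site -> R) : (forall z, (0 <= V z)%R) ->
  travel_weight Px S x y V = travel (fun z => expR (- V z)) y x.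
Proof.
move=> V0; set k := fun z => _.
have kk : killing k by move=> z; rewrite expR_ge0 -expR0 ler_expR oppr_le0/=.
rewrite /travel_weight unlock.
pose f_ N w := (walkN k y N (fun j => S j w))%:E.
have cv : \int[Px x]_(w in setT) f_ N w @[N --> \oo] -->
    \int[Px x]_(w in setT) (hitting_weight V y (fun j => S j w))%:E.
  apply: (@dominated_cvg _ _ _ _ _ _ _ _ (cst 1)) => //.
  - by move=> N; apply/measurable_EFinP; exact: (walkN_measurable k y N 0).
  - by move=> w _; apply: cvg_EFin; [exact: nearW|exact: walkN_cvg].
  - exact: finite_measure_integrable_cst.
  - move=> N w _; have /andP[h0 h1] := walkN01 y N (fun j => S j w) kk.
    by rewrite /f_ gee0_abs ?lee_fin.
have cv2 : \int[Px x]_(w in setT) f_ N w @[N --> \oo] --> (travel k y x)%:E.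
  under eq_cvg do rewrite expectation_walkN//.
  by apply: cvg_EFin; [exact: nearW|exact: travelN_cvg].
by rewrite -(cvg_lim _ cv)// (cvg_lim _ cv2).
Qed.

End WalkLaw.

(** * The law of the potential on finitely many sites *)

Section PotentialLaw.
Context {R : realType} {d : nat} (d_gt0 : (0 < d)%N).
Local Notation site := 'rV[int]_d.
Local Notation config := (site -> bool).
Variables (dO : measure_display) (O : measurableType dO).
Variables (r : R) (P : probability O R) (omega : site -> {mfun O >-> R}).
Hypothesis bern : bernoulli_potential r P omega.
Hypothesis r01 : 0 <= r <= 1.
Implicit Types (c : config) (s a : seq site) (z : site) (F : config -> R).

(** Any nonzero value is read as 1, which is correct almost surely. *)
Definition mix s (o : O) c : config := fun t => if t \in s then omega t o != 0 else c t.

Definition cylinder a c : set O := [set o | forall t, t \in a -> (omega t o != 0) = c t].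

Definition prob_of (b : bool) : R := if b then 1 - r else r.

Let value_set c z : set R := if c z then ~` [set 0] else [set 0].

Let value_set_measurable c z : measurable (value_set c z).
Proof. by rewrite /value_set; case: (c z); [apply: measurableC|]. Qed.

Let cylinderE a c : cylinder a c = [set o | forall t, t \in a -> value_set c t (omega t o)].
Proof.
apply/seteqP; split => o /= h t ta; have := h t ta; rewrite /value_set.
  by case: (c t) => /eqP.
by case: (c t) => /= /eqP ->.
Qed.

Lemma zero_measurable z : measurable [set o | omega z o = 0].
Proof.
have -> : [set o | omega z o = 0] = setT `&` omega z @^-1` [set 0] by rewrite setTI.
exact: measurable_funPT.
Qed.

Lemma cylinder_measurable a c : measurable (cylinder a c).
Proof.
elim: a => [|z a IH].
  by have -> : cylinder [::] c = setT; [apply/seteqP; split|].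
have -> : cylinder (z :: a) c =
    (if c z then ~` [set o | omega z o = 0] else [set o | omega z o = 0]) `&` cylinder a c.
  apply/seteqP; split => o /= h.
    split; last by move=> t ta; apply: h; rewrite in_cons ta orbT.
    by have := h z (mem_head _ _); case: (c z) => /eqP.
  move=> t; rewrite in_cons => /orP[/eqP->|]; last exact: h.2.
  by case: h => + _; case: (c z) => /= /eqP ->.
apply: measurableI => //; case: (c z); [apply: measurableC|]; exact: zero_measurable.
Qed.

Local Open Scope ereal_scope.

Lemma zero_prob z b : P [set o | value_set (fun=> b) z (omega z o)] = (prob_of b)%:E.
Proof.
have [_ prob _] := bern; rewrite /value_set /prob_of; case: b; last exact: (prob z).1.
apply: etrans (probability_setC P (zero_measurable z)) _.
by rewrite (prob z).1.
Qed.

Lemma cylinder_prob a c : uniq a -> P (cylinder a c) = (\prod_(t <- a) prob_of (c t))%:E.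
Proof.
move=> ua; have [_ prob ind] := bern.
rewrite cylinderE ind// -prodEFin; apply: eq_bigr => t _; exact: (zero_prob t (c t)).
Qed.

Lemma mix_measurable s c F : measurable_fun setT (fun o => F (mix s o c)).
Proof.
elim: s c => [|z s IH] c; first by rewrite /mix /=.
have -> : (fun o => F (mix (z :: s) o c)) = (fun o => if omega z o == 0%R then
    F (mix s o (up c z false)) else F (mix s o (up c z true))).
  apply/funext => o; case: (eqVneq (omega z o) 0%R) => oz; congr F; apply/funext => t;
    rewrite /mix /up in_cons; case: (eqVneq t z) => [->|] //=; by rewrite ?oz ?eqxx; case: ifP.
apply: measurable_fun_ifT => //.
apply: (measurable_fun_bool true); rewrite setTI.
have -> : (fun o => omega z o == 0%R) @^-1` [set true] = [set o | omega z o = 0%R].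
  by apply/seteqP; split => o /= /eqP.
exact: zero_measurable.
Qed.

(** Induction on [s]: its first coordinate is moved into the cylinder with either value, as in the
    recursion of [Er]. *)
Lemma integral_mix s a c F : uniq (s ++ a) -> (forall c, (0 <= F c)%R) ->
  \int[P]_(o in cylinder a c) (F (mix s o c))%:E =
  ((\prod_(t <- a) prob_of (c t)) * Er r s F c)%:E.
Proof.
move=> + F0; elim: s a c => [|z s IH] a c usa.
  rewrite (eq_integral (cst (F c)%:E)) => [|o _]; last by rewrite /mix.
  rewrite integral_cst; last exact: cylinder_measurable.
  by rewrite EFinM muleC; congr (_ * _); exact: cylinder_prob.
have [zs za ua] : [/\ z \notin s, z \notin a & uniq (s ++ a)].
  by move: usa => /= /andP[]; rewrite mem_cat negb_or => /andP[].
have cylU : cylinder a c = cylinder (z :: a) (up c z false) `|` cylinder (z :: a) (up c z true).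
  apply/seteqP; split => o /=.
    move=> h; case: (eqVneq (omega z o) 0%R) => oz; [left|right] => t;
      rewrite in_cons => /orP[/eqP->|ta]; rewrite ?up_eq ?oz ?eqxx//;
      by rewrite (h t ta) /up; case: eqP ta => // ->; rewrite (negbTE za).
  by case=> h t ta; rewrite h ?in_cons ?ta ?orbT// /up; case: eqP ta => // ->; rewrite (negbTE za).
have mixE b o : cylinder (z :: a) (up c z b) o -> mix (z :: s) o c = mix s o (up c z b).
  move=> h; apply/funext => t; rewrite /mix /up in_cons; case: (eqVneq t z) => [->|] //=.
  by rewrite (negbTE zs) h ?mem_head// up_eq.
have prodE b : (\prod_(t <- z :: a) prob_of (up c z b t) = prob_of b * \prod_(t <- a) prob_of (c t))%R.
  rewrite big_cons up_eq; congr (_ * _)%R; apply: eq_big_seq => t ta.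
  by rewrite /up; case: eqP ta => // ->; rewrite (negbTE za).
have uza : uniq (s ++ z :: a).
  by rewrite (perm_uniq (permEl (perm_catCA s [:: z] a))).
rewrite cylU ge0_integral_setU//; last 5 first.
- exact: cylinder_measurable.
- exact: cylinder_measurable.
- by apply: measurable_funTS; apply/measurable_EFinP; exact: mix_measurable.
- by move=> o _; rewrite lee_fin.
- apply/disj_setPS => o /= [h h'].
  by have := h z (mem_head _ _); rewrite (h' z (mem_head _ _)) !up_eq.
have intE b : \int[P]_(o in cylinder (z :: a) (up c z b)) (F (mix (z :: s) o c))%:E =
    (prob_of b * (\prod_(t <- a) prob_of (c t)) * Er r s F (up c z b))%:E.
  rewrite -prodE -IH//; apply: eq_integral => o; rewrite inE => h.
  by rewrite (mixE b).
by rewrite !intE -EFinD; congr (_%:E); rewrite /prob_of /=; ring.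
Qed.

Lemma expectation_mix s F : uniq s -> (forall c, (0 <= F c)%R) ->
  \int[P]_o (F (mix s o full))%:E = (Er r s F full)%:E.
Proof.
move=> us F0; have := @integral_mix s [::] full F; rewrite cats0 => /(_ us F0).
rewrite big_nil mul1r => <-; congr (integral _ _ _).
by apply/seteqP; split.
Qed.

End PotentialLaw.

(** * Passage to the infinite environment *)

Section Limit.
Context {R : realType} {d : nat} (d_gt0 : (0 < d)%N).
Local Notation site := 'rV[int]_d.
Local Notation config := (site -> bool).
Variables (dO : measure_display) (O : measurableType dO).
Variables (r : R) (P : probability O R) (omega : site -> {mfun O >-> R}).
Hypothesis bern : bernoulli_potential r P omega.
Hypothesis r01 : 0 <= r <= 1.
Variables (lam : R) (y : site).
Hypothesis lam0 : 0 <= lam.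

Definition survival o z : R := expR (- (omega z o + lam)).

Let omega_ge0 z o : 0 <= omega z o. Proof. by have [] := bern. Qed.

Lemma survival_killing o : killing (survival o).
Proof. by move=> z; rewrite expR_ge0 -[X in _ <= X]expR0 ler_expR oppr_le0 addr_ge0. Qed.

Lemma travelN_local k k' N (x : site) :
  (forall z, (norm1 z <= norm1 x + N)%N -> k z = k' z) ->
  travelN k y N x = travelN k' y N x :> R.
Proof.
elim: N x => [|N IH] x kk' //=; case: eqP => // _; rewrite kk' ?leq_addr//.
congr (_ * _); apply: eq_avg => e; apply: IH => z zx; apply: kk'.
apply: leq_trans zx _; rewrite addnS -addSn leq_add2r.
by apply: leq_trans (norm1D _ _) _; rewrite norm1_dir addn1.
Qed.

Lemma survival_env o : (forall z, omega z o = 0 \/ omega z o = 1) ->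
  survival o = env lam (fun z => omega z o != 0).
Proof.
move=> o01; apply/funext => z; rewrite /survival /env.
by case: (o01 z) => ->; rewrite ?eqxx ?oner_eq0.
Qed.

(** A squeeze: N steps from 0 stay where the two environments agree, and replacing values outside by
    1 can only lower the weight. *)
Lemma weight_mix_cvg o : (forall z, omega z o = 0 \/ omega z o = 1) ->
  weight lam y (mix omega (lattice_ball N) o full) @[N --> \oo] --> travel (survival o) y 0.
Proof.
move=> o01; have sk := survival_killing o.
apply: (@squeeze_cvgr _ _ _ _ (fun N => travelN (survival o) y N 0) (fun=> travel (survival o) y 0)).
- apply: nearW => N; apply/andP; split.
    apply: le_trans (travelN_le_travel d_gt0 y N 0 (env_killing lam0 _)).
    rewrite (@travelN_local _ (env lam (mix omega (lattice_ball N) o full))) // => z zN.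
    rewrite survival_env// /env /mix mem_lattice_ball//.
    by move: zN; rewrite norm10.
  rewrite survival_env//; apply: le_weight => // z oz.
  by rewrite /mix oz if_same.
- exact: travelN_cvg.
- exact: cvg_cst.
Qed.

Lemma survival_travelN_measurable N x :
  measurable_fun setT (fun o => travelN (survival o) y N x).
Proof.
elim: N x => [|N IH] x /=; case: eqP => // _.
apply: measurable_funM.
  apply: measurableT_comp => //; apply: measurableT_comp => //.
  exact: measurable_funD.
apply: measurable_funM => //; exact: measurable_sum.
Qed.

Lemma survival_travel_measurable x :
  measurable_fun setT (fun o => travel (survival o) y x).
Proof.
apply: (@measurable_fun_cvg _ _ _ _ (fun N o => travelN (survival o) y N x)).
  by move=> N; exact: survival_travelN_measurable.
by move=> o _; apply: travelN_cvg => //; exact: survival_killing.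
Qed.

Local Open Scope ereal_scope.

Lemma omega_ae : {ae P, forall o, forall z, omega z o = 0%R \/ omega z o = 1%R}.
Proof.
have [_ prob _] := bern.
have mz v z : measurable [set o | omega z o = v].
  have -> : [set o | omega z o = v] = setT `&` omega z @^-1` [set v] by rewrite setTI.
  exact: measurable_funPT.
pose N z := ~` ([set o | omega z o = 0%R] `|` [set o | omega z o = 1%R]).
have mN z : measurable (N z) by apply: measurableC; apply: measurableU.
have PN z : P (N z) = 0.
  apply: etrans (probability_setC P (measurableU _ _ (mz _ _) (mz _ _))) _.
  have -> : P ([set o | omega z o = 0%R] `|` [set o | omega z o = 1%R]) = 1.
    transitivity (P [set o | omega z o = 0%R] + P [set o | omega z o = 1%R]).
      apply: measureU => //.
      by apply/seteqP; split => o //= [-> /eqP]; rewrite eq_sym oner_eq0.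
    by rewrite (prob z).1 (prob z).2 -EFinD addrCA subrr addr0.
  by rewrite subee.
pose F i := if unpickle i is Some z then N z else set0.
have : P.-negligible (\bigcup_i F i).
  apply: negligible_bigcup => i; rewrite /F; case: unpickle => [z|]; last exact: negligible_set0.
  by exists (N z); split => //; exact: PN.
apply: negligibleS => o /= h.
have /existsNP[z oz] := h.
by exists (pickle z) => //; rewrite /F pickleK; exact: oz.
Qed.

(** Dominated convergence, for G the identity or - ln; the latter is the reason why continuity is
    asked at w > 0 only. *)
Lemma expectation_limit (G : R -> R) (M : R) : measurable_fun setT G ->
  (forall w, (0 < w)%R -> {for w, continuous G}) ->
  (forall c, (0 <= G (weight lam y c) <= M)%R) ->
  exists2 l : R, \int[P]_o (G (travel (survival o) y 0))%:E = l%:E &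
    (Er r (lattice_ball N) (fun c => G (weight lam y c)) full @[N --> \oo] --> l)%R.
Proof.
move=> mG cG bG; have [b0 bM] : (forall c, (0 <= G (weight lam y c))%R) /\
  (forall c, (G (weight lam y c) <= M)%R) by split=> c; have /andP[] := bG c.
pose f_ N o := (G (weight lam y (mix omega (lattice_ball N) o full)))%:E.
pose f o := (G (travel (survival o) y 0))%:E.
have mf_ N : measurable_fun setT (f_ N).
  by apply/measurable_EFinP; exact: (mix_measurable omega _ _ (fun c => G (weight lam y c))).
have mf : measurable_fun setT f.
  by apply/measurable_EFinP; apply: measurableT_comp => //; exact: survival_travel_measurable.
have f_f : {ae P, forall o, setT o -> f_ N o @[N --> \oo] --> f o}.
  apply: filterS omega_ae => o o01 _; apply: cvg_EFin; first exact: nearW.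
  have cw := weight_mix_cvg o01; apply: (continuous_cvg _ _ cw); apply: cG.
  by rewrite survival_env//; exact: weight_gt0.
have iM : P.-integrable setT (EFin \o cst M) by exact: finite_measure_integrable_cst.
have f_M : {ae P, forall o N, setT o -> `|f_ N o| <= (EFin \o cst M) o}.
  by apply: aeW => o N _; rewrite /f_ gee0_abs ?lee_fin.
have [int_f _ cv] := dominated_convergence measurableT mf_ mf f_f iM f_M.
have fin_f : \int[P]_o f o \is a fin_num by exact: integrable_fin_num.
exists (fine (\int[P]_o f o)); first by rewrite fineK.
have : \int[P]_o f_ N o @[N --> \oo] --> (fine (\int[P]_o f o))%:E by rewrite fineK.
under eq_cvg do rewrite (expectation_mix bern (lattice_ball_uniq _) b0).
by move/fine_cvgP => [].
Qed.

End Limit.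

(** * Differences of norms, determined by lattice points *)

Section Norms.
Context {R : realType} {d : nat}.
Implicit Types (x y : 'rV[R]_d) (N : 'rV[R]_d -> R).

Lemma l1norm_ge0 x : 0 <= l1norm x.
Proof. by apply: sumr_ge0. Qed.

Lemma l1normZ (a : R) x : l1norm (a *: x) = `|a| * l1norm x.
Proof. by rewrite /l1norm mulr_sumr; apply: eq_bigr => i _; rewrite mxE normrM. Qed.

Lemma l1norm_gt0 x : x != 0 -> 0 < l1norm x.
Proof.
move=> x0; rewrite lt_neqAle l1norm_ge0 andbT eq_sym; apply: contra x0 => /eqP h.
apply/eqP/rowP => i; rewrite mxE; apply/eqP; rewrite -normr_eq0.
move/eqP: h; rewrite psumr_eq0// => /allP/(_ i); rewrite mem_index_enum => /(_ isT) /=.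
by [].
Qed.

Lemma ler_l1normB x y : `|l1norm x - l1norm y| <= l1norm (x - y).
Proof.
rewrite /l1norm -sumrB; apply: le_trans (ler_norm_sum _ _ _) _.
by apply: ler_sum => i _; rewrite !mxE ler_dist_dist.
Qed.

Lemma l1norm_embed (z : 'rV[int]_d) : l1norm (lattice_embed R z) = (norm1 z)%:R.
Proof.
rewrite /l1norm /norm1 natr_sum; apply: eq_bigr => i _; rewrite mxE -intr_norm.
by rewrite -abszE.
Qed.

Lemma is_norm0 N : is_norm N -> N 0 = 0.
Proof. by move=> [_ NZ _]; rewrite -(scale0r (0 : 'rV[R]_d)) NZ normr0 mul0r. Qed.

Lemma is_normN N x : is_norm N -> N (- x) = N x.
Proof. by move=> [_ NZ _]; rewrite -scaleN1r NZ normrN1 mul1r. Qed.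

Lemma is_norm_lipschitz N : is_norm N ->
  exists2 K : R, 0 <= K & forall x y, `|N x - N y| <= K * l1norm (x - y).
Proof.
move=> nN; have [ND NZ _] := nN.
have N0 x : 0 <= N x.
  by have := ND x (- x); rewrite subrr is_norm0// is_normN//; lra.
pose K := \sum_i N (delta_mx 0 i); exists K; first exact: sumr_ge0.
have le_K x : N x <= K * l1norm x.
  rewrite {1}(row_sum_delta x); apply: le_trans (_ : \sum_i N (x 0 i *: delta_mx 0 i) <= _).
    elim: (index_enum _) => [|i s IH]; first by rewrite !big_nil is_norm0.
    by rewrite !big_cons; apply: le_trans (ND _ _) _; rewrite lerD2l.
  rewrite mulr_sumr; apply: ler_sum => i _; rewrite NZ mulrC ler_wpM2r//.
  by rewrite /K (bigD1 i)//= lerDl sumr_ge0.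
move=> x y; apply: le_trans (le_K _); rewrite ler_norml; apply/andP; split.
  have := ND x (y - x); rewrite addrC subrK -opprB is_normN//; lra.
by have := ND (x - y) y; rewrite subrK; lra.
Qed.

(* Rational points are dense and [F] is homogeneous, hence determined by its
   values on the lattice. *)
Lemma homogeneous_ge0 (F : 'rV[R]_d -> R) (K : R) : 0 <= K ->
  (forall (t : R) x, 0 <= t -> F (t *: x) = t * F x) ->
  (forall x y, `|F x - F y| <= K * l1norm (x - y)) ->
  (forall z, 0 <= F (lattice_embed R z)) -> forall x, 0 <= F x.
Proof.
move=> K0 FZ FK Fz x; rewrite leNgt; apply/negP => Fx.
(* Rounding (m + 1) x to the lattice moves it by at most d in l^1 and changes F by at most K d, too
   little to make F((m + 1) x) nonnegative. *)
have [m hm] : exists m : nat, K * d%:R < m.+1%:R * - F x.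
  exists (Num.trunc (K * d%:R / - F x)); rewrite -ltr_pdivrMr ?oppr_gt0//.
  exact: truncnS_gt.
pose z : 'rV[int]_d := \row_i Num.floor (m.+1%:R * x 0 i).
have zx : l1norm (m.+1%:R *: x - lattice_embed R z) <= d%:R.
  rewrite /l1norm -[d in leRHS]card_ord -sumr_const; apply: ler_sum => i _.
  rewrite !mxE ger0_norm ?subr_ge0 ?floor_le_tmp//.
  by have := floorD1_gt (m.+1%:R * x 0 i); rewrite intrD; lra.
have := FK (m.+1%:R *: x) (lattice_embed R z); rewrite FZ// ler_norml => /andP[h _].
have := ler_wpM2l K0 zx; have := Fz z; lra.
Qed.

Lemma norm_diff_ge N1 N2 (c : R) : is_norm N1 -> is_norm N2 ->
  (forall z, c * (norm1 z)%:R <= N1 (lattice_embed R z) - N2 (lattice_embed R z)) ->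
  forall x, c * l1norm x <= N1 x - N2 x.
Proof.
move=> n1 n2 h x; rewrite -subr_ge0.
have [K1 K10 H1] := is_norm_lipschitz n1; have [K2 K20 H2] := is_norm_lipschitz n2.
apply: (@homogeneous_ge0 (fun x => N1 x - N2 x - c * l1norm x) (K1 + K2 + `|c|)).
- by rewrite !addr_ge0.
- move=> t y t0; have [_ Z1 _] := n1; have [_ Z2 _] := n2.
  by rewrite Z1 Z2 l1normZ ger0_norm//; ring.
- move=> y z; rewrite [X in `|X|](_ : _ = (N1 y - N1 z) - (N2 y - N2 z) - c * (l1norm y - l1norm z)); last by ring.
  rewrite !mulrDl; apply: le_trans (ler_normB _ _) _; apply: lerD; last first.
    by rewrite normrM ler_wpM2l// ler_l1normB.
  by apply: le_trans (ler_normB _ _) _; apply: lerD.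
- by move=> z; rewrite subr_ge0 l1norm_embed.
Qed.

Lemma norm_diff_le N1 N2 (c : R) : is_norm N1 -> is_norm N2 ->
  (forall z, N1 (lattice_embed R z) - N2 (lattice_embed R z) <= c * (norm1 z)%:R) ->
  forall x, N1 x - N2 x <= c * l1norm x.
Proof.
move=> n1 n2 h x.
have := @norm_diff_ge N2 N1 (- c) n2 n1 _ x; rewrite mulNr => h'.
suff : - (c * l1norm x) <= N2 x - N1 x by lra.
by apply: h' => z; have := h z; lra.
Qed.

End Norms.

(** * From Lyapunov exponents to rate functions *)

Section Rates.
Context {R : realType} {d : nat}.
Implicit Types (L : R -> 'rV[R]_d -> R) (x : 'rV[R]_d).
Local Open Scope ereal_scope.

Lemma rate_function_gtNy L x : -oo < rate_function L x.
Proof.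
apply: lt_le_trans (_ : (L 0 x - 0)%:E <= _); first exact: ltNyr.
by apply: ereal_sup_ubound; exists 0%R => /=.
Qed.

(** A shift independent of [lam] passes through the supremum. The additive form stays meaningful
    when the rate functions are +oo. *)
Lemma rate_function_le L1 L2 x (a : R) :
  (forall lam : R, (0 <= lam -> L1 lam x + a <= L2 lam x)%R) ->
  rate_function L1 x + a%:E <= rate_function L2 x.
Proof.
move=> h; have key lam : (0 <= lam)%R -> (L1 lam x - lam)%:E <= rate_function L2 x - a%:E.
  move=> lam0; rewrite leeBrDr//; apply: le_trans (_ : (L2 lam x - lam)%:E <= _).
    by rewrite -EFinD lee_fin; have := h lam lam0; lra.
  by apply: ereal_sup_ubound; exists lam.
rewrite -leeBrDr//; apply: ge_ereal_sup => _ [lam /= lam0 <-]; exact: key.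
Qed.

Lemma diff_quotients_ge L1 L2 (c : R) :
  (forall lam : R, (0 <= lam)%R -> forall x, (c * l1norm x <= L1 lam x - L2 lam x)%R) ->
  c%:E <= ereal_inf (diff_quotients (rate_function L1) (rate_function L2)).
Proof.
move=> h; apply: le_ereal_inf_tmp => _ [x /= [x0 def] <-].
have l0 := l1norm_gt0 x0.
have : rate_function L2 x + (c * l1norm x)%:E <= rate_function L1 x.
  by apply: rate_function_le => lam lam0; have := h lam lam0 x; lra.
have := rate_function_gtNy L1 x; have := rate_function_gtNy L2 x; move: def.
case: (rate_function L1 x) => [f| |]; case: (rate_function L2 x) => [g| |] //=.
- move=> _ _ _; rewrite -EFinD lee_fin -EFinB -EFinM lee_fin => fg.
  by rewrite ler_pdivlMr//; lra.
(* The case +oo minus a finite value, with quotient +oo; [def] excludes oo - oo, and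
   [rate_function_gtNy] the value -oo. *)
- by move=> _ _ _ _; rewrite mulyr gtr0_sg ?invr_gt0// mul1e leey.
Qed.

Lemma diff_quotients_le L1 L2 (c : R) :
  (forall lam : R, (0 <= lam)%R -> forall x, (L1 lam x - L2 lam x <= c * l1norm x)%R) ->
  ereal_sup (diff_quotients (rate_function L1) (rate_function L2)) <= c%:E.
Proof.
move=> h; apply: ge_ereal_sup => _ [x /= [x0 def] <-].
have l0 := l1norm_gt0 x0.
have : rate_function L1 x + (- (c * l1norm x))%:E <= rate_function L2 x.
  by apply: rate_function_le => lam lam0; have := h lam lam0 x; lra.
have := rate_function_gtNy L1 x; have := rate_function_gtNy L2 x; move: def.
case: (rate_function L1 x) => [f| |]; case: (rate_function L2 x) => [g| |] //=.
- move=> _ _ _; rewrite -EFinD lee_fin -EFinB -EFinM lee_fin => fg.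
  by rewrite ler_pdivrMr//; lra.
- by move=> _ _ _ _; rewrite addeNy mulNyr gtr0_sg ?invr_gt0// mul1e leNye.
Qed.

End Rates.

Lemma norm1_mulrn d (z : 'rV[int]_d) n : norm1 (z *+ n) = (norm1 z * n)%N.
Proof.
rewrite /norm1 big_distrl; apply: eq_bigr => i _ /=.
by rewrite mulmxnE -mulr_natr abszM natz absz_nat.
Qed.

Lemma norm1_eq0 d (z : 'rV[int]_d) : (norm1 z == 0%N) = (z == 0).
Proof.
apply/eqP/eqP => [h|->]; last exact: norm10.
apply/rowP => i; move/eqP: h; rewrite sum_nat_eq0 => /forallP/(_ i).
by rewrite mxE absz_eq0 => /eqP.
Qed.

Lemma norm1N d (z : 'rV[int]_d) : norm1 (- z) = norm1 z.
Proof. by rewrite /norm1; apply: eq_bigr => i _; rewrite mxE abszN. Qed.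

(** * Constants depending on d and q0 only *)

Section UpperConstant.
Context {R : realType}.
Variable q0 : R.
Hypothesis q001 : 0 < q0 < 1.

Lemma visit_bounds p q : 0 < p -> p < q -> q <= q0 ->
  [/\ visit q <= visit q0, visit q0 < 1 & q < 1].
Proof.
move=> p0 pq qq; have [q00 q01] := andP q001.
by split; [exact: le_visit|exact: visit_lt1|exact: le_lt_trans q01].
Qed.

Lemma ln_visit_gt0 : 0 < - ln (visit q0).
Proof.
have [q00 q01] := andP q001; rewrite oppr_gt0 ln_lt0// visit_gt0 ?visit_lt1//.
by rewrite (ltW q00) ltW.
Qed.

Definition range_cost d : R := crossing_cost R d / - ln (visit q0).

Lemma range_cost_gt0 d : (0 < d)%N -> 0 < range_cost d.
Proof.
by move=> d0; apply: divr_gt0 ln_visit_gt0; apply: lt_le_trans (crossing_cost_ge1 R d0).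
Qed.

Lemma quenched_upper_plane d : (1 < d)%N -> exists2 C : R, 0 < C &
  forall lam (y : 'rV[int]_d) p q s, 0 <= lam -> (0 < norm1 y)%N -> uniq s ->
  0 < p -> p < q -> q <= q0 ->
  Er p s (fun c => - ln (weight lam y c)) full -
  Er q s (fun c => - ln (weight lam y c)) full <= C * (norm1 y)%:R * (q - p).
Proof.
move=> d2; have d0 : (0 < d)%N by exact: ltnW.
pose i0 : 'I_d := Ordinal d0; pose i1 : 'I_d := Ordinal d2.
have i01 : i0 != i1 by [].
have [D hD] := gauss_sum_bounded (block_rate_ge1 R d0) q001.
have [q00 q01] := andP q001; have rc := range_cost_gt0 d0.
pose K : R := (expR (-1) * (1 - expR (-1)))^-1.
have K0 : 0 < K by rewrite invr_gt0 mulr_gt0 ?expR_gt0// subr_gt0 expRN1_lt1.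
have D0 : 0 <= D.
  by have := hD 0%N 0; rewrite big_geq//; apply; rewrite lexx ltW.
exists ((K + D) * range_cost d); first by rewrite mulr_gt0// ltr_pwDl.
move=> lam y p q s lam0 L0 us p0 pq qq; have [vq v1 q1] := visit_bounds p0 pq qq.
have pq0 : 0 <= q - p by rewrite subr_ge0 ltW.
(* Strong killing gives a bounded ratio; otherwise the squares are used. The sum K + D covers both
   cases. *)
have [lam1|lam1] := leP 1 lam.
  apply: le_trans (quenched_upper_ratio d0 lam0 (ltW K0) _ us L0 vq v1 p0 pq q1) _.
    by move=> c z; exact: ratio_killed.
  by rewrite ler_wpM2r// ler_wpM2r// ler_wpM2r ?(ltW rc)// lerDl.
apply: le_trans (_ : D * (range_cost d * (norm1 y)%:R) * (q - p) <= _); last first.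
  by rewrite ler_wpM2r// mulrA ler_wpM2r// ler_wpM2r ?(ltW rc)// lerDr ltW.
apply: quenched_upper => // r /andP[pr rq].
have lam01 : 0 <= lam <= 1 by rewrite lam0 ltW.
apply: (quenched_plane d0 i01 lam01 _ (le_trans (le_visit rq) vq) v1 us L0 D0).
  by apply/andP; split; lra.
by move=> M; apply: hD; apply/andP; split; lra.
Qed.

Lemma quenched_upper_line : exists2 C : R, 0 < C &
  forall lam (L : int) p q s, 0 <= lam -> 0 < L -> uniq s ->
  0 < p -> p < q -> q <= q0 ->
  Er p s (fun c => - ln (weight lam (pos L) c)) full -
  Er q s (fun c => - ln (weight lam (pos L) c)) full <=
  C * (norm1 (pos L))%:R * (q - p).
Proof.
have [q00 q01] := andP q001.
have v1 : visit q0 < 1 by exact: visit_lt1.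
exists (@line_rate R * (1 - q0) ^- 2 * (1 + (1 - visit q0)^-1)).
  rewrite mulr_gt0 ?mulr_gt0 ?line_rate_gt0 ?invr_gt0 ?exprn_gt0 ?subr_gt0//.
  by rewrite ltr_wpDr// invr_ge0 subr_ge0 ltW.
move=> lam L p q s lam0 L0 us p0 pq qq; have [vq _ _] := visit_bounds p0 pq qq.
apply: quenched_upper => // r /andP[pr rq].
have -> : (norm1 (pos L))%:R = L%:~R :> R by rewrite norm1_pos -[in RHS](gtz0_abs L0).
apply: (quenched_line lam0 L0 _ q01 (le_trans (le_visit rq) vq) v1 us).
by apply/andP; split; lra.
Qed.

(* Up to the symmetry [z -> -z] of norms one may assume [z > 0] when [d = 1]. *)
Lemma quenched_upper_const d : (0 < d)%N -> exists2 C : R, 0 < C &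
  forall z : 'rV[int]_d, z != 0 -> exists2 z', z' = z \/ z' = - z &
  forall n lam p q s, (0 < n)%N -> 0 <= lam -> uniq s -> 0 < p -> p < q -> q <= q0 ->
  Er p s (fun c => - ln (weight lam (z' *+ n) c)) full -
  Er q s (fun c => - ln (weight lam (z' *+ n) c)) full <=
  C * (norm1 (z' *+ n))%:R * (q - p).
Proof.
case: d => [//|[|d]] _.
  have [C C0 hC] := quenched_upper_line; exists C => // z z0.
  have posM (a : int) n : pos a *+ n = pos (a *+ n).
    by elim: n => [|n IH]; rewrite ?mulr0n ?pos0// !mulrS IH; apply/rowP => i; rewrite !mxE.
  have z00 : z 0 0 != 0 by apply: contra z0 => /eqP zz; rewrite (site_posE z) zz pos0.
  have [zp|zn] := ltP 0 (z 0 0).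
    exists z; first by left.
    move=> n lam p q s n0 lam0 us p0 pq qq; rewrite (site_posE z) posM.
    by apply: hC => //; rewrite pmulrn_lgt0.
  exists (- z); first by right.
  move=> n lam p q s n0 lam0 us p0 pq qq.
  have -> : - z = pos (- z 0 0) by rewrite (site_posE (- z)) mxE.
  by rewrite posM; apply: hC => //; rewrite pmulrn_lgt0// oppr_gt0 lt_neqAle z00.
have [C C0 hC] := @quenched_upper_plane d.+2 isT; exists C => // z z0; exists z; first by left.
move=> n lam p q s n0 lam0 us p0 pq qq; apply: hC => //.
by rewrite norm1_mulrn muln_gt0 n0 andbT lt0n norm1_eq0.
Qed.

End UpperConstant.

Lemma cvg_diff_ge (R : realType) (u v : nat -> R) (a b c : R) :
  n%:R^-1 * u n @[n --> \oo] --> a -> n%:R^-1 * v n @[n --> \oo] --> b ->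
  (forall n, (0 < n)%N -> c * n%:R <= u n - v n) -> c <= a - b.
Proof.
move=> ua vb uv; apply: (ler_cvg_to (cvg_cst c) (cvgB ua vb)).
exists 1%N => // n /= n0; rewrite [leRHS](_ : _ = n%:R^-1 * (u n - v n)); last by rewrite mulrBr.
by rewrite ler_pdivlMl ?ltr0n// mulrC uv.
Qed.

(** * Comparison of Lyapunov exponents *)

Section Lyapunov.
Context {R : realType} {d : nat} (d_gt0 : (0 < d)%N).
Local Notation site := 'rV[int]_d.
Variables (dW : measure_display) (W : measurableType dW).
Variables (Px : site -> probability W R) (S : nat -> W -> site).
Variables (dO : measure_display) (O : measurableType dO).
Variables (omega : site -> {mfun O >-> R}).
Hypothesis srw : simple_random_walk Px S.
Implicit Types (lam r p q : R) (P : probability O R) (y z : site).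

Lemma travel_weight_survival r P lam y o : bernoulli_potential r P omega -> 0 <= lam ->
  travel_weight Px S 0 y (fun z => omega z o + lam) = travel (survival omega lam o) y 0.
Proof.
move=> [om0 _ _] lam0; rewrite (travel_weightE d_gt0 srw)// => z.
by rewrite addr_ge0.
Qed.

Let lb lam y : R := ((2 * d)%:R^-1 * expR (- (1 + lam))) ^+ norm1 y.

Let lb_gt0 lam y : 0 < lb lam y.
Proof. by rewrite exprn_gt0// mulr_gt0 ?expR_gt0// invr_gt0 ltr0n; lia. Qed.

Lemma expectation_cost r P lam y : bernoulli_potential r P omega -> 0 <= r <= 1 -> 0 <= lam ->
  exists2 l : R,
    ('E_P[fun o => travel_cost Px S 0 y (fun z => omega z o + lam)%R])%E = l%:E &
    Er r (lattice_ball N) (fun c => - ln (weight lam y c)) full @[N --> \oo] --> l.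
Proof.
move=> bern r01 lam0.
have [||c|l lE lcv] := @expectation_limit R d d_gt0 _ _ r P omega bern lam y lam0 (fun w => - ln w) (- ln (lb lam y)).
- by apply: measurableT_comp => //; exact: measurable_ln.
- by move=> w w0; apply: continuousN; exact: continuous_ln.
- have w0 := weight_gt0 d_gt0 y lam0 c; rewrite oppr_ge0 ln_le0 ?weight_le1//= lerN2.
  by rewrite ler_ln ?posrE// weight_lb.
exists l => //; rewrite -lE unlock; congr integral; apply/funext => o.
by rewrite /travel_cost (travel_weight_survival _ _ bern).
Qed.

Lemma expectation_weight r P lam y : bernoulli_potential r P omega -> 0 <= r <= 1 -> 0 <= lam ->
  exists2 l : R,
    ('E_P[fun o => travel_weight Px S 0 y (fun z => omega z o + lam)%R])%E = l%:E &
    ln (Er r (lattice_ball N) (weight lam y) full) @[N --> \oo] --> ln l.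
Proof.
move=> bern r01 lam0.
have [|||l lE lcv] := @expectation_limit R d d_gt0 _ _ r P omega bern lam y lam0 id 1.
- exact: measurable_id.
- by move=> w _; exact: cvg_id.
- by move=> c; rewrite weight_ge0//= weight_le1.
have l0 : 0 < l.
  apply: (lt_le_trans (lb_gt0 lam y)); apply: (ler_cvg_to (cvg_cst (lb lam y)) lcv).
  apply: nearW => N; rewrite -(@Er_cst _ _ r (@lattice_ball d N) (lb lam y) full).
  by apply: le_Er r01 _ => c _; exact: weight_lb.
exists l; last by apply: continuous_cvg lcv; exact: continuous_ln.
rewrite -lE unlock; congr integral; apply/funext => o.
by rewrite (travel_weight_survival _ _ bern).
Qed.

Section Compare.
Variables (p q lam : R) (Pp Pq : probability O R) (Np Nq : 'rV[R]_d -> R).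
Hypotheses (p01 : 0 <= p <= 1) (q01 : 0 <= q <= 1) (lam0 : 0 <= lam).
Hypotheses (bp : bernoulli_potential p Pp omega) (bq : bernoulli_potential q Pq omega).

(** Two limits: the box grows to Z^d for fixed n, then n tends to oo. The boxes may be assumed to
    contain the ball of radius |n z|_1, as the lower bounds need all its inner levels. *)
Lemma quenched_lyapunov_diff (c : R) z :
  quenched_lyapunov Px S Pp omega lam Np -> quenched_lyapunov Px S Pq omega lam Nq ->
  (forall n N, (0 < n)%N -> (norm1 (z *+ n) <= N)%N ->
     c * (norm1 (z *+ n))%:R <=
     Er p (lattice_ball N) (fun c => - ln (weight lam (z *+ n) c)) full -
     Er q (lattice_ball N) (fun c => - ln (weight lam (z *+ n) c)) full) ->
  c * (norm1 z)%:R <= Np (lattice_embed R z) - Nq (lattice_embed R z).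
Proof.
move=> [_ /(_ z) cp] [_ /(_ z) cq] h.
have /choice[u hu] : forall n : nat, exists l : R,
    ('E_Pp[fun o => travel_cost Px S 0 (z *+ n)%R (fun z => omega z o + lam)%R])%E = l%:E /\
    Er p (lattice_ball N) (fun c => - ln (weight lam (z *+ n) c)) full @[N --> \oo] --> l.
  by move=> n; have [l] := expectation_cost (z *+ n) bp p01 lam0; exists l.
have /choice[v hv] : forall n : nat, exists l : R,
    ('E_Pq[fun o => travel_cost Px S 0 (z *+ n)%R (fun z => omega z o + lam)%R])%E = l%:E /\
    Er q (lattice_ball N) (fun c => - ln (weight lam (z *+ n) c)) full @[N --> \oo] --> l.
  by move=> n; have [l] := expectation_cost (z *+ n) bq q01 lam0; exists l.
apply: (@cvg_diff_ge _ u v).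
- by move: cp; under eq_cvg do rewrite (hu _).1 -EFinM; move/fine_cvgP => [].
- by move: cq; under eq_cvg do rewrite (hv _).1 -EFinM; move/fine_cvgP => [].
move=> n n0; rewrite -mulrA -natrM -norm1_mulrn.
apply: (ler_cvg_to (cvg_cst _) (cvgB (hu n).2 (hv n).2)).
by exists (norm1 (z *+ n)) => // N /= nN; exact: h.
Qed.

Lemma annealed_lyapunov_diff (c : R) z :
  annealed_lyapunov Px S Pp omega lam Np -> annealed_lyapunov Px S Pq omega lam Nq ->
  (forall n N, (0 < n)%N -> (norm1 (z *+ n) <= N)%N ->
     c * (norm1 (z *+ n))%:R <=
     ln (Er q (lattice_ball N) (weight lam (z *+ n)) full) -
     ln (Er p (lattice_ball N) (weight lam (z *+ n)) full)) ->
  c * (norm1 z)%:R <= Np (lattice_embed R z) - Nq (lattice_embed R z).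
Proof.
move=> [_ /(_ z) cp] [_ /(_ z) cq] h.
have /choice[u hu] : forall n : nat, exists l : R,
    ('E_Pp[fun o => travel_weight Px S 0 (z *+ n)%R (fun z => omega z o + lam)%R])%E = l%:E /\
    ln (Er p (lattice_ball N) (weight lam (z *+ n)) full) @[N --> \oo] --> ln l.
  by move=> n; have [l] := expectation_weight (z *+ n) bp p01 lam0; exists l.
have /choice[v hv] : forall n : nat, exists l : R,
    ('E_Pq[fun o => travel_weight Px S 0 (z *+ n)%R (fun z => omega z o + lam)%R])%E = l%:E /\
    ln (Er q (lattice_ball N) (weight lam (z *+ n)) full) @[N --> \oo] --> ln l.
  by move=> n; have [l] := expectation_weight (z *+ n) bq q01 lam0; exists l.
apply: (@cvg_diff_ge _ (fun n => - ln (u n)) (fun n => - ln (v n))).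
- by move: cp; under eq_cvg do rewrite (hu _).1 /= -mulrN.
- by move: cq; under eq_cvg do rewrite (hv _).1 /= -mulrN.
move=> n n0; rewrite -mulrA -natrM -norm1_mulrn opprK addrC.
apply: (ler_cvg_to (cvg_cst _) (cvgB (hv n).2 (hu n).2)).
by exists (norm1 (z *+ n)) => // N /= nN; exact: h.
Qed.

End Compare.
End Lyapunov.

Theorem corollary5p2 (R : realType) (d : nat) (q0 : R) :
  (1 <= d)%N -> 0 < q0 < 1 ->
  exists C C' : R, [/\ 0 < C, 0 < C' &
  forall (dW : measure_display) (W : measurableType dW)
    (Px : 'rV[int]_d -> probability W R) (S : nat -> W -> 'rV[int]_d)
    (dO : measure_display) (O : measurableType dO)
    (P : R -> probability O R) (omega : 'rV[int]_d -> {mfun O >-> R})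
    (alpha beta : R -> R -> 'rV[R]_d -> R),
  simple_random_walk Px S ->
  (forall r : R, 0 <= r <= 1 -> bernoulli_potential r (P r) omega) ->
  (forall r lam : R, 0 < r < 1 -> 0 <= lam ->
     quenched_lyapunov Px S (P r) omega lam (alpha r lam)) ->
  (forall r lam : R, 0 < r < 1 -> 0 <= lam ->
     annealed_lyapunov Px S (P r) omega lam (beta r lam)) ->
  let I := fun r : R => rate_function (alpha r) in
  let J := fun r : R => rate_function (beta r) in
  [/\ (* quenched case *)
      (forall p q : R, 0 < p -> p < q -> q < 1 ->
         (((1 - expR (-1)) * (q - p))%:E
            <= ereal_inf (diff_quotients (I p) (I q)))%E) /\
      (forall p q : R, 0 < p -> p < q -> q <= q0 ->
         (ereal_sup (diff_quotients (I p) (I q)) <= (C * (q - p))%:E)%E),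
      (* annealed case *)
      (forall p q : R, 0 < p -> p < q -> q < 1 ->
         (((1 - expR (-1)) * (q - p))%:E
            <= ereal_inf (diff_quotients (J p) (J q)))%E) /\
      (forall p q : R, 0 < p -> p < q -> q <= q0 ->
         (ereal_sup (diff_quotients (J p) (J q)) <= (C' * (ln q - ln p))%:E)%E)
    & (* annealed case, transient dimensions *)
      (3 <= d)%N -> forall p q : R, 0 < p -> p < q -> q <= q0 ->
         (ereal_sup (diff_quotients (J p) (J q)) <= (C' * (q - p))%:E)%E]].
Proof.
move=> d_gt0 q001; have [q00 q01] := andP q001.
have [C C0 hC] := quenched_upper_const q001 d_gt0.
have rc0 : 0 < range_cost q0 d by exact: range_cost_gt0.
pose K : R := (expR (-1) * escape)^-1.
have K0 : 0 <= K by rewrite invr_ge0 mulr_ge0 ?expR_ge0// ltW// escape_gt0.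
(* A sum, so that one constant serves both the logarithmic bound and the linear one for d >= 3;
   [escape] is a number independent of d. *)
exists C, (range_cost q0 d + K * range_cost q0 d); split=> //.
  by rewrite ltr_pwDl// mulr_ge0// ltW.
move=> dW W Px S dO O P omega alpha beta srw bern hal hbe I J.
have closed01 (r : R) : 0 < r -> r < 1 -> 0 <= r <= 1 by move=> *; apply/andP; split; exact: ltW.
have inner n N (z t : 'rV[int]_d) :
    (norm1 (z *+ n) <= N)%N -> (norm1 t < norm1 (z *+ n))%N -> t \in lattice_ball N.
  by move=> zN tz; apply: mem_lattice_ball => //; exact: leq_trans (ltnW tz) zN.
have site_gt0 n (z : 'rV[int]_d) : (0 < n)%N -> z != 0 -> (0 < norm1 (z *+ n))%N.
  by move=> n0 z0; rewrite norm1_mulrn muln_gt0 n0 andbT lt0n norm1_eq0.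
have embed0 : lattice_embed R (0 : 'rV[int]_d) = 0 by apply/rowP => i; rewrite !mxE.
have embedN (z : 'rV[int]_d) : lattice_embed R (- z) = - lattice_embed R z.
  by apply/rowP => i; rewrite !mxE rmorphN.
have annealed (p q D : R) : 0 < p -> p < q -> q <= q0 ->
    (forall lam (y : 'rV[int]_d) s, 0 <= lam -> (0 < norm1 y)%N -> uniq s ->
       ln (Er q s (weight lam y) full) - ln (Er p s (weight lam y) full) <= D * (norm1 y)%:R) ->
    (ereal_sup (diff_quotients (J p) (J q)) <= D%:E)%E.
  move=> p0 pq qq hD; have [_ _ q1] := visit_bounds q001 p0 pq qq.
  have p1 : p < 1 := lt_trans pq q1; have q0' : 0 < q := lt_trans p0 pq.
  have p01 : 0 < p < 1 by rewrite p0.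
  have q01' : 0 < q < 1 by rewrite q0'.
  apply: diff_quotients_le => lam lam0.
  have np := hbe p lam p01 lam0; have nq := hbe q lam q01' lam0.
  apply: norm_diff_le np.1 nq.1 _ => z.
  have [->|z0] := eqVneq z 0.
    by rewrite embed0 (is_norm0 np.1) (is_norm0 nq.1) subrr norm10 mulr0.
  (* An upper bound is a lower bound, with constant - D, for the difference with p and q
     exchanged. *)
  rewrite -lerN2 opprB -mulNr.
  apply: (annealed_lyapunov_diff d_gt0 srw (closed01 _ q0' q1) (closed01 _ p0 p1) lam0
    (bern _ (closed01 _ q0' q1)) (bern _ (closed01 _ p0 p1)) nq np).
  move=> n N n0 zN; rewrite mulNr -[leRHS]opprB lerN2.
  by apply: hD => //; [exact: site_gt0|exact: lattice_ball_uniq].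
split; [split|split|].
- move=> p q p0 pq q1; have p1 : p < 1 := lt_trans pq q1; have q0' : 0 < q := lt_trans p0 pq.
  have p01 : 0 < p < 1 by rewrite p0.
  have q01' : 0 < q < 1 by rewrite q0'.
  apply: diff_quotients_ge => lam lam0.
  apply: norm_diff_ge (hal p lam p01 lam0).1 (hal q lam q01' lam0).1 _ => z.
  apply: (quenched_lyapunov_diff d_gt0 srw (closed01 _ p0 p1) (closed01 _ q0' q1) lam0
    (bern _ (closed01 _ p0 p1)) (bern _ (closed01 _ q0' q1))
    (hal p lam p01 lam0) (hal q lam q01' lam0)) => n N n0 zN.
  by apply: quenched_lower => //; [exact: lattice_ball_uniq|move=> t; exact: inner].
- move=> p q p0 pq qq; have [_ _ q1] := visit_bounds q001 p0 pq qq.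
  have p1 : p < 1 := lt_trans pq q1; have q0' : 0 < q := lt_trans p0 pq.
  have p01 : 0 < p < 1 by rewrite p0.
  have q01' : 0 < q < 1 by rewrite q0'.
  apply: diff_quotients_le => lam lam0.
  have np := hal p lam p01 lam0; have nq := hal q lam q01' lam0.
  apply: norm_diff_le np.1 nq.1 _ => z.
  have [->|z0] := eqVneq z 0.
    by rewrite embed0 (is_norm0 np.1) (is_norm0 nq.1) subrr norm10 mulr0.
  (* In dimension 1 the estimate holds for a positive site; the evenness of norms carries it over to
     z. *)
  have [z' zz' hz'] := hC z z0.
  have -> : norm1 z = norm1 z' by case: zz' => ->; rewrite ?norm1N.
  have -> : alpha p lam (lattice_embed R z) = alpha p lam (lattice_embed R z').
    by case: zz' => ->; rewrite ?embedN ?(is_normN _ np.1).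
  have -> : alpha q lam (lattice_embed R z) = alpha q lam (lattice_embed R z').
    by case: zz' => ->; rewrite ?embedN ?(is_normN _ nq.1).
  rewrite -lerN2 opprB -mulNr.
  apply: (quenched_lyapunov_diff d_gt0 srw (closed01 _ q0' q1) (closed01 _ p0 p1) lam0
    (bern _ (closed01 _ q0' q1)) (bern _ (closed01 _ p0 p1)) nq np) => n N n0 zN.
  rewrite mulNr -[leRHS]opprB lerN2 mulrAC.
  by apply: hz' => //; exact: lattice_ball_uniq.
- move=> p q p0 pq q1; have p1 : p < 1 := lt_trans pq q1; have q0' : 0 < q := lt_trans p0 pq.
  have p01 : 0 < p < 1 by rewrite p0.
  have q01' : 0 < q < 1 by rewrite q0'.
  apply: diff_quotients_ge => lam lam0.
  apply: norm_diff_ge (hbe p lam p01 lam0).1 (hbe q lam q01' lam0).1 _ => z.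
  apply: (annealed_lyapunov_diff d_gt0 srw (closed01 _ p0 p1) (closed01 _ q0' q1) lam0
    (bern _ (closed01 _ p0 p1)) (bern _ (closed01 _ q0' q1))
    (hbe p lam p01 lam0) (hbe q lam q01' lam0)) => n N n0 zN.
  by apply: annealed_lower => //; [exact: lattice_ball_uniq|move=> t; exact: inner].
- move=> p q p0 pq qq; have [vq v1 q1] := visit_bounds q001 p0 pq qq.
  apply: annealed => // lam y s lam0 L0 us.
  apply: le_trans (annealed_upper d_gt0 lam0 us L0 vq v1 p0 pq q1) _.
  rewrite mulrAC -/(range_cost q0 d) ler_wpM2r// ler_wpM2r//.
    by rewrite subr_ge0 ler_ln ?posrE ?(lt_trans p0 pq)// ltW.
  by rewrite lerDl mulr_ge0// ltW.
- move=> d3 p q p0 pq qq; have [vq v1 q1] := visit_bounds q001 p0 pq qq.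
  apply: annealed => // lam y s lam0 L0 us.
  have ratio c z := ratio_transient d_gt0 y lam0 d3 z c.
  apply: le_trans (annealed_upper_ratio d_gt0 lam0 K0 ratio us L0 vq v1 p0 pq q1) _.
  rewrite mulrAC -/(range_cost q0 d) ler_wpM2r// ler_wpM2r//; first by rewrite subr_ge0 ltW.
  by rewrite lerDr ltW.
Qed.
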